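(* Let $H$ be a crossed Hopf $\pi$-coalgebra of finite type. Then $D(H)$, with the product, unit, comultiplication, counit, antipode and conjugation described in the context, is a crossed Hopf $\pi$-coalgebra. Moreover, for each $\alpha\in\pi$ the multiplication of $D_\alpha(H)$ is the unique one for which the maps $H_{\alpha^{-1}}\to D_\alpha(H)$, $h\mapsto h\circledast\varepsilon$, and $A\to D_\alpha(H)$, $F\mapsto1_{\alpha^{-1}}\circledast F$, are algebra morphisms and, for all $h\in H_{\alpha^{-1}}$ and $f\in H^*_\gamma$ ($\gamma\in\pi$), $$(1_{\alpha^{-1}}\circledast f)(h\circledast\varepsilon)=h\circledast f,\qquad (h\circledast\varepsilon)(1_{\alpha^{-1}}\circledast f)=h''_{(\alpha^{-1})}\circledast\bigl\langle f,\,s_\gamma^{-1}(h'''_{(\gamma^{-1})})\,\underline{\ \ }\,\varphi_\alpha(h'_{(\alpha^{-1}\gamma\alpha)})\bigr\rangle .$$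
   Context: Let $\Bbbk$ be a field and $\pi$ a group. A crossed Hopf $\pi$-coalgebra $H$ consists of: associative unital $\Bbbk$-algebras $H_\alpha$ ($\alpha\in\pi$, unit $1_\alpha$); coassociative algebra morphisms $\Delta_{\alpha,\beta}\colon H_{\alpha\beta}\to H_\alpha\otimes H_\beta$ (i.e. $(\mathrm{id}\otimes\Delta_{\beta,\gamma})\Delta_{\alpha,\beta\gamma}=(\Delta_{\alpha,\beta}\otimes\mathrm{id})\Delta_{\alpha\beta,\gamma}$); an algebra morphism $\varepsilon\colon H_1\to\Bbbk$ with $(\varepsilon\otimes\mathrm{id})\Delta_{1,\alpha}=\mathrm{id}=(\mathrm{id}\otimes\varepsilon)\Delta_{\alpha,1}$; algebra isomorphisms $\varphi_\beta\colon H_\alpha\to H_{\beta\alpha\beta^{-1}}$ with $\varphi_\beta\varphi_\gamma=\varphi_{\beta\gamma}$, $\Delta\varphi_\gamma=(\varphi_\gamma\otimes\varphi_\gamma)\Delta$, $\varepsilon\varphi_\gamma=\varepsilon$; linear maps $s_\alpha\colon H_\alpha\to H_{\alpha^{-1}}$ with $\mu_\alpha(s_{\alpha^{-1}}\otimes\mathrm{id})\Delta_{\alpha^{-1},\alpha}=1_\alpha\varepsilon=\mu_\alpha(\mathrm{id}\otimes s_{\alpha^{-1}})\Delta_{\alpha,\alpha^{-1}}$. Finite type: each $H_\alpha$ finite-dimensional (then each $s_\alpha$ is bijective). Notation: $\Delta_{\alpha,\beta}(h)=h'_{(\alpha)}\otimes h''_{(\beta)}$; iterated: $h'_{(\alpha_1)}\otimes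 h''_{(\alpha_2)}\otimes h'''_{(\alpha_3)}=(\mathrm{id}\otimes\Delta_{\alpha_2,\alpha_3})\Delta_{\alpha_1,\alpha_2\alpha_3}(h)$. Let $A=\bigoplus_{\beta\in\pi}H_\beta^*$, an algebra with product $\langle fg,h\rangle=\langle f\otimes g,\Delta_{\alpha,\beta}(h)\rangle$ ($f\in H_\alpha^*,g\in H_\beta^*,h\in H_{\alpha\beta}$) and unit $\varepsilon$; with coproduct $\Delta_*(f)=f'\otimes f''$, $\langle\Delta_*(f),h\otimes k\rangle=\langle f,kh\rangle$ for $f\in H_\alpha^*$, $h,k\in H_\alpha$; antipode $\langle s_*(f),h\rangle=\langle f,s_\alpha^{-1}(h)\rangle$ for $f\in H^*_\alpha$, $h\in H_{\alpha^{-1}}$. For $g\in H^*_\delta$ and $a,b\in H_\delta$, $\langle g,a\,\underline{\ \ }\,b\rangle\in H_\delta^*$ denotes $x\mapsto g(axb)$. Definition of $D(H)$: $D_\alpha(H)=H_{\alpha^{-1}}\otimes A$, elements written $h\circledast F$. Product, for $h,k\in H_{\alpha^{-1}}$, $f\in H^*_\gamma$, $g\in H^*_\delta$: $(h\circledast f)(k\circledast g)=h''_{(\alpha^{-1})}k\circledast f\bigl\langle g,\,s_\delta^{-1}(h'''_{(\delta^{-1})})\,\underline{\ \ }\,\varphi_\alpha(h'_{(\alpha^{-1}\delta\alpha)})\bigr\rangle$; unit $1_{\alpha^{-1}}\circledast\varepsilon$. Comultiplication, for $h\in H_{\beta^{-1}\alpha^{-1}}$, $F\in A$: $\Delta_{\alpha,\beta}(h\circledast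 F)=\bigl(\varphi_\beta(h'_{(\beta^{-1}\alpha^{-1}\beta)})\circledast F'\bigr)\otimes\bigl(h''_{(\beta^{-1})}\circledast F''\bigr)$. Counit on $D_1(H)$: $\varepsilon(h\circledast f)=\varepsilon(h)f(1_\gamma)$ for $f\in H^*_\gamma$. Antipode $s_\alpha\colon D_\alpha(H)\to D_{\alpha^{-1}}(H)$: $s_\alpha(h\circledast F)=\bigl((\varphi_\alpha\circ s_{\alpha^{-1}})(h)\circledast\varepsilon\bigr)\bigl(1_\alpha\circledast s_*(F)\bigr)$. Conjugation $\varphi_\beta\colon D_\alpha(H)\to D_{\beta\alpha\beta^{-1}}(H)$: $\varphi_\beta(h\circledast f)=\varphi_\beta(h)\circledast(f\circ\varphi_{\beta^{-1}})$. *)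

(* Defs.v *)
From HB Require Import structures.
From mathcomp Require Import all_boot all_algebra all_fingroup.
From mathcomp Require Import boolp.

Set Implicit Arguments.
Unset Strict Implicit.
Unset Printing Implicit Defensive.

Import GRing.Theory.

(* Group identities used for the (unavoidable) type casts H_a -> H_b, a = b *)
Section GroupId.
Local Open Scope group_scope.
Variable G : groupType.
Implicit Types a b c g e : G.
Lemma gconj_comp b g a : (b * g) * a * (b * g)^-1 = b * (g * a * g^-1) * b^-1.
Proof. by rewrite invgM !mulgA. Qed.
Lemma gconj_mul g a b : g * (a * b) * g^-1 = (g * a * g^-1) * (g * b * g^-1).
Proof. by rewrite !mulgA mulgVK. Qed.
Lemma gconj1 g : g * 1 * g^-1 = 1.
Proof. by rewrite mulg1 mulgV. Qed.
Lemma gD1 a e : a^-1 = (a^-1 * e * a) * (a^-1 * e^-1).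
Proof. by rewrite !mulgA mulgK mulgK. Qed.
Lemma gD2 a e : a * (a^-1 * e * a) * a^-1 = e.
Proof. by rewrite !mulgA mulgV mul1g mulgK. Qed.
Lemma gE1 a b : (a * b)^-1 = (b^-1 * a^-1 * b) * b^-1.
Proof. by rewrite invgM mulgK. Qed.
Lemma gE2 a b : b * (b^-1 * a^-1 * b) * b^-1 = a^-1.
Proof. by rewrite !mulgA mulgV mul1g mulgK. Qed.
Lemma gF a : a * a * a^-1 = a^-1^-1.
Proof. by rewrite mulgK invgK. Qed.
Lemma gG b a : b * a^-1 * b^-1 = (b * a * b^-1)^-1.
Proof. by rewrite !invgM invgK !mulgA. Qed.
Lemma gH b g : b^-1 * (b * g * b^-1) * b^-1^-1 = g.
Proof. by rewrite invgK !mulgA mulVg mul1g mulgVK. Qed.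
End GroupId.

Local Open Scope ring_scope.

Definition trl (k : fieldType) (pi : groupType) (V : pi -> lmodType k) (a b : pi)
  (e : a = b) (x : V a) : V b := eq_rect a (fun c => (V c : Type)) x b e.
Arguments trl {k pi} V {a b} e x.

(* Tensors.  An element of U (x) W is written as a finite Sweedler sum       *)
(* sum_i u_i (x) w_i, i.e. a list of pairs; two such lists denote the same   *)
(* tensor iff they pair identically with every f (x) g, f in U^*, g in W^*   *)
(* (over a field this is exactly equality in U (x) W).                       *)
Section Tensor.
Variable k : fieldType.

Definition teq2 (U W : lmodType k) (s t : seq (U * W)) : Prop :=
  forall (f : {scalar U}) (g : {scalar W}),
    \sum_(p <- s) f p.1 * g p.2 = \sum_(p <- t) f p.1 * g p.2.

Definition teq3 (U W X : lmodType k) (s t : seq (U * W * X)) : Prop :=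
  forall (f : {scalar U}) (g : {scalar W}) (h : {scalar X}),
    \sum_(p <- s) f p.1.1 * g p.1.2 * h p.2 =
    \sum_(p <- t) f p.1.1 * g p.1.2 * h p.2.

Definition klinear (U W : lmodType k) (f : U -> W) : Prop :=
  forall (c : k) (x y : U), f (c *: x + y) = c *: f x + f y.

End Tensor.

Record chc_data (k : fieldType) (pi : groupType) (V : pi -> lmodType k) := CHCData {
  cmul   : forall a : pi, V a -> V a -> V a;
  cone   : forall a : pi, V a;
  cDelta : forall a b : pi, V (a * b)%g -> seq (V a * V b);
  ceps   : V 1%g -> k;
  cphi   : forall b a : pi, V a -> V (b * a * b^-1)%g;
  cS     : forall a : pi, V a -> V a^-1%g
}.

Arguments cmul {k pi V} c a.
Arguments cone {k pi V} c a.
Arguments cDelta {k pi V} c a b.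
Arguments ceps {k pi V} c.
Arguments cphi {k pi V} c b a.
Arguments cS {k pi V} c a.

Record is_chc (k : fieldType) (pi : groupType) (V : pi -> lmodType k)
    (d : chc_data V) : Prop := IsCHC {
  mul_linl : forall a (c : k) (x y z : V a),
    cmul d a (c *: x + y) z = c *: cmul d a x z + cmul d a y z;
  mul_linr : forall a (c : k) (x y z : V a),
    cmul d a z (c *: x + y) = c *: cmul d a z x + cmul d a z y;
  mul_assoc : forall a (x y z : V a),
    cmul d a x (cmul d a y z) = cmul d a (cmul d a x y) z;
  mul_1l : forall a (x : V a), cmul d a (cone d a) x = x;
  mul_1r : forall a (x : V a), cmul d a x (cone d a) = x;
  Delta_lin : forall a b (c : k) (x y : V (a * b)%g),
    teq2 (cDelta d a b (c *: x + y))
         ([seq (c *: p.1, p.2) | p <- cDelta d a b x] ++ cDelta d a b y);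
  Delta_mul : forall a b (x y : V (a * b)%g),
    teq2 (cDelta d a b (cmul d (a * b)%g x y))
         [seq (cmul d a p.1 q.1, cmul d b p.2 q.2)
            | p <- cDelta d a b x, q <- cDelta d a b y];
  Delta_one : forall a b,
    teq2 (cDelta d a b (cone d (a * b)%g)) [:: (cone d a, cone d b)];
  coassoc : forall a b c (x : V (a * (b * c))%g),
    teq3 [seq (p.1, q.1, q.2) | p <- cDelta d a (b * c)%g x, q <- cDelta d b c p.2]
         [seq (q.1, q.2, p.2) | p <- cDelta d (a * b)%g c (trl V (mulgA a b c) x),
                                q <- cDelta d a b p.1];
  eps_lin : forall (c : k) (x y : V 1%g), ceps d (c *: x + y) = c * ceps d x + ceps d y;
  eps_mul : forall x y : V 1%g, ceps d (cmul d 1%g x y) = ceps d x * ceps d y;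
  eps_one : ceps d (cone d 1%g) = 1;
  counit_l : forall a (x : V a),
    \sum_(p <- cDelta d 1%g a (trl V (esym (mul1g a)) x)) ceps d p.1 *: p.2 = x;
  counit_r : forall a (x : V a),
    \sum_(p <- cDelta d a 1%g (trl V (esym (mulg1 a)) x)) ceps d p.2 *: p.1 = x;
  phi_lin : forall b a, klinear (cphi d b a);
  phi_mul : forall b a (x y : V a),
    cphi d b a (cmul d a x y) = cmul d _ (cphi d b a x) (cphi d b a y);
  phi_one : forall b a, cphi d b a (cone d a) = cone d _;
  phi_bij : forall b a, bijective (cphi d b a);
  phi_comp : forall b g a (x : V a),
    cphi d b _ (cphi d g a x) = trl V (gconj_comp b g a) (cphi d (b * g)%g a x);
  phi_Delta : forall g a b (x : V (a * b)%g),
    teq2 (cDelta d _ _ (trl V (gconj_mul g a b) (cphi d g (a * b)%g x)))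
         [seq (cphi d g a p.1, cphi d g b p.2) | p <- cDelta d a b x];
  eps_phi : forall g (x : V 1%g), ceps d (trl V (gconj1 g) (cphi d g 1%g x)) = ceps d x;
  S_lin : forall a, klinear (cS d a);
  antipode_l : forall a (x : V 1%g),
    \sum_(p <- cDelta d a^-1%g a (trl V (esym (mulVg a)) x))
       cmul d a (trl V (invgK a) (cS d a^-1%g p.1)) p.2 = ceps d x *: cone d a;
  antipode_r : forall a (x : V 1%g),
    \sum_(p <- cDelta d a a^-1%g (trl V (esym (mulgV a)) x))
       cmul d a p.1 (trl V (invgK a) (cS d a^-1%g p.2)) = ceps d x *: cone d a
}.

Section FSec.
Variables (K : pzRingType) (I : eqType) (V : I -> lmodType K).

Definition fin_supp (F : forall i, V i) : Prop :=
  exists s : seq I, forall i, i \notin s -> F i = 0.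

Record fsec := FSec { fsec_val :> forall i, V i; fsec_supp : fin_supp fsec_val }.

HB.instance Definition _ := gen_eqMixin fsec.
HB.instance Definition _ := gen_choiceMixin fsec.

Lemma fsecP (F G : fsec) : (forall i, F i = G i) -> F = G.
Proof.
case: F G => f fP [g gP] /= fg.
have e : f = g by apply: functional_extensionality_dep.
subst g; congr FSec; exact: Prop_irrelevance.
Qed.

Lemma fsec0_supp : fin_supp (fun i => 0 : V i).
Proof. by exists [::]. Qed.
Definition fsec0 := FSec fsec0_supp.

Lemma fsecN_supp (F : fsec) : fin_supp (fun i => - F i).
Proof. by case: F => f [s fs] /=; exists s => i /fs ->; rewrite oppr0. Qed.
Definition fsecN F := FSec (fsecN_supp F).

Lemma fsecD_supp (F G : fsec) : fin_supp (fun i => F i + G i).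
Proof.
case: F G => f [s fs] [g [t gt]] /=; exists (s ++ t) => i.
by rewrite mem_cat negb_or => /andP[/fs -> /gt ->]; rewrite addr0.
Qed.
Definition fsecD F G := FSec (fsecD_supp F G).

Lemma fsecZ_supp (c : K) (F : fsec) : fin_supp (fun i => c *: F i).
Proof. by case: F => f [s fs] /=; exists s => i /fs ->; rewrite scaler0. Qed.
Definition fsecZ c F := FSec (fsecZ_supp c F).

Lemma fsecDA : associative fsecD.
Proof. by move=> F G H; apply: fsecP => i /=; rewrite addrA. Qed.
Lemma fsecDC : commutative fsecD.
Proof. by move=> F G; apply: fsecP => i /=; rewrite addrC. Qed.
Lemma fsec0D : left_id fsec0 fsecD.
Proof. by move=> F; apply: fsecP => i /=; rewrite add0r. Qed.
Lemma fsecND : left_inverse fsec0 fsecN fsecD.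
Proof. by move=> F; apply: fsecP => i /=; rewrite addNr. Qed.

HB.instance Definition _ := GRing.isZmodule.Build fsec fsecDA fsecDC fsec0D fsecND.

Lemma fsecZA a b (F : fsec) : fsecZ a (fsecZ b F) = fsecZ (a * b) F.
Proof. by apply: fsecP => i /=; rewrite scalerA. Qed.
Lemma fsecZ1 : left_id 1 fsecZ.
Proof. by move=> F; apply: fsecP => i /=; rewrite scale1r. Qed.
Lemma fsecZDr : right_distributive fsecZ +%R.
Proof. by move=> c F G; apply: fsecP => i /=; rewrite scalerDr. Qed.
Lemma fsecZDl (F : fsec) : {morph fsecZ^~ F : a b / a + b}.
Proof. by move=> a b; apply: fsecP => i /=; rewrite scalerDl. Qed.

HB.instance Definition _ := GRing.Zmodule_isLmodule.Build K fsec fsecZA fsecZ1 fsecZDr fsecZDl.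

Definition dsingle (j : I) (v : V j) : forall i, V i :=
  fun i => if j =P i is ReflectT e then eq_rect j V v i e else 0.

Lemma dsingle_supp j v : fin_supp (@dsingle j v).
Proof.
exists [:: j] => i; rewrite inE => ni; rewrite /dsingle.
by case: eqP => // e; rewrite e eqxx in ni.
Qed.
Definition fsingle j v : fsec := FSec (@dsingle_supp j v).

End FSec.

Section Double.
Variables (k : fieldType) (pi : groupType) (H : pi -> vectType k).

Definition Hl : pi -> lmodType k := fun a => (H a : lmodType k).

Definition dual (g : pi) := 'Hom(H g, k^o).

(* D_a(H) = H_{a^-1} (x) A, with A = (+)_{b} H_b^*, realised (canonically,  *)
(* H_b being finite dimensional) as (+)_b H_{a^-1} (x) H_b^* = (+)_b Hom(H_b, H_{a^-1}) *)
Definition Dc (a : pi) : lmodType k :=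
  fsec (fun b : pi => ('Hom(H b, H a^-1%g) : lmodType k)).

Definition dot (a : pi) (g : pi) (h : H a^-1%g) (f : dual g) : Dc a :=
  @fsingle k pi (fun b : pi => ('Hom(H b, H a^-1%g) : lmodType k)) g
    (linfun (fun x : H g => (f x : k) *: h)).

Variable d : chc_data Hl.

Definition epsH : dual 1%g := linfun (fun x : H 1%g => (ceps d x : k^o)).

Definition dmul (g e : pi) (f : dual g) (f' : dual e) : dual (g * e)%g :=
  linfun (fun x : H (g * e)%g =>
    (\sum_(p <- cDelta d g e x) (f p.1 : k) * (f' p.2 : k) : k^o)).

Definition sand (e : pi) (f : dual e) (u w : H e) : dual e :=
  linfun (fun x : H e => f (cmul d e (cmul d e u x) w)).

Definition sinv (e : pi) (y : H e^-1%g) : H e := ((linfun (cS d e : H e -> H e^-1%g))^-1)%VF y.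

Definition sstar (g : pi) (f : dual g) : dual g^-1%g :=
  linfun (fun y : H g^-1%g => f (sinv y)).

Definition fphi (b g : pi) (f : dual g) : dual (b * g * b^-1)%g :=
  linfun (fun x : H (b * g * b^-1)%g => f (trl Hl (gH b g) (cphi d b^-1%g _ x))).

Definition Dprod_rhs (a c e : pi) (h h2 : H a^-1%g) (f : dual c) (f2 : dual e) : Dc a :=
  \sum_(p <- cDelta d (a^-1 * e * a)%g (a^-1 * e^-1)%g (trl Hl (gD1 a e) h))
    \sum_(q <- cDelta d a^-1%g e^-1%g p.2)
       dot (cmul d a^-1%g q.1 h2)
           (dmul f (sand f2 (sinv q.2) (trl Hl (gD2 a e) (cphi d a _ p.1)))).

Definition Dmix_rhs (a e : pi) (h : H a^-1%g) (f : dual e) : Dc a :=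
  \sum_(p <- cDelta d (a^-1 * e * a)%g (a^-1 * e^-1)%g (trl Hl (gD1 a e) h))
    \sum_(q <- cDelta d a^-1%g e^-1%g p.2)
       dot q.1 (sand f (sinv q.2) (trl Hl (gD2 a e) (cphi d a _ p.1))).

Record D_formulas (D : chc_data Dc) : Prop := DFormulas {
  Dmul_def : forall a c e (h h2 : H a^-1%g) (f : dual c) (f2 : dual e),
    cmul D a (dot h f) (dot h2 f2) = Dprod_rhs h h2 f f2;
  Done_def : forall a, cone D a = dot (cone d a^-1%g) epsH;
  DDelta_def : forall a b c (h : H (a * b)^-1%g) (f : dual c)
      (L : seq (dual c * dual c)),
    (* L is a Sweedler representation of Delta_*(f) = f' (x) f'' *)
    (forall x y : H c, \sum_(l <- L) (l.1 x : k) * (l.2 y : k) = f (cmul d c y x)) ->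
    teq2 (cDelta D a b (dot h f))
      [seq (dot (trl Hl (gE2 a b) (cphi d b _ p.1)) l.1, dot p.2 l.2)
         | p <- cDelta d (b^-1 * a^-1 * b)%g b^-1%g (trl Hl (gE1 a b) h), l <- L];
  Deps_def : forall c (h : H 1^-1%g) (f : dual c),
    ceps D (dot h f) = ceps d (trl Hl (invg1 pi) h) * f (cone d c);
  DS_def : forall a c (h : H a^-1%g) (f : dual c),
    cS D a (dot h f) =
      cmul D a^-1%g
        (dot (trl Hl (gF a) (cphi d a a (trl Hl (invgK a) (cS d a^-1%g h)))) epsH)
        (dot (trl Hl (esym (invgK a)) (cone d a)) (sstar f));
  Dphi_def : forall b a c (h : H a^-1%g) (f : dual c),
    cphi D b a (dot h f) = dot (trl Hl (gG b a) (cphi d b a^-1%g h)) (fphi b f)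
}.

Record Dmul_char (a : pi) (m : Dc a -> Dc a -> Dc a) : Prop := DMulChar {
  mc_linl : forall (c : k) (x y z : Dc a), m (c *: x + y) z = c *: m x z + m y z;
  mc_linr : forall (c : k) (x y z : Dc a), m z (c *: x + y) = c *: m z x + m z y;
  mc_assoc : forall x y z : Dc a, m x (m y z) = m (m x y) z;
  mc_1l : forall x : Dc a, m (dot (cone d a^-1%g) epsH) x = x;
  mc_1r : forall x : Dc a, m x (dot (cone d a^-1%g) epsH) = x;
  mc_Hmorph : forall h h2 : H a^-1%g,
    m (dot h epsH) (dot h2 epsH) = dot (cmul d a^-1%g h h2) epsH;
  mc_Amorph : forall c e (f : dual c) (f2 : dual e),
    m (dot (cone d a^-1%g) f) (dot (cone d a^-1%g) f2)
      = dot (cone d a^-1%g) (dmul f f2);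
  mc_AH : forall c (h : H a^-1%g) (f : dual c),
    m (dot (cone d a^-1%g) f) (dot h epsH) = dot h f;
  mc_HA : forall c (h : H a^-1%g) (f : dual c),
    m (dot h epsH) (dot (cone d a^-1%g) f) = Dmix_rhs h f
}.

End Double.

(* Main.v *)
(* D_a(H) is the sum over c of the spaces Hom(H_c, H_(a^-1)), and every structure map has a
   closed form on homogeneous elements: (X Y)(x) = h'' Y(S^-1(h''') x'' phi_a(h')) with
   h = X(x'), and Delta(X)(x, y) = (phi_b (x) id) Delta(X(y x)).  Left multiplication by h is
   compatible with the product of H and with X Y, whence associativity; multiplicativity of the
   coproduct comes from the cancellation of S^-1(phi_b(h3)) against phi_b(h4).  The antipode
   axioms follow from associativity, since h # f = (1 # f)(h # eps) and
   S(h # f) = S(h # eps) S(1 # f).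

   All this needs S to be bijective.  As for finite-dimensional Hopf algebras, the traces of
   e |-> x S^2(e') f(e'') form left integrals, not all zero, and pairing them with S(h) shows
   that S is injective; it is bijective by comparing dimensions.

   Uniqueness: (h # f)(g # f') = (1 # f)(h # eps)(1 # f')(g # eps) is determined by the mixed
   relation and the products of H and A. *)

Require Import Defs.
From HB Require Import structures.
From mathcomp Require Import all_boot all_algebra all_fingroup.
From mathcomp Require Import boolp.

Set Implicit Arguments.
Unset Strict Implicit.
Unset Printing Implicit Defensive.

Import GRing.Theory.
Local Open Scope ring_scope.

(** Two features of the encoding shape the proof. Tensors are lists known only through their
    pairings with functionals, so an identity of tensors is always tested: it becomes an identity
    between Sweedler sums of a multilinear function. These sums are taken in coordinates, which
    depend linearly on their argument and may be interchanged and reassociated for any function.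
    Indices such as b a b^-1 occur in types, so the operations are restated with a free target
    index, and each law asks only for equations in the group. Reading h # f as a map X in Hom(H_c,
    H_(a^-1)) turns product and coproduct into formulas in the values X(x); dual bases return only
    where a tensor has to be listed. S^-1 enters the product as the generic inverse of a linear map,
    which means something only once S is known to be bijective; this is why the integrals come
    before D(H). The square of S in the trace has this origin: a right factor can be moved through a
    coproduct when it has the form S(h), and h must itself be S(e') for what remains to contract
    with the legs of a basis vector. *)

Ltac grp := subst; rewrite ?(invgM, invgK, invg1, mulgA, mulg1, mul1g, mulgV, mulVg, mulgK, mulgVK); reflexivity.

(** * Linear maps, casts and Sweedler sums *)

Section Klinear.
Variable k : fieldType.
Implicit Types U V W : lmodType k.

Definition bilin U V W (F : U -> V -> W) :=
  (forall v, klinear (fun u => F u v)) /\ (forall u, klinear (fun v => F u v)).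

Lemma klin0 U V (f : U -> V) : klinear f -> f 0 = 0.
Proof. by move=> h; have := h (-1) 0 0; rewrite addr0 !scaleN1r oppr0 addNr. Qed.

Lemma klinD U V (f : U -> V) x y : klinear f -> f (x + y) = f x + f y.
Proof. by move=> h; have := h 1 x y; rewrite !scale1r. Qed.

Lemma klinZ U V (f : U -> V) c x : klinear f -> f (c *: x) = c *: f x.
Proof. by move=> h; have := h c x 0; rewrite (klin0 h) !addr0. Qed.

Lemma klin_sum_arg U V (f : U -> V) I (r : seq I) (P : pred I) F :
  klinear f -> f (\sum_(i <- r | P i) F i) = \sum_(i <- r | P i) f (F i).
Proof. by move=> h; apply: (big_morph f (fun x y => klinD x y h) (klin0 h)). Qed.

Lemma klin_id U : klinear (fun x : U => x). Proof. by []. Qed.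
Lemma klin_zero U V : klinear (fun x : U => 0 : V).
Proof. by move=> c x y; rewrite scaler0 addr0. Qed.

Lemma klin_comp U V W (g : V -> W) (f : U -> V) :
  klinear g -> klinear f -> klinear (fun x => g (f x)).
Proof. by move=> hg hf c x y; rewrite hf hg. Qed.

Lemma klin_add U V (f g : U -> V) :
  klinear f -> klinear g -> klinear (fun x => f x + g x).
Proof. by move=> hf hg c x y; rewrite hf hg scalerDr addrACA. Qed.

Lemma klin_sum U V I (r : seq I) (P : pred I) (F : I -> U -> V) :
  (forall i, klinear (F i)) -> klinear (fun x => \sum_(i <- r | P i) F i x).
Proof.
move=> h c x y; rewrite scaler_sumr -big_split /=.
by apply: eq_bigr => i _; apply: h.
Qed.

Lemma klin_scale U V (c : k) (f : U -> V) :
  klinear f -> klinear (fun x => c *: f x).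
Proof. by move=> hf a x y; rewrite hf scalerDr !scalerA mulrC. Qed.

Lemma klin_scalel U V (f : U -> k^o) (v : V) :
  klinear f -> klinear (fun x => (f x : k) *: v).
Proof. by move=> hf a x y; rewrite hf scalerDl scalerA. Qed.

Lemma klin_mulr U (c : k) (f : U -> k^o) :
  klinear f -> klinear (fun x => (c * (f x : k) : k^o)).
Proof. exact: (@klin_scale U k^o). Qed.

Lemma klin_mull U (c : k) (f : U -> k^o) :
  klinear f -> klinear (fun x => ((f x : k) * c : k^o)).
Proof. by move=> hf a x y; rewrite hf mulrDl -[a *: f x]/(a * f x) -mulrA. Qed.

End Klinear.

Section Basis.
Variable k : fieldType.
Implicit Types U V : vectType k.
Implicit Type W : lmodType k.

Definition bs V (i : 'I_(\dim {:V})) : V := (vbasis {:V})`_i.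
Definition cf V (i : 'I_(\dim {:V})) (x : V) : k := coord (vbasis {:V}) i x.

Lemma cf_lin V i : klinear (@cf V i : V -> k^o).
Proof. by move=> c x y; rewrite /cf linearP. Qed.

Lemma basisE V (x : V) : x = \sum_i cf i x *: bs i.
Proof. exact/coord_vbasis/memvf. Qed.

Lemma klin_basis V W (f : V -> W) x : klinear f -> f x = \sum_i cf i x *: f (bs i).
Proof.
move=> hf; rewrite {1}(basisE x) klin_sum_arg //.
by apply: eq_bigr => i _; rewrite klinZ.
Qed.

Lemma bilin_basis U V W (F : U -> V -> W) u v : bilin F ->
  F u v = \sum_i \sum_j (cf i u * cf j v) *: F (bs i) (bs j).
Proof.
move=> [h1 h2]; rewrite (klin_basis u (h1 v)); apply: eq_bigr => i _.
rewrite (klin_basis v (h2 _)) scaler_sumr.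
by apply: eq_bigr => j _; rewrite scalerA.
Qed.

(** [teq2] tests only products of two scalar functionals, while F takes values in any W. Expanding
    both arguments in bases leaves products of coordinates, which are such tests. *)
Lemma teq2_bilin U V W (F : U -> V -> W) (s t : seq (U * V)) : bilin F ->
  teq2 s t -> \sum_(p <- s) F p.1 p.2 = \sum_(p <- t) F p.1 p.2.
Proof.
move=> hF st.
have E r : \sum_(p <- r) F p.1 p.2 =
    \sum_i \sum_j (\sum_(p <- r) cf i p.1 * cf j p.2) *: F (bs i) (bs j).
  under eq_bigr => p _ do rewrite (bilin_basis _ _ hF).
  rewrite exchange_big; apply: eq_bigr => i _.
  rewrite exchange_big; apply: eq_bigr => j _.
  by rewrite scaler_suml.
rewrite !E; apply: eq_bigr => i _; apply: eq_bigr => j _; congr (_ *: _).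
exact: (st (coord (vbasis {:U}) i) (coord (vbasis {:V}) j)).
Qed.

End Basis.

Section Casts.
Variables (k : fieldType) (pi : groupType) (H : pi -> vectType k).

(* The cast H_a -> H_b, extended by 0 when a <> b: being total, it keeps proofs of group
   identities out of the terms. *)
Definition cst (a b : pi) (x : H a) : H b :=
  if a =P b is ReflectT e then trl (Hl H) e x else 0.
Arguments cst {a} b x.

(** Equality on the index group is decidable, so its proofs are unique and every cast, along
    whatever proof, is [cst]. *)
Lemma trlE a b (e : a = b) (x : H a) : trl (Hl H) e x = cst b x.
Proof.
by rewrite /cst; case: eqP => [e'|//]; rewrite (eq_irrelevance e' e).
Qed.

Lemma cst_id a (x : H a) : cst a x = x.
Proof. by rewrite -(trlE erefl). Qed.

Lemma cst_lin a b : klinear (@cst a b).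
Proof.
rewrite /cst; case: eqP => [e|_]; last exact: klin_zero.
by subst b.
Qed.

Lemma cst_cst a b c (x : H a) : a = b -> cst c (cst b x) = cst c x.
Proof. by move=> e; subst b; rewrite cst_id. Qed.

End Casts.
Arguments cst {k pi H a} b x.

(** * Operations with free indices and Sweedler sums in coordinates *)

Section Wrap.
Variables (k : fieldType) (pi : groupType) (H : pi -> vectType k).
Variable d : chc_data (Hl H).
Hypothesis hd : is_chc d.

Definition mu a (x y : H a) : H a := cmul d a x y.
Definition oneH a : H a := cone d a.
(** [ep], [ph] and [sa] accept indices that are only provably of the right shape; the laws below
    carry the index equations as hypotheses, to be discharged by [grp]. *)
Definition ep a (x : H a) : k := ceps d (cst 1%g x).
Definition ph b a c (x : H a) : H c := cst c (cphi d b a x : H _).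
Definition sa a c (x : H a) : H c := cst c (cS d a x : H _).
Arguments oneH {a}.
Arguments ph b {a c} x.
Arguments sa {a c} x.

Lemma muA a (x y z : H a) : mu x (mu y z) = mu (mu x y) z.
Proof. exact: (mul_assoc hd). Qed.
Lemma mu1l a (x : H a) : mu oneH x = x. Proof. exact: (mul_1l hd). Qed.
Lemma mu1r a (x : H a) : mu x oneH = x. Proof. exact: (mul_1r hd). Qed.

Lemma klin_mul_l (U : lmodType k) a (f : U -> H a) y :
  klinear f -> klinear (fun x => mu (f x) y).
Proof. by move=> hf c u v; rewrite hf; apply: (mul_linl hd). Qed.
Lemma klin_mul_r (U : lmodType k) a (f : U -> H a) y :
  klinear f -> klinear (fun x => mu y (f x)).
Proof. by move=> hf c u v; rewrite hf; apply: (mul_linr hd). Qed.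

Lemma ep_lin a : klinear (@ep a : H a -> k^o).
Proof. by move=> c x y; rewrite /ep cst_lin; apply: (eps_lin hd). Qed.
Lemma ph_lin b a c : klinear (@ph b a c).
Proof. by move=> t x y; rewrite /ph (phi_lin hd) cst_lin. Qed.
Lemma sa_lin a c : klinear (@sa a c).
Proof. by move=> t x y; rewrite /sa (S_lin hd) cst_lin. Qed.

Lemma one_cst a b : a = b -> cst b (oneH : H a) = oneH.
Proof. by move=> e; subst b; rewrite cst_id. Qed.

Lemma ep_mu a (x y : H a) : a = 1%g -> ep (mu x y) = ep x * ep y.
Proof. by move=> e; subst a; rewrite /ep !cst_id; apply: (eps_mul hd). Qed.
Lemma ep_one a : a = 1%g -> ep (oneH : H a) = 1.
Proof. by move=> e; subst a; rewrite /ep cst_id; apply: (eps_one hd). Qed.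
Lemma ep_cst a b (x : H a) : a = b -> ep (cst b x) = ep x.
Proof. by move=> e; subst b; rewrite cst_id. Qed.

Lemma ph_mu b a c (x y : H a) : c = (b * a * b^-1)%g ->
  ph b (mu x y) = mu (ph b x : H c) (ph b y).
Proof. by move=> e; subst c; rewrite /ph !cst_id; apply: (phi_mul hd). Qed.
Lemma ph_one b a c : c = (b * a * b^-1)%g -> ph b (oneH : H a) = oneH :> H c.
Proof. by move=> e; subst c; rewrite /ph !cst_id; apply: (phi_one hd). Qed.
Lemma ph_ph b g a c e (x : H a) : c = (g * a * g^-1)%g ->
  ph b (ph g x : H c) = ph (b * g)%g x :> H e.
Proof.
move=> ec; subst c; rewrite /ph cst_id (phi_comp hd) trlE cst_cst //.
by rewrite gconj_comp.
Qed.
Lemma ep_ph b a c (x : H a) : a = 1%g -> c = (b * a * b^-1)%g -> ep (ph b x : H c) = ep x.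
Proof.
move=> ea ec; subst a c; rewrite /ep /ph !cst_id -(eps_phi hd b x) trlE //.
Qed.
Lemma ph_cst b a a' c (x : H a) : a = a' -> ph b (cst a' x) = ph b x :> H c.
Proof. by move=> e; subst; rewrite cst_id. Qed.
Lemma cst_ph b a c c' (x : H a) : c = (b * a * b^-1)%g -> cst c' (ph b x : H c) = ph b x.
Proof. by move=> e; subst; rewrite /ph cst_id. Qed.
(** The composition law makes phi_1 idempotent, and phi_1 is injective; together these give the
    identity. *)
Lemma ph1 a c (x : H a) : a = c -> ph 1 x = cst c x.
Proof.
move=> e; subst c; rewrite cst_id.
have inj : injective (ph 1 : H a -> H a).
  move=> u v; rewrite /ph => /(congr1 (cst (1 * a * 1^-1)%g)).
  by rewrite !cst_cst ?cst_id; [move/(bij_inj (phi_bij hd 1 a)) | grp | grp].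
by apply: inj; rewrite ph_ph ?mulg1 //; grp.
Qed.
Lemma phK b a c (x : H a) : c = (b * a * b^-1)%g -> ph b^-1 (ph b x : H c) = x.
Proof. by move=> e; rewrite ph_ph // mulVg ph1 // cst_id. Qed.
Lemma phVK b a c (x : H a) : c = (b^-1 * a * b)%g -> ph b (ph b^-1 x : H c) = x.
Proof. by move=> e; rewrite ph_ph ?invgK // mulgV ph1 // cst_id. Qed.

Lemma cst_sa a c c' (x : H a) : c = a^-1%g -> cst c' (sa x : H c) = sa x.
Proof. by move=> e; subst; rewrite /sa cst_id. Qed.

(** The list [cDelta] is linear in x only up to [teq2]; its coordinates are linear in x on the
    nose. *)
Definition cD a b c i j (x : H c) : k :=
  \sum_(p <- cDelta d a b (cst (a * b)%g x)) cf i (p.1 : H a) * cf j (p.2 : H b).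

Lemma cD_lin a b c i j : klinear (@cD a b c i j : H c -> k^o).
Proof.
move=> t x y; rewrite /cD cst_lin.
have := Delta_lin hd t (cst (a * b)%g x) (cst (a * b)%g y).
move/(_ (coord (vbasis {:H a}) i) (coord (vbasis {:H b}) j)) => ->.
rewrite big_cat big_map /=; congr (_ + _); rewrite scaler_sumr.
apply: eq_bigr => p _; rewrite linearZ; apply/esym/mulrA.
Qed.

(* Ds F x is the Sweedler sum of F x'_(a) x''_(b), computed from the coordinates of
   Delta_(a,b)(x); it is linear in x whatever F is, and it is the sum over the list
   cDelta d a b x only when F is bilinear (Ds_cDelta). *)
Definition Ds a b c (W : lmodType k) (F : H a -> H b -> W) (x : H c) : W :=
  \sum_i \sum_j cD i j x *: F (bs i) (bs j).

Lemma eq_Ds a b c (W : lmodType k) (F G : H a -> H b -> W) (x : H c) :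
  (forall u v, F u v = G u v) -> Ds F x = Ds G x.
Proof. by move=> e; apply: eq_bigr => i _; apply: eq_bigr => j _; rewrite e. Qed.

Lemma Ds_lin a b c (W : lmodType k) (F : H a -> H b -> W) : klinear (@Ds a b c W F).
Proof.
apply: klin_sum => i; apply: klin_sum => j; apply: klin_scalel; exact: cD_lin.
Qed.

Lemma klin_Ds (U : lmodType k) a b c (W : lmodType k) (F : U -> H a -> H b -> W) (x : H c) :
  (forall u v, klinear (fun t => F t u v)) -> klinear (fun t => Ds (F t) x).
Proof.
by move=> h; apply: klin_sum => i; apply: klin_sum => j; apply: klin_scale; apply: h.
Qed.

Lemma klin_DsF a b c (W W' : lmodType k) (g : W -> W') (F : H a -> H b -> W) (x : H c) :
  klinear g -> g (Ds F x) = Ds (fun u v => g (F u v)) x.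
Proof.
move=> h; rewrite /Ds klin_sum_arg //; apply: eq_bigr => i _.
rewrite klin_sum_arg //; apply: eq_bigr => j _; exact: klinZ.
Qed.

Lemma Ds_cDelta a b (W : lmodType k) (F : H a -> H b -> W) (x : H (a * b)%g) :
  bilin F -> \sum_(p <- cDelta d a b x) F p.1 p.2 = Ds F x.
Proof.
move=> hF; under eq_bigr => p _ do rewrite (bilin_basis _ _ hF).
rewrite exchange_big; apply: eq_bigr => i _.
rewrite exchange_big; apply: eq_bigr => j _.
by rewrite scaler_suml /cD cst_id.
Qed.

Lemma Ds_cst a b c c' (W : lmodType k) (F : H a -> H b -> W) (x : H c) : c = c' ->
  Ds F (cst c' x) = Ds F x.
Proof. by move=> e; subst; rewrite cst_id. Qed.

Lemma Ds_sum a b c (W : lmodType k) I (r : seq I) P (F : I -> H a -> H b -> W) (x : H c) :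
  Ds (fun u v => \sum_(i <- r | P i) F i u v) x = \sum_(i <- r | P i) Ds (F i) x.
Proof.
rewrite /Ds [RHS]exchange_big; apply: eq_bigr => i _ /=.
by rewrite [RHS]exchange_big; apply: eq_bigr => j _ /=; rewrite scaler_sumr.
Qed.

Lemma Ds_scale a b c (W : lmodType k) t (F : H a -> H b -> W) (x : H c) :
  Ds (fun u v => t *: F u v) x = t *: Ds F x.
Proof. by rewrite -(klin_DsF F x (klin_scale t (@klin_id _ W))). Qed.

(** Both sums run over fixed bases with scalar coefficients, so no linearity of F enters. *)
Lemma Ds_swap a b c a' b' c' (W : lmodType k) (F : H a -> H b -> H a' -> H b' -> W)
   (x : H c) (y : H c') :
  Ds (fun u v => Ds (F u v) y) x = Ds (fun u' v' => Ds (fun u v => F u v u' v') x) y.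
Proof.
rewrite {2}/Ds Ds_sum; apply: eq_bigr => i _.
by rewrite Ds_sum; apply: eq_bigr => j _; rewrite Ds_scale.
Qed.


(** Summing one coordinate against a functional returns to the list; this and [cD_suml] bring
    iterated coordinates to the form in which coassociativity is given. *)
Lemma cD_sumr a b c i (g : H b -> k^o) (x : H c) : klinear g ->
  \sum_m @cD a b c i m x * g (bs m) =
  \sum_(p <- cDelta d a b (cst (a * b)%g x)) cf i (p.1 : H a) * g p.2.
Proof.
move=> hg; under eq_bigr => m _ do rewrite mulr_suml.
rewrite exchange_big; apply: eq_bigr => p _ /=.
rewrite (klin_basis p.2 hg) mulr_sumr.
by apply: eq_bigr => m _; rewrite -mulrA.
Qed.

Lemma cD_suml a b c j (g : H a -> k^o) (x : H c) : klinear g ->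
  \sum_m @cD a b c m j x * g (bs m) =
  \sum_(p <- cDelta d a b (cst (a * b)%g x)) g p.1 * cf j (p.2 : H b).
Proof.
move=> hg; under eq_bigr => m _ do rewrite mulr_suml.
rewrite exchange_big; apply: eq_bigr => p _ /=.
rewrite (klin_basis p.1 hg) mulr_suml.
by apply: eq_bigr => m _; rewrite -[cf m _ *: _]/(cf m _ * _) mulrAC.
Qed.

(* Coordinatewise, so F need not be multilinear. *)
Lemma Ds_coassoc a b c u w t (W : lmodType k) (F : H a -> H b -> H c -> W) (x : H t) :
  w = (a * b)%g -> u = (b * c)%g -> t = (a * u)%g ->
  Ds (fun (x1 : H a) (y : H u) => Ds (fun x2 x3 => F x1 x2 x3) y) x =
  Ds (fun (y : H w) (x3 : H c) => Ds (fun x1 x2 => F x1 x2 x3) y) x.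
Proof.
move=> ew eu et; subst w u t.
transitivity (\sum_i \sum_j \sum_l
    (\sum_m @cD a (b * c)%g _ i m x * cD j l (bs m : H (b * c)%g)) *:
      F (bs i) (bs j) (bs l)).
  rewrite /Ds; apply: eq_bigr => i _.
  under [RHS]eq_bigr => j _ do under eq_bigr => l _ do rewrite scaler_suml.
  under [RHS]eq_bigr => j _ do rewrite exchange_big.
  rewrite exchange_big; apply: eq_bigr => m _ /=.
  rewrite scaler_sumr; apply: eq_bigr => j _.
  by rewrite scaler_sumr; apply: eq_bigr => l _; rewrite scalerA.
transitivity (\sum_i \sum_j \sum_l
    (\sum_m @cD (a * b)%g c _ m l x * cD i j (bs m : H (a * b)%g)) *:
      F (bs i) (bs j) (bs l)).
  apply: eq_bigr => i _; apply: eq_bigr => j _; apply: eq_bigr => l _.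
  congr (_ *: _).
  rewrite (cD_sumr _ _ (cD_lin j l)) (cD_suml _ _ (cD_lin i j)).
  have := coassoc hd x (coord (vbasis {:H a}) i) (coord (vbasis {:H b}) j)
    (coord (vbasis {:H c}) l).
  rewrite trlE cst_id !big_allpairs_dep /= => E.
  apply: etrans (etrans E _).
    apply: eq_bigr => p _; rewrite /cD cst_id mulr_sumr.
    by apply: eq_bigr => q _; rewrite mulrA.
  by apply: eq_bigr => p _; rewrite /cD cst_id mulr_suml.
rewrite /Ds.
under eq_bigr => i _ do under eq_bigr => j _ do under eq_bigr => l _ do rewrite scaler_suml.
under eq_bigr => i _ do under eq_bigr => j _ do rewrite exchange_big /=.
under eq_bigr => i _ do rewrite exchange_big /=.
rewrite exchange_big /=; apply: eq_bigr => m _.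
under [RHS]eq_bigr => l _ do rewrite scaler_sumr.
rewrite [RHS]exchange_big /=; apply: eq_bigr => i _.
under [RHS]eq_bigr => l _ do rewrite scaler_sumr.
rewrite [RHS]exchange_big /=; apply: eq_bigr => j _.
by apply: eq_bigr => l _; rewrite scalerA.
Qed.

Lemma Ds_counitl a b c (W : lmodType k) (G : H b -> W) (x : H c) :
  klinear G -> a = 1%g -> c = b ->
  Ds (fun (u : H a) v => ep u *: G v) x = G (cst b x).
Proof.
move=> hG ea ec; subst a c; rewrite cst_id.
have hB : bilin (fun (u : H 1%g) v => ep u *: G v).
  split=> w; [exact/klin_scalel/ep_lin|exact/klin_scale].
rewrite -(Ds_cst _ x (esym (mul1g b))) -Ds_cDelta // -{2}(counit_l hd x).
rewrite klin_sum_arg // trlE; apply: eq_bigr => p _.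
by rewrite klinZ // /ep cst_id.
Qed.

Lemma Ds_counitr a b c (W : lmodType k) (G : H a -> W) (x : H c) :
  klinear G -> b = 1%g -> c = a ->
  Ds (fun u (v : H b) => ep v *: G u) x = G (cst a x).
Proof.
move=> hG eb ec; subst b c; rewrite cst_id.
have hB : bilin (fun u (v : H 1%g) => ep v *: G u).
  split=> w; [exact/klin_scale|exact/klin_scalel/ep_lin].
rewrite -(Ds_cst _ x (esym (mulg1 a))) -Ds_cDelta // -{2}(counit_r hd x).
rewrite klin_sum_arg // trlE; apply: eq_bigr => p _.
by rewrite klinZ // /ep cst_id.
Qed.

Lemma Ds_mu a b c (W : lmodType k) (F : H a -> H b -> W) (x y : H c) :
  bilin F -> c = (a * b)%g ->
  Ds F (mu x y) = Ds (fun x1 x2 => Ds (fun y1 y2 => F (mu x1 y1) (mu x2 y2)) y) x.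
Proof.
move=> hF e; subst c; rewrite -Ds_cDelta //.
have hx u v : bilin (fun y1 y2 => F (mu u y1) (mu v y2)).
  by split=> w; [apply: (klin_comp (hF.1 _))|apply: (klin_comp (hF.2 _))];
     apply: klin_mul_r; apply: klin_id.
have hy : bilin (fun x1 x2 => Ds (fun y1 y2 => F (mu x1 y1) (mu x2 y2)) y).
  by split=> w; apply: klin_Ds => u v;
    [apply: (klin_comp (hF.1 _))|apply: (klin_comp (hF.2 _))];
     apply: klin_mul_l; apply: klin_id.
rewrite -(Ds_cDelta _ hy) (teq2_bilin hF (@Delta_mul _ _ _ _ hd a b x y)) big_allpairs_dep /=.
apply: eq_bigr => p _; rewrite -(Ds_cDelta _ (hx _ _)) //.
Qed.

Lemma Ds_one a b c (W : lmodType k) (F : H a -> H b -> W) :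
  bilin F -> c = (a * b)%g -> Ds F (oneH : H c) = F oneH oneH.
Proof.
move=> hF e; subst c; rewrite -Ds_cDelta //.
by rewrite (teq2_bilin hF (@Delta_one _ _ _ _ hd a b)) big_seq1.
Qed.

Lemma Ds_ph g a b c a' b' c' (W : lmodType k) (F : H a' -> H b' -> W) (x : H c) :
  bilin F -> c = (a * b)%g -> a' = (g * a * g^-1)%g -> b' = (g * b * g^-1)%g ->
  c' = (g * c * g^-1)%g ->
  Ds F (ph g x : H c') = Ds (fun (u : H a) (v : H b) => F (ph g u) (ph g v)) x.
Proof.
move=> hF ec ea eb ec'; subst c a' b' c'.
have hy : bilin (fun (u : H a) (v : H b) => F (ph g u) (ph g v)).
  by split=> w; [apply: (klin_comp (hF.1 _))|apply: (klin_comp (hF.2 _))];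
     apply: ph_lin.
rewrite -(Ds_cDelta _ hy) -(Ds_cst _ _ (gconj_mul g a b)) -Ds_cDelta //.
rewrite /ph cst_id -(trlE (gconj_mul g a b)).
rewrite (teq2_bilin hF (@phi_Delta _ _ _ _ hd g a b x)) big_map /=.
by apply: eq_bigr => p _; rewrite !cst_id.
Qed.

Lemma Ds_antil a b c (W : lmodType k) (G : H a -> W) (x : H c) :
  klinear G -> b = a^-1%g -> c = 1%g ->
  Ds (fun (u : H b) (v : H a) => G (mu (sa u) v)) x = ep x *: G oneH.
Proof.
move=> hG eb ec; subst b c.
have hB : bilin (fun (u : H a^-1%g) (v : H a) => G (mu (sa u) v)).
  by split=> w; apply: (klin_comp hG); [apply/klin_mul_l/sa_lin|apply/klin_mul_r].
rewrite -(Ds_cst _ x (esym (mulVg a))) -Ds_cDelta // -klinZ // /ep cst_id.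
rewrite -[in RHS](antipode_l hd a x) klin_sum_arg // trlE.
by apply: eq_bigr => p _; rewrite trlE.
Qed.

Lemma Ds_antir a b c (W : lmodType k) (G : H a -> W) (x : H c) :
  klinear G -> b = a^-1%g -> c = 1%g ->
  Ds (fun (u : H a) (v : H b) => G (mu u (sa v))) x = ep x *: G oneH.
Proof.
move=> hG eb ec; subst b c.
have hB : bilin (fun (u : H a) (v : H a^-1%g) => G (mu u (sa v))).
  by split=> w; apply: (klin_comp hG); [apply/klin_mul_l|apply/klin_mul_r/sa_lin].
rewrite -(Ds_cst _ x (esym (mulgV a))) -Ds_cDelta // -klinZ // /ep cst_id.
rewrite -[in RHS](antipode_r hd a x) klin_sum_arg // trlE.
by apply: eq_bigr => p _; rewrite trlE.
Qed.

End Wrap.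
Arguments oneH {k pi H} d {a}.
Arguments ph {k pi H} d b {a c} x.
Arguments sa {k pi H} d {a c} x.
Arguments ep {k pi H} d {a} x.

Lemma klin_hom (k : fieldType) (U V : vectType k) (X : 'Hom(U, V)) : klinear X.
Proof. by move=> c x y; rewrite linearP. Qed.

Lemma klin_homl (k : fieldType) (W : lmodType k) (U V : vectType k) (X : W -> 'Hom(U, V)) x :
  klinear X -> klinear (fun t => X t x).
Proof. by move=> h c s t; rewrite h add_lfunE scale_lfunE. Qed.

Ltac eta := lazymatch goal with
  | |- klinear (fun _ => _) => idtac
  | |- @klinear ?k ?U ?V ?f => change (@klinear k U V (fun t => f t))
  | |- _ => idtac
  end.

(* Extended below, when S^-1 and the sums Tw become available. *)
Ltac lin_ext := fail.

(** Linearity by recursion on the head symbol: the variable must occur in exactly one factor of a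
    product. For a function known only through the context, [linh] looks for a hypothesis stating
    that it is linear or bilinear, possibly after some arguments. *)
Ltac lin := intros; cbv beta; eta; lazymatch goal with
  | |- bilin _ => split; lin
  | |- klinear (fun x => x) => exact (@klin_id _ _)
  | |- klinear (fun x => mu _ _ _) =>
      first [ eapply klin_mul_l; [eassumption | lin] | eapply klin_mul_r; [eassumption | lin] ]
  | |- klinear (fun x => ph _ _ _) =>
      eapply klin_comp; [eapply ph_lin; eassumption | lin]
  | |- klinear (fun x => sa _ _) =>
      eapply klin_comp; [eapply sa_lin; eassumption | lin]
  | |- klinear (fun x => ep _ _) =>
      eapply klin_comp; [eapply ep_lin; eassumption | lin]
  | |- klinear (fun x => cst _ _) =>
      eapply klin_comp; [eapply cst_lin | lin]
  | |- klinear (fun x => cf _ _) =>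
      eapply klin_comp; [eapply cf_lin | lin]
  | |- klinear (fun x => Ds _ _ _) =>
      first [ eapply klin_comp; [eapply Ds_lin; eassumption | lin] | eapply klin_Ds; lin ]
  | |- klinear (fun x => _ *: _) =>
      first [ eapply klin_scalel; lin | eapply klin_scale; lin ]
  | |- klinear (fun x => GRing.mul _ _) =>
      first [ eapply klin_mull; lin | eapply klin_mulr; lin ]
  | |- klinear (fun x => GRing.add _ _) => eapply klin_add; lin
  | |- klinear (fun x => bigop _ _ _) => eapply klin_sum; lin
  | |- klinear (fun x => fun_of_lfun _ _) =>
      first [ eapply klin_comp; [eapply klin_hom | lin] | eapply klin_homl; lin | linh ]
  | |- klinear _ => linh
  end
with linh :=
  first [ lin_ext | match goal with h : bilin _ |- _ =>
      first [ eapply (klin_comp (proj1 h _)); lin | eapply (klin_comp (proj2 h _)); lin ] end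
    | match goal with h : _ |- _ => first [ eapply (klin_comp h); lin
      | eapply (klin_comp (h _)); lin
      | eapply (klin_comp (h _ _)); lin
      | eapply (klin_comp (h _ _ _)); lin
      | eapply (klin_comp (h _ _ _ _)); lin ] end
    | match goal with h : _ |- _ =>
      first [ eapply (klin_comp (proj1 (h _) _)); lin | eapply (klin_comp (proj2 (h _) _)); lin
      | eapply (klin_comp (proj1 (h _ _) _)); lin | eapply (klin_comp (proj2 (h _ _) _)); lin ] end ].

Ltac side := solve [ assumption | grp | lin ].

(** * The antipode *)

Section Antipode.
Variables (k : fieldType) (pi : groupType) (H : pi -> vectType k).
Variable d : chc_data (Hl H).
Hypothesis hd : is_chc d.
Local Notation mu := (mu d).
Local Notation one := (oneH d).
Local Notation ep := (ep d).
Local Notation ph := (ph d).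
Local Notation sa := (sa d).
Local Notation Ds := (Ds d).

Section Contract.
Variables (W : lmodType k) (u a b c : pi).

(** Contractions inside a threefold Sweedler sum: the antipode axiom on the inner pair produces a
    counit, which the remaining leg absorbs. The small letter tells on which factor S stands, the
    capital one on which side the pair lies. *)
Lemma antirR (F : H a -> H b -> W) (x : H a) : bilin F -> u = 1%g -> c = b^-1%g ->
  Ds (fun x1 (r : H u) => Ds (fun x2 (x3 : H c) => F x1 (mu x2 (sa x3))) r) x = F x one.
Proof.
move=> hF hu hc; etransitivity.
  by apply: eq_Ds => x1 r; apply: (Ds_antir hd); side.
by rewrite (Ds_counitr hd) ?cst_id //; side.
Qed.

Lemma antilR (F : H a -> H b -> W) (x : H a) : bilin F -> u = 1%g -> c = b^-1%g ->
  Ds (fun x1 (r : H u) => Ds (fun (x2 : H c) x3 => F x1 (mu (sa x2) x3)) r) x = F x one.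
Proof.
move=> hF hu hc; etransitivity.
  by apply: eq_Ds => x1 r; apply: (Ds_antil hd); side.
by rewrite (Ds_counitr hd) ?cst_id //; side.
Qed.

Lemma antirL (F : H b -> H a -> W) (x : H a) : bilin F -> u = 1%g -> c = b^-1%g ->
  Ds (fun (r : H u) x3 => Ds (fun x1 (x2 : H c) => F (mu x1 (sa x2)) x3) r) x = F one x.
Proof.
move=> hF hu hc; etransitivity.
  by apply: eq_Ds => r x1; apply: (Ds_antir hd (G := F^~ x1)); side.
by rewrite (Ds_counitl hd) ?cst_id //; side.
Qed.

Lemma antilL (F : H b -> H a -> W) (x : H a) : bilin F -> u = 1%g -> c = b^-1%g ->
  Ds (fun (r : H u) x3 => Ds (fun (x1 : H c) x2 => F (mu (sa x1) x2) x3) r) x = F one x.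
Proof.
move=> hF hu hc; etransitivity.
  by apply: eq_Ds => r x1; apply: (Ds_antil hd (G := F^~ x1)); side.
by rewrite (Ds_counitl hd) ?cst_id //; side.
Qed.

End Contract.

(* Both sides are S(x' y') x'' y'' S(y''') S(x'''). *)
Lemma sa_mu a c (x y : H a) : c = a^-1%g -> sa (mu x y) = mu (sa y) (sa x) :> H c.
Proof.
move=> ec.
pose T (x1 y1 : H a) (x2 y2 : H c) (x3 y3 : H a) : H c :=
  mu (sa (mu x1 y1)) (mu (mu x2 (mu y2 (sa y3))) (sa x3)).
transitivity (Ds (fun x1 (r : H 1) => Ds (fun x2 x3 => Ds (fun y1 (s : H 1) =>
  Ds (fun y2 y3 => T x1 y1 x2 y2 x3 y3) s) y) r) x).
  symmetry; etransitivity.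
    apply: eq_Ds => x1 r; apply: eq_Ds => x2 x3; rewrite /T.
    by apply: (antirR (F := fun y1 z => mu (sa (mu x1 y1)) (mu (mu x2 z) (sa x3)))); side.
  cbv beta.
  under eq_Ds => x1 r do under eq_Ds => x2 x3 do rewrite (mu1r hd).
  by rewrite (antirR (F := fun x1 z => mu (sa (mu x1 y)) z)) ?(mu1r hd) //; side.
rewrite (Ds_coassoc hd (w := 1%g)); try grp.
transitivity (Ds (fun (w : H 1) (x3 : H a) => Ds (fun (v : H 1) (y3 : H a) =>
    ep w *: (ep v *: mu (sa y3) (sa x3 : H c))) y) x).
  apply: eq_Ds => w x3.
  under eq_Ds => x1 x2 do (rewrite (Ds_coassoc hd (w := 1%g)); try grp).
  rewrite Ds_swap; apply: eq_Ds => v y3.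
  (* Delta(w) Delta(v) = Delta(w v), so S(x' y') x'' y'' is the left antipode axiom at the product w
     v. *)
  transitivity (Ds (fun (p : H a) (q : H c) => mu (mu (sa p) q) (mu (sa y3) (sa x3))) (mu w v)).
    rewrite (Ds_mu hd); try side.
    by apply: eq_Ds => x1 x2; apply: eq_Ds => y1 y2; rewrite /T !(muA hd).
  rewrite (Ds_antil hd (G := fun z => mu z (mu (sa y3) (sa x3)))); try side.
  by rewrite (ep_mu hd) // (mu1l hd) scalerA.
etransitivity.
  apply: eq_Ds => w x3.
  rewrite Ds_scale (Ds_counitl hd (G := fun y3 => mu (sa y3) (sa x3))); try side.
  reflexivity.
rewrite (Ds_counitl hd (G := fun x3 => mu (sa (cst a y)) (sa x3))); try side.
by rewrite !cst_id.
Qed.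


(* Both sides are S(x1)' x2' S(x4) (x) S(x1)'' x2'' S(x3). *)
Lemma Ds_sa a b c a' b' c' (W : lmodType k) (F : H a -> H b -> W) (x : H c) : bilin F ->
  a' = a^-1%g -> b' = b^-1%g -> c' = (a * b)%g -> c = (b' * a')%g ->
  Ds F (sa x : H c') = Ds (fun (u : H b') (v : H a') => F (sa v) (sa u)) x.
Proof.
move=> hF ea eb ec' ec.
pose T (p : H a) (q : H b) (p' : H a) (q' : H b) (x3 : H b') (x4 : H a') : W :=
  F (mu p (mu p' (sa x4))) (mu q (mu q' (sa x3))).
transitivity (Ds (fun (x1 : H c) (r : H 1) => Ds (fun p q =>
   Ds (fun (x2 : H c') (t : H c) => Ds (fun p' q' => Ds (fun x3 x4 =>
     T p q p' q' x3 x4) t) x2) r) (sa x1 : H c')) x).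
  transitivity (Ds (fun (x1 : H c) (r : H 1) => Ds (fun (p' : H a) (s : H a') =>
     Ds (fun p q => F (mu p (mu p' (sa s))) q) (sa x1 : H c')) r) x).
    rewrite (antirR (F := fun x1 z => Ds (fun p q => F (mu p z) q) (sa x1 : H c'))); try side.
    by apply: eq_Ds => p q; rewrite (mu1r hd).
  apply: eq_Ds => x1 r; rewrite Ds_swap; apply: eq_Ds => p q.
  rewrite -(Ds_coassoc hd (u := a') (fun p' q' t => Ds (T p q p' q') t)); try grp.
  apply: eq_Ds => p' s; rewrite (Ds_coassoc hd (w := 1%g)); try grp.
  rewrite /T (antirL (F := fun z x4 => F (mu p (mu p' (sa x4))) (mu q z))); try side.
  by rewrite (mu1r hd).
transitivity (Ds (fun (x1 : H c) (r : H 1) => Ds (fun (x2 : H c') (t : H c) =>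
   Ds (fun (x3 : H b') (x4 : H a') =>
     Ds (fun m n => F (mu m (sa x4)) (mu n (sa x3))) (mu (sa x1) x2)) t) r) x).
  apply: eq_Ds => x1 r; rewrite Ds_swap; apply: eq_Ds => x2 t.
  under eq_Ds => p q do rewrite Ds_swap.
  rewrite Ds_swap; apply: eq_Ds => x3 x4.
  rewrite (Ds_mu hd); try side.
  by apply: eq_Ds => p q; apply: eq_Ds => p' q'; rewrite /T !(muA hd).
rewrite (Ds_coassoc hd (w := 1%g)); try grp.
rewrite (antilL (F := fun z t => Ds (fun (x3 : H b') (x4 : H a') =>
   Ds (fun m n => F (mu m (sa x4)) (mu n (sa x3))) z) t)); try side.
by apply: eq_Ds => x3 x4; rewrite (Ds_one hd) ?(mu1l hd) //; side.
Qed.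

(* Both sides are S(phi(x')) phi(x'') phi(S(x''')). *)
Lemma sa_ph g a b c e (x : H a) : b = (g * a * g^-1)%g -> e = b^-1%g -> c = a^-1%g ->
  sa (ph g x : H b) = ph g (sa x : H c) :> H e.
Proof.
move=> eb ee ec.
transitivity (Ds (fun (x1 : H a) (r : H 1) => Ds (fun (x2 : H c) (x3 : H a) =>
  mu (sa (ph g x1 : H b) : H e) (ph g (mu x2 (sa x3)))) r) x).
  rewrite (antirR (F := fun x1 z => mu (sa (ph g x1 : H b) : H e) (ph g z))); try side.
  by rewrite (ph_one hd) ?(mu1r hd) //; grp.
rewrite (Ds_coassoc hd (w := 1%g)); try grp.
transitivity (Ds (fun (w : H 1) (x3 : H a) => ep w *: (ph g (sa x3 : H c) : H e)) x).
  apply: eq_Ds => w x3; rewrite -(ep_ph hd (b := g) (c := 1%g)); try grp.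
  rewrite -[X in _ = _ *: X](mu1l hd).
  rewrite -(Ds_antil hd (b := b) (G := fun z => mu z (ph g (sa x3 : H c) : H e))); try side.
  rewrite (Ds_ph hd (a := a) (b := c)); try side.
  by apply: eq_Ds => x1 x2; rewrite (ph_mu hd) ?(muA hd) //; grp.
by rewrite (Ds_counitl hd) ?cst_id //; side.
Qed.

Lemma sa_one a c : c = a^-1%g -> sa (one : H a) = one :> H c.
Proof.
move=> ec; have := Ds_antil hd (G := id) (one : H 1) (@klin_id _ (H c)) (b := a).
rewrite (Ds_one hd) ?(mu1r hd); try side.
by rewrite (ep_one hd) // scale1r; apply; grp.
Qed.

(** Apply epsilon to S(x') x'' = epsilon(x) 1 and absorb epsilon(x'') by the counit. *)
Lemma ep_sa a c (x : H a) : a = 1%g -> c = 1%g -> ep (sa x : H c) = ep x.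
Proof.
move=> ea ec; subst a c.
have := Ds_antil hd (G := fun z => ep z : k^o) (b := 1%g) x (@ep_lin _ _ _ _ hd 1%g).
under eq_Ds => u v do rewrite (ep_mu hd) // mulrC -[_ * _]/(_ *: (_ : k^o)).
rewrite (Ds_counitr hd) ?cst_id //; last side.
rewrite (ep_one hd) // => ->; try grp.
by rewrite -[_ *: _]/(_ * _) mulr1.
Qed.

End Antipode.

(** * Bijectivity of the antipode *)

Section Bijective.
Variables (k : fieldType) (pi : groupType) (H : pi -> vectType k).
Variable d : chc_data (Hl H).
Hypothesis hd : is_chc d.
Local Notation mu := (mu d).
Local Notation one := (oneH d).
Local Notation ep := (ep d).
Local Notation sa := (sa d).
Local Notation Ds := (Ds d).

Lemma Ds_scalel a b c (W : lmodType k) (g : H a -> H b -> k^o) (w : W) (x : H c) :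
  Ds (fun u v => (g u v : k) *: w) x = (Ds g x : k) *: w.
Proof. by rewrite -(klin_DsF _ g x (klin_scalel w (@klin_id _ k^o))). Qed.

Lemma Ds0 a b c (W : lmodType k) (x : H c) : Ds (fun (_ : H a) (_ : H b) => 0 : W) x = 0.
Proof. by rewrite /Ds; do 2 apply: big1 => ? _; rewrite scaler0. Qed.

(** In tensor form, x' (x) x'' S(h) = (x S(h'))' h'' (x) (x S(h'))''. As S reverses the coproduct,
    the right side is x' S(h'') h''' (x) x'' S(h'), where S(h'') h''' contracts. *)
Lemma Ds_mu_sa b c e c' e' (g : H c -> k^o) (h : H c') (x : H e) :
  klinear g -> e = (b * c)%g -> c' = c^-1%g -> e' = e^-1%g ->
  Ds (fun (x1 : H b) (x2 : H c) => (g (mu x2 (sa h)) : k) *: x1) x =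
  Ds (fun (h1 : H e') (h2 : H b) => Ds (fun (y1 : H b) (y2 : H c) =>
        (g y2 : k) *: mu y1 h2) (mu x (sa h1))) h.
Proof.
move=> hg ee ec' ee'; symmetry.
transitivity (Ds (fun (x1 : H b) (x2 : H c) => Ds (fun (h1 : H e') (h2 : H b) =>
    Ds (fun (u : H c') (v : H b^-1%g) => (g (mu x2 (sa u)) : k) *: mu x1 (mu (sa v) h2))
    h1) h) x).
  rewrite [RHS]Ds_swap; apply: eq_Ds => h1 h2; rewrite (Ds_mu hd); try side.
  apply: eq_Ds => x1 x2; rewrite (Ds_sa hd (a' := b^-1%g) (b' := c')); try side.
  by apply: eq_Ds => u v; rewrite (muA hd).
apply: eq_Ds => x1 x2; rewrite -(Ds_coassoc hd (u := 1%g)); try grp.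
rewrite (antilR hd (F := fun u z => (g (mu x2 (sa u)) : k) *: mu x1 z)); try side.
by rewrite (mu1r hd).
Qed.

Lemma sa_sa a b b' c (x : H a) : b = b' -> sa (sa x : H b) = sa (sa x : H b') :> H c.
Proof. by move=> e; subst b'. Qed.

(* The trace of e |-> x S^2(e') f(e''); by lam_inv these functionals form a left integral. *)
Definition lam (f : H 1 -> k^o) c (x : H c) : k^o :=
  \sum_i Ds (fun (e1 : H c) (e2 : H 1) =>
    (f e2 : k) *: (cf i (mu x (sa (sa e1 : H c^-1))) : k^o)) (bs i).

Lemma lam_lin f c : klinear (@lam f c).
Proof. rewrite /lam; lin. Qed.

(** Cyclicity of the trace. [Ds_mu_sa] with h = S(e') produces the coproduct of x S^2(v); this
    element is expanded in a basis of H_e, with basis vector y, and the sum over the basis of H_c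
    then puts y'' in place of e. The trace over H_c has become one over H_e, in which y' meets S of
    the next leg and contracts. *)
Lemma lam_inv f b c e (x : H e) : klinear f -> e = (b * c)%g ->
  Ds (fun (x1 : H b) (x2 : H c) => (lam f x2 : k) *: x1) x = (lam f x : k) *: one.
Proof.
move=> hf ee; rewrite /lam.
transitivity (\sum_(i < \dim {:H c}) \sum_(j < \dim {:H e})
  Ds (fun (e1 : H c) (e2 : H 1) => (f e2 : k) *:
    Ds (fun (u : H b^-1%g) (v : H e) => cf j (mu x (sa (sa v : H e^-1%g))) *:
      Ds (fun (y1 : H b) (y2 : H c) => cf i y2 *: mu y1 (sa u)) (bs j)) e1) (bs i)).
  under eq_Ds => x1 x2 do rewrite scaler_suml.
  rewrite Ds_sum; apply: eq_bigr => i _.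
  under eq_Ds => x1 x2 do rewrite -Ds_scalel.
  rewrite Ds_swap -Ds_sum; apply: eq_Ds => e1 e2.
  under eq_Ds => x1 x2 do rewrite -scalerA.
  rewrite Ds_scale -scaler_sumr; congr (_ *: _).
  rewrite (Ds_mu_sa (e' := e^-1%g) (g := cf i)); try side.
  rewrite (Ds_sa hd (a' := e) (b' := b^-1%g)); try side.
  rewrite -Ds_sum; apply: eq_Ds => u v.
  rewrite (klin_basis (mu x _) (Ds_lin hd _)) //.
rewrite exchange_big scaler_suml; apply: eq_bigr => j _ /=.
rewrite -Ds_scalel.
transitivity (Ds (fun (y1 : H b) (y2 : H c) => Ds (fun (e1 : H c) (e2 : H 1) =>
   Ds (fun (u : H b^-1%g) (v : H e) =>
     (f e2 : k) *: (cf j (mu x (sa (sa v : H e^-1%g))) *: mu y1 (sa u))) e1) y2) (bs j)).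
  transitivity (Ds (fun (y1 : H b) (y2 : H c) => \sum_i cf i y2 *:
    Ds (fun (e1 : H c) (e2 : H 1) => Ds (fun (u : H b^-1%g) (v : H e) =>
     (f e2 : k) *: (cf j (mu x (sa (sa v : H e^-1%g))) *: mu y1 (sa u))) e1) (bs i)) (bs j)).
    rewrite Ds_sum; apply: eq_bigr => i _.
    under [RHS]eq_Ds => y1 y2 do rewrite -Ds_scale.
    rewrite [RHS]Ds_swap; apply: eq_Ds => e1 e2.
    under [RHS]eq_Ds => y1 y2 do rewrite -Ds_scale.
    rewrite [RHS]Ds_swap -Ds_scale; apply: eq_Ds => u v.
    rewrite -!Ds_scale; apply: eq_Ds => y1 y2.
    by rewrite !scalerA mulrC mulrA.
  by apply: eq_Ds => y1 y2; rewrite -(klin_basis y2 (Ds_lin hd _)).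
transitivity (Ds (fun (y1 : H b) (y2 : H c) => Ds (fun (u : H b^-1%g) (w : H e) =>
   Ds (fun (v : H e) (e2 : H 1) =>
     (f e2 : k) *: (cf j (mu x (sa (sa v : H e^-1%g))) *: mu y1 (sa u))) w) y2) (bs j)).
  by apply: eq_Ds => y1 y2; rewrite (Ds_coassoc hd (w := c)) //; grp.
rewrite (Ds_coassoc hd (w := 1%g)); try grp.
rewrite (antirL hd (F := fun m w => Ds (fun (v : H e) (e2 : H 1) =>
     (f e2 : k) *: (cf j (mu x (sa (sa v : H e^-1%g))) *: m)) w)); try side.
by apply: eq_Ds => v e2; rewrite scalerA.
Qed.

(** Summing over i puts the second leg of a basis vector b_j in place of e. Then S(e') S^2(b_j')
    becomes S(S(b_j') b_j''), which contracts to 1 and leaves the expansion of f(x) in the basis.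
    Hence every functional is obtained from translates of the functionals [lam]. *)
Lemma lam_recover (f : H 1 -> k^o) (x : H 1) : klinear f ->
  \sum_i Ds (fun (e1 : H 1) (e2 : H 1) =>
     (f e2 : k) *: lam (cf i : H 1 -> k^o) (mu x (sa e1))) (bs i) = f x.
Proof.
move=> hf; rewrite /lam.
transitivity (\sum_(j < \dim {:H 1}) Ds (fun (p q : H 1) => \sum_i cf i q *:
   Ds (fun (e1 e2 : H 1) => (f e2 : k) *:
     (cf j (mu x (sa (mu (sa p) e1 : H 1))) : k^o)) (bs i)) (bs j)).
  under eq_bigr => i _ do under eq_Ds => e1 e2 do rewrite scaler_sumr.
  under eq_bigr => i _ do rewrite Ds_sum.
  rewrite exchange_big; apply: eq_bigr => j _ /=.
  rewrite Ds_sum; apply: eq_bigr => i _.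
  under eq_Ds => e1 e2 do rewrite -Ds_scale.
  rewrite Ds_swap; apply: eq_Ds => p q.
  rewrite -Ds_scale; apply: eq_Ds => e1 e2.
  rewrite (sa_mu hd) ?(muA hd); try grp.
  by rewrite !scalerA mulrC (sa_sa _ p (esym (@invg1 pi))).
rewrite [RHS](klin_basis x hf); apply: eq_bigr => j _.
under eq_Ds => p q do rewrite -(klin_basis q (Ds_lin hd _)).
rewrite (Ds_coassoc hd (w := 1%g)); try grp.
rewrite (antilL hd (F := fun m e2 => (f e2 : k) *: (cf j (mu x (sa m)) : k^o))); try side.
rewrite (sa_one hd) ?(mu1r hd); try grp.
by rewrite -![_ *: _]/(_ * _) mulrC.
Qed.

Lemma lam_neq0 : exists f : H 1 -> k^o, klinear f /\ exists x : H 1, lam f x <> 0.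
Proof.
apply: contrapT => no.
have z f (x : H 1) : klinear f -> lam f x = 0.
  by move=> hf; apply: contrapT => nz; apply: no; exists f; split => //; exists x.
(* If all [lam] vanished, recovering epsilon from them would give epsilon(1) = 0. *)
have := lam_recover one (@ep_lin _ _ _ _ hd 1%g).
rewrite big1 => [/esym/eqP|i _]; first by rewrite (ep_one hd) // oner_eq0.
under eq_Ds => e1 e2 do rewrite (z _ _ (cf_lin i)) scaler0.
exact: Ds0.
Qed.

(** For an invariant functional, [Ds_mu_sa] reads lam(e'' S(h)) e' = lam(e S(h')) h''. Inside the
    trace this gives lam(x S^2(h'') S(h')) = lam(x S(h' S(h''))), where h' S(h'') contracts. *)
Lemma lam_eps (f : H 1 -> k^o) (x h : H 1) : klinear f ->
  \sum_i Ds (fun (e1 : H 1) (e2 : H 1) =>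
    (lam f (mu e2 (sa h)) : k) *: (cf i (mu x (sa (sa e1 : H 1^-1%g))) : k^o)) (bs i)
  = ep h *: lam f x.
Proof.
move=> hf.
have hl := lam_lin f (c := 1%g).
transitivity (Ds (fun h1 h2 : H 1 => \sum_i cf i (mu x (sa (sa h2 : H 1^-1%g))) *:
    lam f (mu (bs i) (sa h1))) h).
  rewrite Ds_sum; apply: eq_bigr => i _.
  have hT : klinear (fun z : H 1 => cf i (mu x (sa (sa z : H 1^-1%g))) : k^o) by lin.
  transitivity (cf i (mu x (sa (sa (Ds (fun e1 e2 : H 1 => (lam f (mu e2 (sa h)) : k) *: e1)
      (bs i)) : H 1^-1%g))) : k^o).
    by rewrite [RHS](klin_DsF d _ _ hT); apply: eq_Ds => e1 e2; rewrite (klinZ _ _ hT).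
  rewrite (Ds_mu_sa (e' := 1%g)) //; try grp.
  rewrite [LHS](klin_DsF d _ _ hT); apply: eq_Ds => h1 h2.
  transitivity (cf i (mu x (sa (sa (mu (lam f (mu (bs i) (sa h1)) *: one) h2 : H 1) : H 1^-1%g))) : k^o).
    rewrite -(lam_inv (b := 1%g) (c := 1%g)) //; last grp.
    have hr : klinear (fun y : H 1 => cf i (mu x (sa (sa (mu y h2) : H 1^-1%g))) : k^o) by lin.
    rewrite [RHS](klin_DsF d _ _ hr) [LHS](klin_DsF d _ _ hT); apply: eq_Ds => y1 y2.
    have hm : klinear (fun y : H 1 => mu y h2) by lin.
    by rewrite (klinZ _ _ hm).
  rewrite (klinZ (f := fun y => cf i (mu x (sa (sa (mu y h2) : H 1^-1%g))) : k^o)); last lin.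
  by rewrite (mu1l hd) -![_ *: _]/(_ * _) mulrC.
transitivity (Ds (fun h1 h2 : H 1 => lam f (mu x (sa (mu h1 (sa h2 : H 1))))) h).
  apply: eq_Ds => h1 h2; rewrite (sa_mu hd) ?(muA hd); try grp.
  rewrite (sa_sa _ h2 (esym (@invg1 pi))).
  by rewrite -(klin_basis (mu x _) (f := fun z => lam f (mu z (sa h1)))) //; lin.
rewrite (Ds_antir hd (G := fun z => lam f (mu x (sa z)))); try side.
by rewrite (sa_one hd) ?(mu1r hd) //; grp.
Qed.

(* If S(h) = 0 then Ds_mu_sa gives lam(y S(h')) h'' = 0 for all y; by lam_eps a combination
   of the functionals h' |-> lam(y S(h')) is a nonzero multiple of epsilon, so h = 0. *)
Lemma sa_inj0 a c (h : H a) : c = a^-1%g -> sa h = 0 :> H c -> h = 0.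
Proof.
move=> ec h0.
have [f [hf [x fx]]] := lam_neq0.
have hl b := lam_lin f (c := b).
have E (y : H 1) : Ds (fun (h1 : H 1) (h2 : H a) => (lam f (mu y (sa h1)) : k) *: h2) h = 0.
  transitivity (Ds (fun (x1 : H a) (x2 : H c) => (lam f (mu x2 (sa h)) : k) *: x1) y).
    rewrite (Ds_mu_sa (e' := 1%g)) //; try grp.
    apply: eq_Ds => h1 h2.
    have hr : klinear (fun z : H a => mu z h2) by lin.
    have := klin_DsF d (fun (y1 : H a) (y2 : H c) => (lam f y2 : k) *: y1) (mu y (sa h1)) hr.
    rewrite (lam_inv _ hf); last grp.
    rewrite (klinZ _ _ hr) (mu1l hd) => ->; apply: eq_Ds => y1 y2.
    by rewrite (klinZ _ _ hr).
  rewrite h0 /Ds; apply: big1 => i _; apply: big1 => j _.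
  rewrite (klin0 (f := fun z => lam f (mu (bs j) z))) ?scale0r ?scaler0 //; lin.
suff: (lam f x : k) *: h = 0.
  by move/eqP; rewrite scaler_eq0 => /orP[/eqP/fx //|/eqP].
transitivity (Ds (fun (h1 : H 1) (h2 : H a) => ep h1 *: ((lam f x : k) *: h2)) h).
  by rewrite (Ds_counitl hd) ?cst_id //; side.
transitivity (\sum_i Ds (fun e1 e2 : H 1 => cf i (mu x (sa (sa e1 : H 1^-1%g))) *:
   Ds (fun (h1 : H 1) (h2 : H a) => (lam f (mu e2 (sa h1)) : k) *: h2) h) (bs i)).
  under eq_Ds => h1 h2 do rewrite scalerA -[ep h1 * _]/(ep h1 *: _) -lam_eps // scaler_suml.
  rewrite Ds_sum; apply: eq_bigr => i _.
  under eq_Ds => h1 h2 do rewrite -Ds_scalel.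
  rewrite Ds_swap; apply: eq_Ds => e1 e2; rewrite -Ds_scale.
  by apply: eq_Ds => h1 h2; rewrite scalerA mulrC.
apply: big1 => i _; under eq_Ds => e1 e2 do rewrite E scaler0.
exact: Ds0.
Qed.

Let S a : 'Hom(H a, H a^-1) := linfun (cS d a : H a -> H a^-1%g).

Lemma SE a (x : H a) : S a x = sa x.
Proof.
pose f := HB.pack_for {linear H a -> H a^-1%g} (cS d a : H a -> H a^-1%g)
  (GRing.isLinear.Build _ _ _ _ _ (S_lin hd (a := a))).
by rewrite /S -[cS d a]/(f : _ -> _) lfunE /sa cst_id.
Qed.

Lemma S_ker a : lker (S a) == 0%VS.
Proof.
apply/lker0P => x y; rewrite !SE => e.
apply/eqP; rewrite -subr_eq0; apply/eqP/(@sa_inj0 a a^-1%g) => //.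
have := @sa_lin _ _ _ _ hd a a^-1%g (-1) y x.
by rewrite !scaleN1r e addNr addrC.
Qed.

Lemma S_dim a : (\dim {:H a} <= \dim {:H a^-1%g})%N.
Proof.
by rewrite -(limg_dim_eq (f := S a)) ?dimvS ?subvf // (eqP (S_ker a)) capv0.
Qed.

(** S_a goes between different spaces, so its injectivity alone does not suffice: injectivity on
    H_(a^-1) gives the opposite inequality of dimensions. *)
Lemma S_img a : limg (S a) = fullv.
Proof.
apply/eqP; rewrite eqEdim subvf limg_dim_eq ?(eqP (S_ker a)) ?capv0 //=.
by have := S_dim a^-1%g; rewrite invgK.
Qed.

(** [sinv] is the generic inverse of a linear map; that it inverts the antipode on both sides is
    [saK] and [siK], which rest on [S_ker] and [S_img]. *)
Definition si a c (x : H a) : H c := sinv d (cst c^-1%g x).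

Lemma saK a b c (x : H a) : b = a^-1%g -> c = a -> si c (sa x : H b) = cst c x.
Proof.
move=> eb ec; subst b c; rewrite /si !cst_id /sinv -/(S a).
by rewrite -SE (lker0_lfunK (S_ker a)).
Qed.

Lemma siK a b c (x : H a) : b = a^-1%g -> c = a -> sa (si b x) = cst c x.
Proof.
move=> eb ec; have ea : a = b^-1%g by grp.
clear eb; subst c a; rewrite /si !cst_id /sinv -/(S b).
by rewrite -SE limg_lfunVK // S_img memvf.
Qed.

End Bijective.
Arguments si {k pi H} d {a c} x.

(** * Laws of the inverse antipode *)

Section InverseAntipode.
Variables (k : fieldType) (pi : groupType) (H : pi -> vectType k).
Variable d : chc_data (Hl H).
Hypothesis hd : is_chc d.
Local Notation mu := (mu d).
Local Notation one := (oneH d).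
Local Notation ep := (ep d).
Local Notation ph := (ph d).
Local Notation sa := (sa d).
Local Notation Ds := (Ds d).
Local Notation si := (si d).

Lemma si_lin a c : klinear (fun x : H a => si x : H c).
Proof.
have := @klin_hom _ _ _ ((linfun (cS d c : H c -> H c^-1%g))^-1)%VF.
by move=> h t x y; rewrite /si /sinv cst_lin h.
Qed.

(** Carries the laws of S over to S^-1: both sides are compared after applying S. *)
Lemma sa_inj a b (x y : H a) : b = a^-1%g -> sa x = sa y :> H b -> x = y.
Proof. by move=> e /(congr1 (fun z : H b => si z : H a)); rewrite !(saK hd) // !cst_id. Qed.

Lemma si_cst a a' c (x : H a) : a = a' -> si (cst a' x) = si x :> H c.
Proof. by move=> e; subst a'; rewrite cst_id. Qed.

Lemma sa_si a b (x : H a) : b = a^-1%g -> sa (si x : H b) = x.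
Proof. by move=> e; rewrite (siK hd) ?cst_id. Qed.

Lemma si_sa a b (x : H a) : b = a^-1%g -> si (sa x : H b) = x.
Proof. by move=> e; rewrite (saK hd) ?cst_id. Qed.

Lemma si_mu a c (x y : H a) : c = a^-1%g -> si (mu x y) = mu (si y) (si x) :> H c.
Proof.
move=> e; apply: (@sa_inj _ a); first by grp.
by rewrite (sa_mu hd) ?sa_si //; grp.
Qed.

Lemma si_one a c : c = a^-1%g -> si (one : H a) = one :> H c.
Proof.
move=> e; apply: (@sa_inj _ a); first by grp.
by rewrite (sa_one hd) ?sa_si //; grp.
Qed.

Lemma ep_si a c (x : H a) : a = 1%g -> c = 1%g -> ep (si x : H c) = ep x.
Proof.
move=> ea ec; rewrite -[in RHS](sa_si (b := c) x); last by grp.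
by rewrite (ep_sa hd).
Qed.

Lemma si_ph g a b c e (x : H a) : b = (g * a * g^-1)%g -> e = b^-1%g -> c = a^-1%g ->
  si (ph g x : H b) = ph g (si x : H c) :> H e.
Proof.
move=> eb ee ec; apply: (@sa_inj _ b); first by grp.
by rewrite sa_si // (sa_ph hd (c := a)) ?sa_si //; grp.
Qed.

Lemma Ds_si a b c a' b' c' (W : lmodType k) (F : H a -> H b -> W) (x : H c) : bilin F ->
  a' = a^-1%g -> b' = b^-1%g -> c' = (a * b)%g -> c = (b' * a')%g ->
  Ds F (si x : H c') = Ds (fun (u : H b') (v : H a') => F (si v) (si u)) x.
Proof.
move=> hF ea eb ec' ec; rewrite -{2}(sa_si (b := c') x); last by grp.
rewrite (Ds_sa hd (a' := b) (b' := a)).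
- by apply: eq_Ds => u v; rewrite !si_sa //; grp.
- by split=> w; [apply: (klin_comp (hF.2 _))|apply: (klin_comp (hF.1 _))]; apply: si_lin.
all: grp.
Qed.

(** With x = S(y) the coproduct is reversed, and S^-1(x'') x' turns into y' S(y''), the right
    antipode axiom for y. In the same way [Ds_sir] comes from the left one. *)
Lemma Ds_sil a b c (W : lmodType k) (G : H b -> W) (x : H c) :
  klinear G -> b = a^-1%g -> c = 1%g ->
  Ds (fun (u : H b) (v : H a) => G (mu (si v) u)) x = ep x *: G one.
Proof.
move=> hG eb ec; rewrite -{1}(sa_si (b := c) x); last by grp.
rewrite (Ds_sa hd (a' := a) (b' := b)).
- transitivity (Ds (fun (u : H b) (v : H a) => G (mu u (sa v))) (si x : H c)).
    by apply: eq_Ds => u v; rewrite si_sa //; grp.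
  by rewrite (Ds_antir hd) ?ep_si //; grp.
- split=> w; apply: (klin_comp hG); first lin.
  by eapply klin_mul_l => //; apply: si_lin.
all: grp.
Qed.

Lemma Ds_sir a b c (W : lmodType k) (G : H a -> W) (x : H c) :
  klinear G -> b = a^-1%g -> c = 1%g ->
  Ds (fun (u : H b) (v : H a) => G (mu v (si u))) x = ep x *: G one.
Proof.
move=> hG eb ec; rewrite -{1}(sa_si (b := c) x); last by grp.
rewrite (Ds_sa hd (a' := a) (b' := b)).
- transitivity (Ds (fun (u : H b) (v : H a) => G (mu (sa u) v)) (si x : H c)).
    by apply: eq_Ds => u v; rewrite si_sa //; grp.
  by rewrite (Ds_antil hd) ?ep_si //; grp.
- split=> w; apply: (klin_comp hG); last lin.
  by eapply klin_mul_r => //; apply: si_lin.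
all: grp.
Qed.

Lemma sirL u a b c (W : lmodType k) (F : H b -> H a -> W) (x : H a) :
  bilin F -> u = 1%g -> c = b^-1%g ->
  Ds (fun (r : H u) z => Ds (fun (x1 : H c) x2 => F (mu x2 (si x1)) z) r) x = F one x.
Proof.
move=> hF hu hc; etransitivity.
  by apply: eq_Ds => r z; apply: (Ds_sir (G := F^~ z)); side.
by rewrite (Ds_counitl hd) ?cst_id //; side.
Qed.

End InverseAntipode.

Ltac lin_ext ::= lazymatch goal with
  | |- klinear (fun x => si _ _) => eapply klin_comp; [eapply si_lin; eassumption | lin]
  end.

(** * The threefold Sweedler sum in the product of D_a(H) *)

Section Twist.
Variables (k : fieldType) (pi : groupType) (H : pi -> vectType k).
Variable d : chc_data (Hl H).
Hypothesis hd : is_chc d.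
Local Notation mu := (mu d).
Local Notation one := (oneH d).
Local Notation ep := (ep d).
Local Notation ph := (ph d).
Local Notation Ds := (Ds d).
Local Notation si := (si d).

(* The sum of F h''_(a^-1) (S^-1(h'''_(e^-1))) (phi_a(h'_(a^-1 e a))) that occurs in the
   product of D_a(H). *)
Definition Tw a e (W : lmodType k) (F : H a^-1%g -> H e -> H e -> W) (h : H a^-1%g) : W :=
  Ds (fun (h1 : H (a^-1 * e * a)%g) (r : H (a^-1 * e^-1)%g) =>
    Ds (fun (h2 : H a^-1%g) (h3 : H e^-1%g) => F h2 (si h3) (ph a h1)) r) h.

Lemma eq_Tw a e (W : lmodType k) (F G : H a^-1%g -> H e -> H e -> W) h :
  (forall m u v, F m u v = G m u v) -> Tw F h = Tw G h.
Proof. by move=> E; apply: eq_Ds => h1 r; apply: eq_Ds => h2 h3. Qed.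

Lemma Tw_lin a e (W : lmodType k) (F : H a^-1%g -> H e -> H e -> W) : klinear (@Tw a e W F).
Proof. exact: Ds_lin. Qed.

Lemma klin_Tw (U : lmodType k) a e (W : lmodType k)
  (F : U -> H a^-1%g -> H e -> H e -> W) h :
  (forall m u v, klinear (fun t => F t m u v)) -> klinear (fun t => Tw (F t) h).
Proof. by move=> E; apply: klin_Ds => h1 r; apply: klin_Ds => h2 h3; apply: E. Qed.

Lemma klin_TwF a e (W W' : lmodType k) (g : W -> W') (F : H a^-1%g -> H e -> H e -> W) h :
  klinear g -> g (Tw F h) = Tw (fun m u v => g (F m u v)) h.
Proof.
move=> hg; rewrite /Tw (klin_DsF d _ _ hg); apply: eq_Ds => h1 r.
by rewrite (klin_DsF d _ _ hg).
Qed.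

Lemma Tw_Dswap a e b c b' (W : lmodType k) (F : H a^-1%g -> H e -> H e -> H b -> H c -> W) h
  (x : H b') :
  Tw (fun m u v => Ds (F m u v) x) h = Ds (fun y z => Tw (fun m u v => F m u v y z) h) x.
Proof.
rewrite [RHS]Ds_swap; apply: eq_Ds => h1 r.
by rewrite [RHS]Ds_swap; apply: eq_Ds => h2 h3.
Qed.

(** S^-1 reverses products while phi_a preserves them, hence u' u but v v'. This order is what makes
    u x v, and with it [Lh], an action of H_(a^-1). *)
Lemma Tw_mu a e (W : lmodType k) (F : H a^-1%g -> H e -> H e -> W) h g :
  (forall u v, klinear (fun m => F m u v)) -> (forall m v, klinear (fun u => F m u v)) ->
  (forall m u, klinear (F m u)) ->
  Tw F (mu h g) =
  Tw (fun m u v => Tw (fun m' u' v' => F (mu m m') (mu u' u) (mu v v')) g) h.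
Proof.
move=> h1 h2 h3; rewrite /Tw.
rewrite (Ds_mu hd); [|split; lin|grp].
apply: eq_Ds => x1 x2; rewrite [RHS]Ds_swap; apply: eq_Ds => y1 y2.
rewrite (Ds_mu hd); [|split; lin|grp].
apply: eq_Ds => x3 x4; apply: eq_Ds => y3 y4.
by rewrite (si_mu hd) ?(ph_mu hd) //; grp.
Qed.

Lemma Tw_one a e (W : lmodType k) (F : H a^-1%g -> H e -> H e -> W) :
  (forall u v, klinear (fun m => F m u v)) -> (forall m v, klinear (fun u => F m u v)) ->
  (forall m u, klinear (F m u)) -> Tw F one = F one one one.
Proof.
move=> h1 h2 h3; rewrite /Tw.
rewrite (Ds_one hd); [|split; lin|grp].
rewrite (Ds_one hd); [|split; lin|grp].
by rewrite (si_one hd) ?(ph_one hd) //; grp.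
Qed.

Lemma Tw_ep a (W : lmodType k) (F : H a^-1%g -> W) h : klinear F ->
  Tw (fun m (u v : H 1) => ep u *: (ep v *: F m)) h = F h.
Proof.
move=> hF; rewrite /Tw.
transitivity (Ds (fun (h1 : H (a^-1 * 1 * a)%g) (r : H (a^-1 * 1^-1)%g) =>
    ep h1 *: F (cst a^-1%g r)) h).
  apply: eq_Ds => h1 r; rewrite -(Ds_counitr hd (b := 1^-1%g) (G := fun r => ep h1 *: F r)); try grp.
    by apply: eq_Ds => m v; rewrite (ep_si hd) ?(ep_ph hd) //; grp.
  lin.
rewrite (Ds_counitl hd (G := fun r => F (cst a^-1%g r))); try grp.
  by rewrite cst_cst ?cst_id //; grp.
lin.
Qed.

(** Splitting the two outer legs of h gives five legs. S^-1 reverses the last two, so that u1, v1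
    come from the outermost legs and u2, v2 from the next ones: these are [Tw] applied again to the
    middle leg. *)
Lemma Tw_Ds a e e1 e2 (W : lmodType k)
  (F : H a^-1%g -> H e1 -> H e2 -> H e1 -> H e2 -> W) h :
  (forall u u' v v', klinear (fun m => F m u u' v v')) ->
  (forall m u' v v', klinear (fun u => F m u u' v v')) ->
  (forall m u v v', klinear (fun u' => F m u u' v v')) ->
  (forall m u u' v', klinear (fun v => F m u u' v v')) ->
  (forall m u u' v, klinear (fun v' => F m u u' v v')) ->
  e = (e1 * e2)%g ->
  Tw (fun m (u v : H e) => Ds (fun u1 u2 => Ds (fun v1 v2 => F m u1 u2 v1 v2) v) u) h =
  Tw (fun m u1 v1 => Tw (fun m2 u2 v2 => F m2 u1 u2 v1 v2) m) h.
Proof.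
move=> l1 l2 l3 l4 l5 ee; rewrite /Tw.
pose G (s : H (a^-1 * e1 * a)%g) (t : H (a^-1 * e2 * a)%g) m (p : H e2^-1%g) (q : H e1^-1%g) :=
  F m (si q) (si p) (ph a s) (ph a t).
transitivity (Ds (fun (h1 : H (a^-1 * e * a)%g) (r : H (a^-1 * e^-1)%g) => Ds (fun s t =>
   Ds (fun (h2 : H a^-1%g) (h3 : H e^-1%g) => Ds (fun p q => G s t h2 p q) h3) r) h1) h).
  apply: eq_Ds => h1 r; rewrite [RHS]Ds_swap; apply: eq_Ds => h2 h3.
  rewrite [RHS]Ds_swap (Ds_si hd (a' := e1^-1%g) (b' := e2^-1%g)); [|split; lin|grp|grp|grp|grp].
  apply: eq_Ds => p q.
  by rewrite (Ds_ph hd (a := (a^-1 * e1 * a)%g) (b := (a^-1 * e2 * a)%g)) //; grp.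
rewrite -(Ds_coassoc hd (u := (a^-1 * e1^-1)%g) (fun s t r => Ds (fun (h2 : H a^-1%g)
   (h3 : H e^-1%g) => Ds (fun p q => G s t h2 p q) h3) r)); try grp.
apply: eq_Ds => s w.
transitivity (Ds (fun (t : H (a^-1 * e2 * a)%g) (r : H (a^-1 * e^-1)%g) => Ds (fun (z : H (a^-1 * e2^-1)%g) q =>
   Ds (fun h2 p => G s t h2 p q) z) r) w).
  by apply: eq_Ds => t r; rewrite (Ds_coassoc hd (w := (a^-1 * e2^-1)%g)) //; grp.
by rewrite (Ds_coassoc hd (w := a^-1%g)) //; grp.
Qed.

Lemma Tw_ph b a e (W : lmodType k) (F : H (b * a * b^-1)^-1%g -> H (b * e * b^-1)%g ->
    H (b * e * b^-1)%g -> W) (h : H a^-1%g) :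
  (forall u v, klinear (fun m => F m u v)) -> (forall m v, klinear (fun u => F m u v)) ->
  (forall m u, klinear (F m u)) ->
  Tw F (ph b h) = Tw (fun m (u v : H e) => F (ph b m) (ph b u) (ph b v)) h.
Proof.
move=> l1 l2 l3; rewrite /Tw.
rewrite (Ds_ph hd (a := (a^-1 * e * a)%g) (b := (a^-1 * e^-1)%g)); [|split; lin|grp|grp|grp|grp].
apply: eq_Ds => h1 r.
rewrite (Ds_ph hd (a := a^-1%g) (b := e^-1%g)); [|split; lin|grp|grp|grp|grp].
apply: eq_Ds => h2 h3.
rewrite (si_ph hd (c := e)); try grp.
by rewrite !(ph_ph hd) ?mulgVK //; grp.
Qed.

(* In the middle, phi_b(h4) S^-1(phi_b(h3)) cancels; this makes the coproduct of D(H)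
   multiplicative. *)
Lemma Tw_Delta a b e (W : lmodType k)
  (F : H a^-1%g -> H b^-1%g -> H e -> H e -> H e -> W) (h : H (a * b)^-1%g) :
  (forall m' u' w v, klinear (fun m => F m m' u' w v)) ->
  (forall m u' w v, klinear (fun m' => F m m' u' w v)) ->
  (forall m m' w v, klinear (fun u' => F m m' u' w v)) ->
  (forall m m' u' v, klinear (fun w => F m m' u' w v)) ->
  (forall m m' u' w, klinear (fun v => F m m' u' w v)) ->
  Ds (fun (p : H (b^-1 * a^-1 * b)%g) (l : H b^-1%g) =>
    Tw (fun m u v => Tw (fun m' u' v' => F m m' u' (mu v' u) v) l) (ph b p)) h =
  Tw (fun n u' v => Ds (fun (p : H (b^-1 * a^-1 * b)%g) l => F (ph b p) l u' one v) n) h.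
Proof.
move=> l1 l2 l3 l4 l5; rewrite /Tw.
pose G (k1 : H ((a * b)^-1 * e * (a * b))%g) (k2 : H (b^-1 * a^-1 * b)%g)
  (z : H (b^-1 * e * b)%g) (l2 : H b^-1%g) (l3 : H e^-1%g) : W :=
  F (ph b k2) l2 (si l3) (ph b z) (ph (a * b)%g k1).
transitivity (Ds (fun (p : H (b^-1 * a^-1 * b)%g) (l : H b^-1%g) =>
  Ds (fun k1 (r : H (b^-1 * a^-1 * e^-1 * b)%g) => Ds (fun k2 (k3 : H (b^-1 * e^-1 * b)%g) =>
  Ds (fun (l1 : H (b^-1 * e * b)%g) (s : H (b^-1 * e^-1)%g) => Ds (fun l2 l3 =>
    G k1 k2 (mu l1 (si k3)) l2 l3) s) l) r) p) h).
  apply: eq_Ds => p l.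
  rewrite (Ds_ph hd (a := ((a * b)^-1 * e * (a * b))%g) (b := (b^-1 * a^-1 * e^-1 * b)%g));
    [|split; lin|grp|grp|grp|grp].
  apply: eq_Ds => k1 r.
  rewrite (Ds_ph hd (a := (b^-1 * a^-1 * b)%g) (b := (b^-1 * e^-1 * b)%g));
    [|split; lin|grp|grp|grp|grp].
  apply: eq_Ds => k2 k3; apply: eq_Ds => l1' s; apply: eq_Ds => l2' l3'; rewrite /G.
  rewrite (si_ph hd (c := (b^-1 * e * b)%g)); try grp.
  by rewrite (ph_mu hd) ?(ph_ph hd) //; grp.
rewrite -(Ds_coassoc hd (u := ((a * b)^-1 * e^-1)%g) (fun k1 (r : H (b^-1 * a^-1 * e^-1 * b)%g) l =>
  Ds (fun k2 (k3 : H (b^-1 * e^-1 * b)%g) =>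
  Ds (fun (l1 : H (b^-1 * e * b)%g) (s : H (b^-1 * e^-1)%g) => Ds (fun l2 l3 =>
    G k1 k2 (mu l1 (si k3)) l2 l3) s) l) r)); try grp.
apply: eq_Ds => k1 q.
rewrite -(Ds_coassoc hd (u := (b^-1 * e^-1)%g) (fun k2 (k3 : H (b^-1 * e^-1 * b)%g) l =>
  Ds (fun (l1 : H (b^-1 * e * b)%g) (s : H (b^-1 * e^-1)%g) => Ds (fun l2 l3 =>
    G k1 k2 (mu l1 (si k3)) l2 l3) s) l)); try grp.
rewrite -(Ds_coassoc hd (u := (b^-1 * e^-1)%g)); try grp.
apply: eq_Ds => k2 t.
(* This groups k3 and l1 as the two legs of an element of H_1, so that l1 S^-1(k3) contracts. *)
rewrite (Ds_coassoc hd (w := 1%g)); try grp.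
rewrite (sirL hd (F := fun z s => Ds (fun l2 l3 => G k1 k2 z l2 l3) s));
  [|rewrite /G; split; lin|grp|grp].
apply: eq_Ds => l2' l3'; rewrite /G.
by rewrite (ph_one hd) //; grp.
Qed.

End Twist.

Ltac lin_ext ::= lazymatch goal with
  | |- klinear (fun x => si _ _) => eapply klin_comp; [eapply si_lin; eassumption | lin]
  | |- klinear (fun x => Tw _ _ _) =>
      first [ eapply klin_comp; [eapply Tw_lin; eassumption | lin] | eapply klin_Tw; lin ]
  end.

(** * Product and coproduct on homogeneous components *)

Section Product.
Variables (k : fieldType) (pi : groupType) (H : pi -> vectType k).
Variable d : chc_data (Hl H).
Hypothesis hd : is_chc d.
Local Notation mu := (mu d).
Local Notation one := (oneH d).
Local Notation ep := (ep d).
Local Notation ph := (ph d).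
Local Notation Ds := (Ds d).
Local Notation Tw := (Tw d).

(* Left multiplication by h # epsilon on Y, an element of H_(a^-1) (x) H_e^*. *)
Definition Lh a e (Y : H e -> H a^-1%g) (h : H a^-1%g) (x : H e) : H a^-1%g :=
  Tw (fun m u v => mu m (Y (mu (mu u x) v))) h.

Lemma Lh_linh a e (Y : H e -> H a^-1%g) x : klinear (fun h => Lh Y h x).
Proof. exact: (Tw_lin hd). Qed.

Lemma Lh_linx a e (Y : H e -> H a^-1%g) h : klinear Y -> klinear (Lh Y h).
Proof. move=> hY; rewrite /Lh; lin. Qed.

Lemma Lh_mu a e (Y : H e -> H a^-1%g) h g x : klinear Y ->
  Lh Y (mu h g) x = Lh (Lh Y g) h x.
Proof.
move=> hY; rewrite /Lh (Tw_mu hd); try lin.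
apply: eq_Tw => m u v.
have hm : klinear (fun z : H a^-1%g => mu m z) by lin.
rewrite [RHS](klin_TwF d _ _ hm).
by apply: eq_Tw => m' u' v'; rewrite !(muA hd).
Qed.

Lemma Lh_one a e (Y : H e -> H a^-1%g) x : klinear Y -> Lh Y one x = Y x.
Proof.
move=> hY; rewrite /Lh (Tw_one hd); try lin.
by rewrite !(mu1l hd) (mu1r hd).
Qed.

(* The product of D_a(H) on X : H_c -> H_(a^-1), Y : H_e -> H_(a^-1), read as elements
   of H_(a^-1) (x) H_c^* and H_(a^-1) (x) H_e^*. *)
Definition mulf a c e g (X : H c -> H a^-1%g) (Y : H e -> H a^-1%g) (x : H g) : H a^-1%g :=
  Ds (fun x1 x2 => Lh Y (X x1) x2) x.

Lemma mulf_linx a c e g (X : H c -> H a^-1%g) (Y : H e -> H a^-1%g) :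
  klinear (@mulf a c e g X Y).
Proof. exact: (Ds_lin hd). Qed.

(** Delta(u x v) splits along c e. By [Tw_Ds] the outer pair goes to X, and the inner pair makes the
    middle leg m act on [Lh Y (X _)]; [Lh_mu] joins the two actions into that of the product of m
    with the value of X. *)
Lemma Lh_mulf a c e g (X : H c -> H a^-1%g) (Y : H e -> H a^-1%g) h (x : H g) :
  g = (c * e)%g -> klinear X -> klinear Y ->
  Lh (mulf X Y) h x = mulf (Lh X h) Y x.
Proof.
move=> eg hX hY; rewrite /mulf.
transitivity (Ds (fun x1 x2 => Tw (fun m (u v : H g) => Ds (fun u1 u2 => Ds (fun v1 v2 =>
   mu m (Lh Y (X (mu (mu u1 x1) v1)) (mu (mu u2 x2) v2))) v) u) h) x).
  rewrite -Tw_Dswap; apply: eq_Tw => m u v; rewrite /mulf.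
  have hm : klinear (fun z : H a^-1%g => mu m z) by lin.
  have hL h' := Lh_linx h' hY; have hL' := @Lh_linh a e Y.
  rewrite [LHS](klin_DsF d _ _ hm).
  rewrite (Ds_mu hd); [|split; lin|grp].
  rewrite (Ds_mu hd); [|split; lin|grp].
  by rewrite Ds_swap; apply: eq_Ds => x1 x2; apply: eq_Ds => u1 u2.
apply: eq_Ds => x1 x2.
have hL h' := Lh_linx h' hY; have hL' := @Lh_linh a e Y.
rewrite (Tw_Ds hd (e1 := c) (e2 := e)); try lin; try grp.
rewrite {3}/Lh (klin_TwF d _ _ (Lh_linh _ _)); apply: eq_Tw => m u v.
by rewrite Lh_mu.
Qed.

Lemma mulfA a c e f ce ef t (X : H c -> H a^-1%g) (Y : H e -> H a^-1%g)
    (Z : H f -> H a^-1%g) (x : H t) :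
  ce = (c * e)%g -> ef = (e * f)%g -> t = (c * ef)%g -> klinear X -> klinear Y -> klinear Z ->
  mulf X (mulf Y Z : H ef -> _) x = mulf (mulf X Y : H ce -> _) Z x.
Proof.
move=> e1 e2 e3 hX hY hZ; rewrite {1}/mulf.
under eq_Ds => x1 y do rewrite (Lh_mulf _ _ e2 hY hZ).
rewrite /mulf (Ds_coassoc hd (w := ce)); try grp.
by apply: eq_Ds => w y2; rewrite (klin_DsF d _ _ (Lh_linh _ _)).
Qed.

Lemma eq_mulf a c e g (X X' : H c -> H a^-1%g) (Y Y' : H e -> H a^-1%g) (x : H g) :
  X =1 X' -> Y =1 Y' -> mulf X Y x = mulf X' Y' x.
Proof.
move=> eX eY; apply: eq_Ds => x1 x2; rewrite eX.
by apply: eq_Tw => m u v; rewrite eY.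
Qed.

Lemma mulf_linX (U : lmodType k) a c e g (X : U -> H c -> H a^-1%g) (Y : H e -> H a^-1%g) (x : H g) :
  (forall y, klinear (X ^~ y)) -> klinear (fun t => mulf (X t) Y x).
Proof. by move=> hX; have := @Lh_linh a e Y => hL; rewrite /mulf; lin. Qed.

Lemma mulf_linY (U : lmodType k) a c e g (X : H c -> H a^-1%g) (Y : U -> H e -> H a^-1%g) (x : H g) :
  (forall y, klinear (Y ^~ y)) -> klinear (fun t => mulf X (Y t) x).
Proof. by move=> hY; rewrite /mulf /Lh; lin. Qed.

Lemma mul1f a e g (Y : H e -> H a^-1%g) (x : H g) : klinear Y -> g = e ->
  mulf (fun x : H 1 => ep x *: one) Y x = Y (cst e x).
Proof.
move=> hY eg; rewrite /mulf.
transitivity (Ds (fun (x1 : H 1) x2 => ep x1 *: Y x2) x).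
  apply: eq_Ds => x1 x2; rewrite (klinZ _ _ (Lh_linh _ _)).
  by rewrite Lh_one.
by rewrite (Ds_counitl hd) //.
Qed.

Lemma mulf1 a c g (X : H c -> H a^-1%g) (x : H g) : klinear X -> g = c ->
  mulf X (fun x : H 1 => ep x *: one) x = X (cst c x).
Proof.
move=> hX eg; rewrite /mulf.
transitivity (Ds (fun x1 (x2 : H 1) => ep x2 *: X x1) x).
  apply: eq_Ds => x1 x2; rewrite /Lh.
  have hF : klinear (fun m : H a^-1%g => ep x2 *: m) by lin.
  rewrite -[RHS](Tw_ep hd _ hF).
  apply: eq_Tw => m u v; rewrite !(ep_mu hd) // (klinZ _ _ (klin_mul_r hd m (@klin_id _ _))).
  by rewrite (mu1r hd) !scalerA; congr (_ *: _); rewrite mulrAC.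
by rewrite (Ds_counitr hd).
Qed.

Lemma ph_mulf b a c e g (X : H c -> H a^-1%g) (Y : H e -> H a^-1%g)
   (X' : H (b * c * b^-1)%g -> H (b * a * b^-1)^-1%g)
   (Y' : H (b * e * b^-1)%g -> H (b * a * b^-1)^-1%g) (x : H g) :
  g = (c * e)%g -> klinear X' -> klinear Y' ->
  (forall x, X' (ph b x) = ph b (X x)) -> (forall y, Y' (ph b y) = ph b (Y y)) ->
  mulf X' Y' (ph b x : H (b * g * b^-1)%g) = ph b (mulf X Y x).
Proof.
move=> eg hX hY eX eY; rewrite /mulf (klin_DsF d _ _ (@ph_lin _ _ _ _ hd b _ _)).
have hL h' := Lh_linx h' hY; have hL' := @Lh_linh _ _ Y'.
rewrite (Ds_ph hd (a := c) (b := e)); [|split; lin|grp|grp|grp|grp].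
apply: eq_Ds => x1 x2; rewrite eX /Lh (Tw_ph hd); try lin.
rewrite (klin_TwF d _ _ (@ph_lin _ _ _ _ hd b _ _)); apply: eq_Tw => m u v.
by rewrite -!(ph_mu hd) ?eY -?(ph_mu hd) //; grp.
Qed.

End Product.

Section Coproduct.
Variables (k : fieldType) (pi : groupType) (H : pi -> vectType k).
Variable d : chc_data (Hl H).
Hypothesis hd : is_chc d.
Local Notation mu := (mu d).
Local Notation ph := (ph d).
Local Notation Ds := (Ds d).
Local Notation Tw := (Tw d).
Local Notation mulf := (mulf d).

Definition lf (U V : vectType k) (f : U -> V) : 'Hom(U, V) := linfun f.

(** [linfun] of a bare function has the expected values only when the function is linear; the proof
    packs it as a linear map so that [lfunE] applies. *)
Lemma lfE (U V : vectType k) (f : U -> V) : klinear f -> lf f =1 f.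
Proof.
move=> hf x.
pose g := HB.pack_for {linear U -> V} f (GRing.isLinear.Build _ _ _ _ _ hf).
by rewrite /lf -[f]/(g : _ -> _) lfunE.
Qed.

Definition rk (U V : vectType k) (h : V) (f : U -> k^o) : 'Hom(U, V) :=
  lf (fun x => (f x : k) *: h).

Lemma rkE (U V : vectType k) (h : V) (f : U -> k^o) x : klinear f -> rk h f x = (f x : k) *: h.
Proof. by move=> hf; rewrite lfE //; lin. Qed.

Lemma klin_rkl (W : lmodType k) (U V : vectType k) (h : W -> V) (f : U -> k^o) :
  klinear f -> klinear h -> klinear (fun t => rk (h t) f).
Proof.
move=> hf hh c s t; apply/lfunP => x.
by rewrite add_lfunE scale_lfunE !rkE // hh scalerDr !scalerA mulrC.
Qed.

Lemma klin_rkr (W : lmodType k) (U V : vectType k) (h : V) (f : W -> U -> k^o) :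
  (forall t, klinear (f t)) -> (forall x, klinear (f ^~ x)) -> klinear (fun t => rk h (f t)).
Proof.
move=> hf hh c s t; apply/lfunP => x.
by rewrite add_lfunE scale_lfunE !rkE // (hh x) scalerDl scalerA.
Qed.

Lemma hom_basis (U V : vectType k) (X : 'Hom(U, V)) : X = \sum_i rk (X (bs i)) (cf i).
Proof.
apply/lfunP => x; rewrite sum_lfunE {1}(basisE x) linear_sum.
by apply: eq_bigr => i _; rewrite linearZ rkE //; exact: cf_lin.
Qed.

Section DS.
Variables (W : lmodType k) (a b c : pi).
Local Notation P := (b^-1 * a^-1 * b)%g.

(* The sum of B over Delta_(a,b)(X), where X in Hom(H_c, H_((ab)^-1)) has as coproduct the map
   (x, y) |-> (phi_b (x) id) (Delta(X(yx))), see DS_eval. *)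
Definition DS (B : 'Hom(H c, H a^-1%g) -> 'Hom(H c, H b^-1%g) -> W)
    (X : 'Hom(H c, H (a * b)^-1%g)) : W :=
  \sum_i \sum_j Ds (fun (p : H P) (l : H b^-1%g) =>
     B (rk (ph b p) (cf i)) (rk l (cf j))) (X (mu (bs j) (bs i))).

Lemma eq_DS B B' X : (forall X1 X2, B X1 X2 = B' X1 X2) -> DS B X = DS B' X.
Proof.
by move=> e; apply: eq_bigr => i _; apply: eq_bigr => j _; apply: eq_Ds => p l; rewrite e.
Qed.

Lemma DS_lin B : klinear (DS B).
Proof. by rewrite /DS; lin. Qed.

Lemma DS_sum I (r : seq I) (Q : pred I) B X :
  DS (fun X1 X2 => \sum_(i <- r | Q i) B i X1 X2) X = \sum_(i <- r | Q i) DS (B i) X.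
Proof.
rewrite /DS [RHS]exchange_big; apply: eq_bigr => i _ /=.
rewrite [RHS]exchange_big; apply: eq_bigr => j _ /=.
by rewrite Ds_sum.
Qed.

Lemma DS_Ds e f g (B : _ -> _ -> H e -> H f -> W) X (x : H g) :
  DS (fun X1 X2 => Ds (B X1 X2) x) X = Ds (fun u v => DS (fun X1 X2 => B X1 X2 u v) X) x.
Proof.
rewrite /DS Ds_sum; apply: eq_bigr => i _; rewrite Ds_sum; apply: eq_bigr => j _.
by rewrite Ds_swap.
Qed.

Lemma DS_Tw a' e (B : _ -> _ -> H a'^-1%g -> H e -> H e -> W) X h :
  DS (fun X1 X2 => Tw (B X1 X2) h) X = Tw (fun m u v => DS (fun X1 X2 => B X1 X2 m u v) X) h.
Proof. by rewrite /Tw DS_Ds; apply: eq_Ds => h1 r; rewrite DS_Ds. Qed.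

(** The sums over the bases in [DS] close up: they are the expansion of x and y in a form bilinear
    in both. Coproduct identities in D(H) are proved after this evaluation. *)
Lemma DS_eval (G : H a^-1%g -> H b^-1%g -> W) X (x y : H c) : bilin G ->
  DS (fun X1 X2 => G (X1 x) (X2 y)) X =
  Ds (fun (p : H P) l => G (ph b p) l) (X (mu y x)).
Proof.
move=> hG.
have hB : bilin (fun x y : H c => Ds (fun (p : H P) l => G (ph b p) l) (X (mu y x))) by lin.
rewrite (bilin_basis x y hB); apply: eq_bigr => i _; apply: eq_bigr => j _.
rewrite -Ds_scale; apply: eq_Ds => p l; rewrite !rkE; try exact: cf_lin.
by rewrite (klinZ _ _ (hG.1 _)) (klinZ _ _ (hG.2 _)) scalerA.
Qed.

Lemma bil_decomp (B : 'Hom(H c, H a^-1%g) -> 'Hom(H c, H b^-1%g) -> W) X1 X2 : bilin B ->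
  B X1 X2 = \sum_i \sum_j B (rk (X1 (bs i)) (cf i)) (rk (X2 (bs j)) (cf j)).
Proof.
move=> hB; rewrite {1}(hom_basis X1) (klin_sum_arg _ _ _ (hB.1 _)).
apply: eq_bigr => i _; rewrite {1}(hom_basis X2) (klin_sum_arg _ _ _ (hB.2 _)).
by [].
Qed.

Lemma DSE B X : DS B X = \sum_i \sum_j Ds (fun (p : H P) l => B (rk (ph b p) (cf i)) (rk l (cf j)))
    (X (mu (bs j) (bs i))).
Proof. by []. Qed.

End DS.

(** Evaluated form of Delta(X) Delta(Y) = Delta(X Y). Evaluation turns the coproducts of X and Y
    into Sweedler sums of their values, in which the twists of the two tensor factors meet between y
    and x as v' u; [Tw_Delta] replaces this product by 1. *)
Lemma DS_mulf (W : lmodType k) a b c e g (G : H a^-1%g -> H b^-1%g -> W)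
   (X : 'Hom(H c, H (a * b)^-1%g)) (Y : 'Hom(H e, H (a * b)^-1%g)) (x y : H g) :
  bilin G -> g = (c * e)%g ->
  DS (fun X1 X2 => DS (fun Y1 Y2 => G (mulf X1 Y1 x) (mulf X2 Y2 y)) Y) X =
  Ds (fun (p : H (b^-1 * a^-1 * b)%g) l => G (ph b p) l) (mulf X Y (mu y x)).
Proof.
move=> hG eg; rewrite /mulf.
have hY : klinear Y by exact: klin_hom.
have hX : klinear X by exact: klin_hom.
have hL h := Lh_linx hd h hY.
transitivity (Ds (fun x1 x2 => Ds (fun y1 y2 => DS (fun X1 X2 => DS (fun Y1 Y2 =>
   Tw (fun m (u v : H e) => Tw (fun m' (u' v' : H e) =>
     G (mu m (Y1 (mu (mu u x2) v))) (mu m' (Y2 (mu (mu u' y2) v')))) (X2 y1)) (X1 x1)) Y) X) y) x).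
  transitivity (DS (fun X1 X2 => Ds (fun x1 x2 => Ds (fun y1 y2 => DS (fun Y1 Y2 =>
   Tw (fun m (u v : H e) => Tw (fun m' (u' v' : H e) =>
     G (mu m (Y1 (mu (mu u x2) v))) (mu m' (Y2 (mu (mu u' y2) v')))) (X2 y1)) (X1 x1)) Y) y) x) X).
    apply: eq_DS => X1 X2.
    transitivity (DS (fun Y1 Y2 => Ds (fun x1 x2 => Ds (fun y1 y2 =>
     Tw (fun m (u v : H e) => Tw (fun m' (u' v' : H e) =>
      G (mu m (Y1 (mu (mu u x2) v))) (mu m' (Y2 (mu (mu u' y2) v')))) (X2 y1)) (X1 x1)) y) x) Y).
      apply: eq_DS => Y1 Y2; rewrite (klin_DsF d _ _ (hG.1 _)); apply: eq_Ds => x1 x2.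
      rewrite (klin_DsF d _ _ (hG.2 _)); apply: eq_Ds => y1 y2.
      rewrite /Lh (klin_TwF d _ _ (hG.1 _)); apply: eq_Tw => m u v.
      by rewrite (klin_TwF d _ _ (hG.2 _)).
    by rewrite DS_Ds; apply: eq_Ds => x1 x2; rewrite DS_Ds.
  by rewrite DS_Ds; apply: eq_Ds => x1 x2; rewrite DS_Ds.
have hR : bilin (fun (z1 : H c) (z2 : H e) =>
    Ds (fun (p : H (b^-1 * a^-1 * b)%g) l => G (ph b p) l) (Lh d Y (X z1) z2)).
  split=> z; last exact: (klin_comp (Ds_lin hd _) (hL _)).
  exact: (klin_comp (Ds_lin hd _) (klin_comp (Lh_linh hd Y z) hX)).
rewrite [RHS](klin_DsF d _ _ (Ds_lin hd _)) (Ds_mu hd) // [RHS]Ds_swap.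
apply: eq_Ds => x1 x2; apply: eq_Ds => y1 y2.
transitivity (DS (fun X1 X2 => Tw (fun m (u v : H e) => Tw (fun m' (u' v' : H e) =>
   Ds (fun (p : H (b^-1 * a^-1 * b)%g) l => G (mu m (ph b p)) (mu m' l))
     (Y (mu (mu (mu u' y2) v') (mu (mu u x2) v)))) (X2 y1)) (X1 x1)) X).
  apply: eq_DS => X1 X2; rewrite DS_Tw; apply: eq_Tw => m u v.
  rewrite DS_Tw; apply: eq_Tw => m' u' v'.
  by rewrite (DS_eval (G := fun p l => G (mu m p) (mu m' l))) //; lin.
(* The slot w receives v' u, the product that cancels. *)
pose F m m' (u' w v : H e) :=
  Ds (fun (p : H (b^-1 * a^-1 * b)%g) l => G (mu m (ph b p)) (mu m' l))
    (Y (mu (mu (mu (mu u' y2) w) x2) v)).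
rewrite (DS_eval (G := fun h h' => Tw (fun m (u v : H e) => Tw (fun m' (u' v' : H e) =>
   Ds (fun (p : H (b^-1 * a^-1 * b)%g) l => G (mu m (ph b p)) (mu m' l))
     (Y (mu (mu (mu u' y2) v') (mu (mu u x2) v)))) h') h)); last first.
  by split=> z; [apply: Tw_lin|apply: klin_Tw => m u v; apply: Tw_lin].
transitivity (Ds (fun (p : H (b^-1 * a^-1 * b)%g) (l : H b^-1%g) =>
  Tw (fun m u v => Tw (fun m' u' v' => F m m' u' (mu v' u) v) l) (ph b p)) (X (mu y1 x1))).
  apply: eq_Ds => p l; apply: eq_Tw => m u v; apply: eq_Tw => m' u' v'.
  by rewrite /F !(muA hd).
rewrite (Tw_Delta hd); try (rewrite /F; lin).
rewrite /Lh (klin_TwF d _ _ (Ds_lin hd _)); apply: eq_Tw => n u v.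
rewrite (Ds_mu hd); [|lin|grp].
apply: eq_Ds => p l; rewrite /F (mu1r hd) !(muA hd); apply: eq_Ds => p' l'.
by rewrite (ph_mu hd) //; grp.
Qed.

End Coproduct.

(** * The algebras D_a(H) *)

Section FsecExtension.
Variables (k : fieldType) (I : eqType) (V : I -> lmodType k).
Implicit Types (F G : fsec V) (W : lmodType k).

(** Chosen from the mere existence of a support, so it may contain indices where F vanishes;
    [ext_cover] makes extensions independent of this choice. *)
Definition supp F : seq I := undup (sval (cid (fsec_supp F))).

Lemma supp_out F i : i \notin supp F -> F i = 0.
Proof. by rewrite mem_undup; case: cid => s hs /=; apply: hs. Qed.

Definition ext W (T : forall i, V i -> W) F : W := \sum_(i <- supp F) T i (F i).

Lemma sum_cover W (T : forall i, V i -> W) F (s t : seq I) :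
  (forall i, klinear (T i)) -> uniq s -> uniq t -> {subset s <= t} ->
  (forall i, i \notin s -> F i = 0) ->
  \sum_(i <- t) T i (F i) = \sum_(i <- s) T i (F i).
Proof.
move=> hT us ut st F0; rewrite (bigID (mem s)) /= [X in _ + X]big1 ?addr0.
  rewrite -big_filter; apply/perm_big/uniq_perm; rewrite ?filter_uniq // => i.
  by rewrite mem_filter; case: (boolP (i \in s)) => //= /st ->.
by move=> i /F0 ->; apply: klin0.
Qed.

Lemma ext_cover W (T : forall i, V i -> W) F (s : seq I) :
  (forall i, klinear (T i)) -> uniq s -> (forall i, i \notin s -> F i = 0) ->
  ext T F = \sum_(i <- s) T i (F i).
Proof.
move=> hT us F0; pose t := undup (supp F ++ s).
transitivity (\sum_(i <- t) T i (F i)); last first.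
  by apply: sum_cover; rewrite ?undup_uniq // => i hi; rewrite /t mem_undup mem_cat hi orbT.
symmetry; apply: sum_cover; rewrite ?undup_uniq //.
  by move=> i hi; rewrite /t mem_undup mem_cat hi.
exact: supp_out.
Qed.

Lemma ext_lin W (T : forall i, V i -> W) : (forall i, klinear (T i)) -> klinear (ext T).
Proof.
move=> hT c F G; pose s := undup (supp F ++ supp G).
have us : uniq s by apply: undup_uniq.
have hF i : i \notin s -> F i = 0.
  by rewrite mem_undup mem_cat negb_or => /andP[/supp_out].
have hG i : i \notin s -> G i = 0.
  by rewrite mem_undup mem_cat negb_or => /andP[_ /supp_out].
rewrite !(@ext_cover _ _ _ s) //; last first.
  by move=> i hi; rewrite /= hF // hG // scaler0 addr0.
rewrite scaler_sumr -big_split /=; apply: eq_bigr => i _; exact: hT.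
Qed.

Lemma fsingle_eq j (v : V j) : fsingle v j = v.
Proof. by rewrite /= /dsingle; case: eqP => // e; rewrite (eq_axiomK e). Qed.

Lemma fsingle_neq i j (v : V j) : i != j -> fsingle v i = 0.
Proof. by rewrite /= /dsingle eq_sym => /eqP ne; case: eqP. Qed.

Lemma ext_single W (T : forall i, V i -> W) j (v : V j) : (forall i, klinear (T i)) ->
  ext T (fsingle v) = T j v.
Proof.
move=> hT; rewrite (@ext_cover _ _ _ [:: j]) // ?big_seq1 ?fsingle_eq // => i.
by rewrite inE; apply: fsingle_neq.
Qed.

Lemma fsec_valP (c : k) F G i : (c *: F + G) i = c *: F i + G i.
Proof. by []. Qed.

Lemma fsingle_lin j : klinear (@fsingle k I V j).
Proof.
move=> c u v; apply: fsecP => i; rewrite fsec_valP.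
have [->|ne] := eqVneq i j; first by rewrite !fsingle_eq.
by rewrite !fsingle_neq // scaler0 addr0.
Qed.

Lemma fsec_sum F : F = \sum_(i <- supp F) fsingle (F i).
Proof.
apply: fsecP => j.
have D (A B : fsec V) : (A + B) j = A j + B j by [].
have Z : (0 : fsec V) j = 0 by [].
rewrite [RHS](big_morph (fun A : fsec V => A j) D Z).
have [jF|/[dup] jF /supp_out ->] := boolP (j \in supp F).
  rewrite (bigD1_seq j) ?undup_uniq // fsingle_eq big1; first exact/esym/addr0.
  by move=> i ne; rewrite fsingle_neq // eq_sym.
rewrite big_seq big1 // => i iF; rewrite fsingle_neq //.
by apply: contraNneq jF => ->.
Qed.

Lemma klin_fsec_eq W (f g : fsec V -> W) F : klinear f -> klinear g ->
  (forall j (v : V j), f (fsingle v) = g (fsingle v)) -> f F = g F.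
Proof.
move=> hf hg e; rewrite [F]fsec_sum !klin_sum_arg //.
by apply: eq_bigr => i _; apply: e.
Qed.

End FsecExtension.

Section DoubleData.
Variables (k : fieldType) (pi : groupType) (H : pi -> vectType k).
Variable d : chc_data (Hl H).
Hypothesis hd : is_chc d.
Local Notation mu := (mu d).
Local Notation one := (oneH d).
Local Notation ep := (ep d).
Local Notation Ds := (Ds d).
Local Notation mulf := (mulf d).

Definition sgl a c (X : 'Hom(H c, H a^-1%g)) : Dc H a :=
  @fsingle k pi (fun b : pi => ('Hom(H b, H a^-1%g) : lmodType k)) c X.

Lemma sgl_lin a c : klinear (@sgl a c).
Proof. exact: fsingle_lin. Qed.

Definition Dext a (W : lmodType k) (T : forall c, 'Hom(H c, H a^-1%g) -> W) (F : Dc H a) : W :=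
  ext T F.

Lemma Dext_lin a (W : lmodType k) (T : forall c, 'Hom(H c, H a^-1%g) -> W) :
  (forall c, klinear (T c)) -> klinear (Dext T).
Proof. exact: ext_lin. Qed.

Lemma Dext_sgl a (W : lmodType k) (T : forall c, 'Hom(H c, H a^-1%g) -> W) c (X : 'Hom(H c, _)) :
  (forall c, klinear (T c)) -> Dext T (sgl X) = T c X.
Proof. exact: ext_single. Qed.

Lemma klin_Dext (U : lmodType k) a (W : lmodType k) (T : U -> forall c, 'Hom(H c, H a^-1%g) -> W) F :
  (forall c X, klinear (fun t => T t c X)) -> klinear (fun t => Dext (T t) F).
Proof. by move=> h; apply: klin_sum => c; apply: h. Qed.

Lemma Dc_eq a (W : lmodType k) (f g : Dc H a -> W) F : klinear f -> klinear g ->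
  (forall c (X : 'Hom(H c, H a^-1%g)), f (sgl X) = g (sgl X)) -> f F = g F.
Proof. exact: klin_fsec_eq. Qed.

Lemma sgl_eq a c c' (X : 'Hom(H c, H a^-1%g)) (X' : 'Hom(H c', H a^-1%g)) : c = c' ->
  (forall x : H c, X x = X' (cst c' x)) -> sgl X = sgl X'.
Proof.
move=> e h; subst c'; congr sgl; apply/lfunP => x.
by rewrite h cst_id.
Qed.

Definition castH a b c (X : 'Hom(H c, H a^-1%g)) : 'Hom(H c, H b^-1%g) :=
  lf (fun x => cst b^-1%g (X x)).

Lemma castHE a b c (X : 'Hom(H c, H a^-1%g)) x : castH b X x = cst b^-1%g (X x).
Proof. by rewrite lfE //; lin. Qed.

Lemma trl_sgl a b (e : a = b) c (X : 'Hom(H c, H a^-1%g)) :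
  trl (Dc H) e (sgl X) = sgl (castH b X).
Proof.
subst b; rewrite /trl /=; congr sgl; apply/lfunP => x.
by rewrite castHE cst_id.
Qed.

Lemma trl_lin a b (e : a = b) : klinear (trl (Dc H) e).
Proof. by subst b. Qed.

Definition mulh a c e g (X : 'Hom(H c, H a^-1%g)) (Y : 'Hom(H e, H a^-1%g)) :
  'Hom(H g, H a^-1%g) := lf (mulf X Y).

Lemma mulhE a c e g (X : 'Hom(H c, H a^-1%g)) (Y : 'Hom(H e, H a^-1%g)) (x : H g) :
  mulh g X Y x = mulf X Y x.
Proof. exact/lfE/mulf_linx. Qed.

Lemma mulh_linl a c e g (Y : 'Hom(H e, H a^-1%g)) : klinear (fun X => @mulh a c e g X Y).
Proof.
move=> t X X'; apply/lfunP => x; rewrite add_lfunE scale_lfunE !mulhE.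
by apply: (mulf_linX hd (X := fun X : 'Hom(H c, _) => X)) => y; lin.
Qed.

Lemma mulh_linr a c e g (X : 'Hom(H c, H a^-1%g)) : klinear (@mulh a c e g X).
Proof.
move=> t Y Y'; apply/lfunP => x; rewrite add_lfunE scale_lfunE !mulhE.
by apply: (mulf_linY hd X (Y := fun Y : 'Hom(H e, _) => Y)) => y; lin.
Qed.

Definition Dmul a (F G : Dc H a) : Dc H a :=
  Dext (fun c X => Dext (fun e Y => sgl (mulh (c * e)%g X Y)) G) F.

Lemma Dmul_lin1 a c (X : 'Hom(H c, H a^-1%g)) :
  klinear (Dext (fun e (Y : 'Hom(H e, _)) => sgl (mulh (c * e)%g X Y))).
Proof. by apply: Dext_lin => e; apply: klin_comp (@sgl_lin _ _) _; apply: mulh_linr. Qed.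

Lemma Dmul_lin2 a (G : Dc H a) c :
  klinear (fun X : 'Hom(H c, H a^-1%g) => Dext (fun e Y => sgl (mulh (c * e)%g X Y)) G).
Proof. by apply: klin_Dext => e Y; apply: klin_comp (@sgl_lin _ _) _; apply: mulh_linl. Qed.

Lemma Dmul_linl a (G : Dc H a) : klinear (fun F => Dmul F G).
Proof. by apply: Dext_lin; apply: Dmul_lin2. Qed.

Lemma Dmul_linr a (F : Dc H a) : klinear (Dmul F).
Proof. by apply: klin_Dext => c X; apply: Dmul_lin1. Qed.

Lemma Dmul_sgl a c e (X : 'Hom(H c, H a^-1%g)) (Y : 'Hom(H e, H a^-1%g)) :
  Dmul (sgl X) (sgl Y) = sgl (mulh (c * e)%g X Y).
Proof.
rewrite /Dmul Dext_sgl; last exact: Dmul_lin2.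
rewrite Dext_sgl // => c'; apply: klin_comp (@sgl_lin _ _) _; exact: mulh_linr.
Qed.

Lemma mulf_cst a c e g g' (X : H c -> H a^-1%g) (Y : H e -> H a^-1%g) (x : H g) : g = g' ->
  mulf X Y (cst g' x) = mulf X Y x.
Proof. exact: Ds_cst. Qed.

Lemma DmulA a (F G K : Dc H a) : Dmul F (Dmul G K) = Dmul (Dmul F G) K.
Proof.
have l := @Dmul_linl a; have r := @Dmul_linr a.
apply: (Dc_eq (f := fun F => Dmul F (Dmul G K)) (g := fun F => Dmul (Dmul F G) K)); try lin.
move=> c X; apply: (Dc_eq (f := fun G => Dmul (sgl X) (Dmul G K))
  (g := fun G => Dmul (Dmul (sgl X) G) K)); try lin.
move=> e Y; apply: (Dc_eq (f := fun K => Dmul (sgl X) (Dmul (sgl Y) K))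
  (g := fun K => Dmul (Dmul (sgl X) (sgl Y)) K)); try lin.
move=> f Z; rewrite !Dmul_sgl; apply: sgl_eq => [|x]; first exact: mulgA.
have hX := klin_hom X; have hY := klin_hom Y; have hZ := klin_hom Z.
rewrite !mulhE mulf_cst ?mulgA //.
transitivity (mulf X (mulf Y Z : H (e * f)%g -> _) x).
  by apply: eq_mulf => // y; rewrite mulhE.
rewrite (mulfA hd (ce := (c * e)%g)) //.
by apply: eq_mulf => // y; rewrite mulhE.
Qed.

(** [dot] for a bare function f, so that functionals depending on parameters need not be bundled;
    the results using it ask for linearity where it matters. *)
Definition el a c (h : H a^-1%g) (f : H c -> k^o) : Dc H a := sgl (rk h f).

Lemma eq_rk (U V : vectType k) (h : V) (f f' : U -> k^o) : f =1 f' -> rk h f = rk h f'.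
Proof. by move=> /funext ->. Qed.

Lemma dot_el a c (h : H a^-1%g) (f : dual H c) : dot h f = el h f.
Proof. by []. Qed.

Lemma epsHE (x : H 1) : epsH d x = ep x.
Proof.
rewrite /epsH -/(lf _) lfE; first by rewrite /ep cst_id.
exact: (eps_lin hd).
Qed.

Lemma dot_eps a (h : H a^-1%g) : dot h (epsH d) = el h (ep : H 1 -> k).
Proof. by rewrite dot_el /el (eq_rk h epsHE). Qed.

Lemma el_linl a c (f : H c -> k^o) : klinear f -> klinear (fun h : H a^-1%g => el h f).
Proof. by move=> hf; apply: klin_comp (@sgl_lin _ _) _; apply: klin_rkl. Qed.

Lemma el_linr (W : lmodType k) a c (h : H a^-1%g) (f : W -> H c -> k^o) :
  (forall t, klinear (f t)) -> (forall x, klinear (f ^~ x)) -> klinear (fun t => el h (f t)).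
Proof. by move=> hf hx; apply: klin_comp (@sgl_lin _ _) _; apply: klin_rkr. Qed.

Lemma sgl_el a c (X : 'Hom(H c, H a^-1%g)) : sgl X = \sum_i el (X (bs i)) (cf i).
Proof. by rewrite {1}(hom_basis X) (klin_sum_arg _ _ _ (@sgl_lin _ _)). Qed.

Lemma Dc_eq_el a (W : lmodType k) (f g : Dc H a -> W) F : klinear f -> klinear g ->
  (forall c (h : H a^-1%g) (u : H c -> k^o), klinear u -> f (el h u) = g (el h u)) -> f F = g F.
Proof.
move=> hf hg e; apply: Dc_eq => // c X; rewrite sgl_el !klin_sum_arg //.
by apply: eq_bigr => i _; apply: e; exact: cf_lin.
Qed.

Lemma el_eq a c c' (h : H a^-1%g) (f : H c -> k^o) (f' : H c' -> k^o) : c = c' ->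
  (forall x, f x = f' (cst c' x)) -> el h f = el h f'.
Proof. by move=> e hf; subst c'; congr sgl; apply: eq_rk => x; rewrite hf cst_id. Qed.

Definition conv c e g (f : H c -> k^o) (f' : H e -> k^o) (x : H g) : k^o :=
  Ds (fun x1 x2 => (f x1 : k) *: f' x2) x.

Lemma conv_lin c e g (f : H c -> k^o) (f' : H e -> k^o) : klinear (@conv c e g f f').
Proof. exact: (Ds_lin hd). Qed.

Lemma Dmul_el a c e (h g : H a^-1%g) (f : H c -> k^o) (f' : H e -> k^o) :
  klinear f -> klinear f' ->
  Dmul (el h f) (el g f') = sgl (lf (fun x : H (c * e)%g => Ds (fun x1 x2 => (f x1 : k) *:
    Tw d (fun m u v => (f' (mu (mu u x2) v) : k) *: mu m g) h) x)).
Proof.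
move=> hf hf'; rewrite /el Dmul_sgl; congr sgl; apply/lfunP => x; rewrite mulhE lfE //.
  apply: eq_Ds => x1 x2; rewrite rkE // (klinZ _ _ (Lh_linh hd _ _)) /Lh.
  congr (_ *: _); apply: eq_Tw => m u v; rewrite rkE //.
  by rewrite (klinZ _ _ (klin_mul_r hd m (@klin_id _ _))).
exact: (Ds_lin hd).
Qed.

Lemma Dmul1 a (F : Dc H a) : Dmul (el one (ep : H 1 -> k)) F = F.
Proof.
apply: (Dc_eq (f := Dmul (el one (ep : H 1 -> k))) (g := id)) => //.
  exact: Dmul_linr.
move=> c X; rewrite Dmul_sgl; apply: sgl_eq => [|x]; first exact: mul1g.
rewrite mulhE -(mul1f hd (g := (1 * c)%g)) ?mul1g //; last exact: klin_hom.
by apply: eq_mulf => // y; rewrite rkE //; exact: (ep_lin hd).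
Qed.

Lemma DmulK1 a (F : Dc H a) : Dmul F (el one (ep : H 1 -> k)) = F.
Proof.
apply: (Dc_eq (f := fun F => Dmul F (el one (ep : H 1 -> k))) (g := id)) => //.
  exact: Dmul_linl.
move=> c X; rewrite Dmul_sgl; apply: sgl_eq => [|x]; first exact: mulg1.
rewrite mulhE -(mulf1 hd (g := (c * 1)%g)) ?mulg1 //; last exact: klin_hom.
by apply: eq_mulf => // y; rewrite rkE //; exact: (ep_lin hd).
Qed.

Lemma Dmul_AH a c (h : H a^-1%g) (f : H c -> k^o) : klinear f ->
  Dmul (el one f) (el h (ep : H 1 -> k)) = el h f.
Proof.
move=> hf; have he := @ep_lin _ _ _ _ hd 1%g; rewrite Dmul_el //.
apply: sgl_eq => [|x]; first exact: mulg1.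
rewrite lfE; last exact: (Ds_lin hd).
rewrite rkE // -(Ds_counitr hd (b := 1%g) (G := fun x1 => (f x1 : k) *: h)); try side.
apply: eq_Ds => x1 x2; rewrite (Tw_one hd); try lin.
by rewrite (mu1l hd) (mu1l hd) (mu1r hd) !scalerA mulrC.
Qed.

Lemma Dmul_AA a c e (f : H c -> k^o) (f' : H e -> k^o) : klinear f -> klinear f' ->
  Dmul (el one f) (el one f') = el (one : H a^-1%g) (conv f f' : H (c * e)%g -> k^o).
Proof.
move=> hf hf'; rewrite Dmul_el // /el; congr sgl; apply/lfunP => x.
rewrite lfE; last exact: (Ds_lin hd).
rewrite rkE; last exact: conv_lin.
rewrite /conv -Ds_scalel; apply: eq_Ds => x1 x2.
rewrite (Tw_one hd); try lin.
by rewrite (mu1l hd) (mu1l hd) (mu1r hd) !scalerA.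
Qed.

Lemma Dmul_HH a (h g : H a^-1%g) :
  Dmul (el h (ep : H 1 -> k)) (el g (ep : H 1 -> k)) = el (mu h g) (ep : H 1 -> k).
Proof.
have he := @ep_lin _ _ _ _ hd 1%g; rewrite Dmul_el //.
apply: sgl_eq => [|x]; first exact: mulg1.
rewrite lfE; last exact: (Ds_lin hd).
rewrite rkE // -(Ds_counitr hd (b := 1%g) (G := fun x1 : H 1 => (ep x1 : k) *: mu h g)); try side.
have hm : klinear (fun m : H a^-1%g => mu m g) by lin.
apply: eq_Ds => x1 x2; rewrite -(Tw_ep hd h hm) [RHS]scalerA mulrC -scalerA; congr (_ *: _).
have hs : klinear (fun m : H a^-1%g => ep x2 *: m) by lin.
rewrite [RHS](klin_TwF d _ _ hs); apply: eq_Tw => m u v.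
by rewrite !(ep_mu hd) // !scalerA; congr (_ *: _); rewrite -mulrA mulrCA mulrA.
Qed.

Lemma Dmul_HA a e (h : H a^-1%g) (f : H e -> k^o) : klinear f ->
  Dmul (el h (ep : H 1 -> k)) (el one f) =
  Tw d (fun m u v => el m (fun x => f (mu (mu u x) v))) h.
Proof.
move=> hf; have he := @ep_lin _ _ _ _ hd 1%g; rewrite Dmul_el //.
have hk u v : klinear (fun x : H e => f (mu (mu u x) v)) by lin.
transitivity (sgl (Tw d (fun m u v => rk m (fun x : H e => f (mu (mu u x) v))) h)); last first.
  by rewrite [LHS](klin_TwF d _ _ (@sgl_lin _ _)).
apply: sgl_eq => [|x]; first exact: mul1g.
rewrite lfE; last exact: (Ds_lin hd).
have hx y : klinear (fun X : 'Hom(H e, H a^-1%g) => X y) by lin.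
rewrite [RHS](klin_TwF d _ _ (hx _)).
have hT : klinear (fun y : H e => Tw d (fun m u v => (f (mu (mu u y) v) : k) *: m) h) by lin.
transitivity (Tw d (fun m u v => (f (mu (mu u (cst e x)) v) : k) *: m) h); last first.
  by apply: eq_Tw => m u v; rewrite rkE.
rewrite -(Ds_counitl hd (a := 1%g) x hT) ?mul1g //.
apply: eq_Ds => x1 x2; congr (_ *: _); apply: eq_Tw => m u v.
by rewrite (mu1r hd).
Qed.

End DoubleData.

(** * Comultiplication, counit, conjugation and antipode of D(H) *)

Section DoubleCoproduct.
Variables (k : fieldType) (pi : groupType) (H : pi -> vectType k).
Variable d : chc_data (Hl H).
Hypothesis hd : is_chc d.
Local Notation one := (oneH d).
Local Notation ep := (ep d).
Local Notation Ds := (Ds d).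
Local Notation mulf := (mulf d).
Local Notation DS := (DS d).
Local Notation Dmul := (Dmul d).
Local Notation mu := (mu d).
Local Notation ph := (ph d).

(** The structure asks for an actual list, so Delta(X) is written over pairs of basis vectors of H_c
    and of the two target components, the coordinates of Delta(X(b_j b_i)) being the coefficients.
    Only sums over this list matter later, and [sum_DL] identifies them with [DS]. *)
Definition DL a b c (X : 'Hom(H c, H (a * b)^-1%g)) : seq (Dc H a * Dc H b) :=
  [seq (@cD k pi H d (b^-1 * a^-1 * b)%g b^-1%g _ q.2.1 q.2.2
          (X (mu (bs q.1.2) (bs q.1.1))) *:
          sgl (rk (ph b (bs q.2.1)) (cf q.1.1)),
        sgl (rk (bs q.2.2) (cf q.1.2)))
  | q <- index_enum ('I_(\dim {:H c}) * 'I_(\dim {:H c}) *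
      ('I_(\dim {:H (b^-1 * a^-1 * b)%g}) * 'I_(\dim {:H b^-1%g})))%type].

Definition Ddelta a b (F : Dc H (a * b)%g) : seq (Dc H a * Dc H b) :=
  flatten [seq DL (F c) | c <- supp F].

Section Sums.
Variables (a b : pi) (W : lmodType k) (B : Dc H a -> Dc H b -> W).
Hypothesis hB : forall v, klinear (fun u => B u v).

Lemma sum_DL c (X : 'Hom(H c, H (a * b)^-1%g)) :
  \sum_(p <- DL X) B p.1 p.2 = DS (fun X1 X2 => B (sgl X1) (sgl X2)) X.
Proof.
pose G (i j : 'I_(\dim {:H c})) (s : 'I_(\dim {:H (b^-1 * a^-1 * b)%g}))
    (t : 'I_(\dim {:H b^-1%g})) :=
  B (@cD k pi H d (b^-1 * a^-1 * b)%g b^-1%g _ s t (X (mu (bs j) (bs i))) *: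
          sgl (rk (ph b (bs s)) (cf i))) (sgl (rk (bs t) (cf j))).
rewrite big_map -(pair_bigA _ (fun u v => G u.1 u.2 v.1 v.2)) /=.
rewrite -(pair_bigA _ (fun i j => \sum_v G i j v.1 v.2)) /=.
apply: eq_bigr => i _; apply: eq_bigr => j _.
rewrite -(pair_bigA _ (fun s t => G i j s t)) /=.
by apply: eq_bigr => s _; apply: eq_bigr => t _; rewrite /G (klinZ _ _ (hB _)).
Qed.

Lemma sum_Ddelta (F : Dc H (a * b)%g) : \sum_(p <- Ddelta F) B p.1 p.2 =
  @Dext k pi H (a * b)%g W (fun c X => DS (fun X1 X2 => B (sgl X1) (sgl X2)) X) F.
Proof.
rewrite /Ddelta big_flatten big_map /=.
by apply: eq_bigr => c _; rewrite sum_DL.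
Qed.

(** The lists for F, G and t F + G come from unrelated supports; only sums over them can be
    compared, through the extension [Dext]. *)
Lemma sum_Ddelta_lin : klinear (fun F : Dc H (a * b)%g => \sum_(p <- Ddelta F) B p.1 p.2).
Proof.
move=> t F G; rewrite !sum_Ddelta; apply: Dext_lin => c; exact: (DS_lin hd).
Qed.

Lemma sum_Ddelta_sgl c (X : 'Hom(H c, H (a * b)^-1%g)) :
  \sum_(p <- Ddelta (sgl X)) B p.1 p.2 = DS (fun X1 X2 => B (sgl X1) (sgl X2)) X.
Proof. by rewrite sum_Ddelta Dext_sgl // => c'; exact: (DS_lin hd). Qed.

End Sums.

Lemma hom_decomp (W : lmodType k) (U V : vectType k) (B : 'Hom(U, V) -> W) X : klinear B ->
  B X = \sum_i B (rk (X (bs i)) (cf i)).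
Proof. by move=> hB; rewrite {1}(hom_basis X) klin_sum_arg. Qed.

Lemma klin_fun (U : lmodType k) (f : {scalar U}) : klinear (f : U -> k^o).
Proof. by move=> c x y; rewrite linearP. Qed.

Lemma DS_sum2 (W : lmodType k) a b c I J (r : seq I) (s : seq J)
    (B : I -> J -> 'Hom(H c, H a^-1%g) -> 'Hom(H c, H b^-1%g) -> W) X :
  DS (fun X1 X2 => \sum_(i <- r) \sum_(j <- s) B i j X1 X2) X =
  \sum_(i <- r) \sum_(j <- s) DS (B i j) X.
Proof. by rewrite DS_sum; apply: eq_bigr => i _; rewrite DS_sum. Qed.

Lemma teq2_intro (U W : lmodType k) (s t : seq (U * W)) :
  (forall (f : U -> k^o) (g : W -> k^o), klinear f -> klinear g ->
    \sum_(p <- s) (f p.1 : k) *: g p.2 = \sum_(p <- t) (f p.1 : k) *: g p.2) -> teq2 s t.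
Proof. by move=> h f g; exact: (h _ _ (klin_fun f) (klin_fun g)). Qed.

Lemma teq3_intro (U W X : lmodType k) (s t : seq (U * W * X)) :
  (forall (f : U -> k^o) (g : W -> k^o) (h : X -> k^o), klinear f -> klinear g -> klinear h ->
    \sum_(p <- s) ((f p.1.1 : k) * (g p.1.2 : k)) *: h p.2 =
    \sum_(p <- t) ((f p.1.1 : k) * (g p.1.2 : k)) *: h p.2) -> teq3 s t.
Proof. by move=> e f g h; exact: (e _ _ _ (klin_fun f) (klin_fun g) (klin_fun h)). Qed.

Lemma Ddelta_lin a b (c : k) (F G : Dc H (a * b)%g) :
  teq2 (Ddelta (c *: F + G)) ([seq (c *: p.1, p.2) | p <- Ddelta F] ++ Ddelta G).
Proof.
apply: teq2_intro => f g hf hg.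
have hB : forall v, klinear (fun u => (f u : k) *: g v) by move=> v; lin.
rewrite big_cat big_map /= (sum_Ddelta_lin hB); congr (_ + _).
rewrite scaler_sumr; apply: eq_bigr => p _.
by rewrite (klinZ _ _ hf) scalerA.
Qed.

Lemma Ddelta_mul a b (F G : Dc H (a * b)%g) :
  teq2 (Ddelta (Dmul F G)) [seq (Dmul p.1 q.1, Dmul p.2 q.2) | p <- Ddelta F, q <- Ddelta G].
Proof.
apply: teq2_intro => f g hf hg.
have l a' := @Dmul_linl k pi H d hd a'; have r a' := @Dmul_linr k pi H d hd a'.
rewrite [RHS]big_allpairs_dep /=.
pose B u v : k^o := (f u : k) *: g v.
have hB v : klinear (fun u => B u v) by rewrite /B; lin.
have hC u0 v0 v : klinear (fun u => B (Dmul u0 u) (Dmul v0 v)) by rewrite /B; lin.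
have hC' v (G' : Dc H (a * b)%g) : klinear (fun u => \sum_(q <- Ddelta G') B (Dmul u q.1) (Dmul v q.2)).
  by rewrite /B; lin.
have hD u v : klinear (fun G : Dc H (a * b)%g => \sum_(q <- Ddelta G) B (Dmul u q.1) (Dmul v q.2)).
  exact: (sum_Ddelta_lin (B := fun u' v' => B (Dmul u u') (Dmul v v'))).
have lD := sum_Ddelta_lin hB.
apply: (Dc_eq (W := k^o) (f := fun F => \sum_(p <- Ddelta (Dmul F G)) B p.1 p.2)
  (g := fun F => \sum_(p <- Ddelta F) \sum_(q <- Ddelta G) B (Dmul p.1 q.1) (Dmul p.2 q.2))).
- exact: (klin_comp lD (l _ _)).
- exact: (sum_Ddelta_lin (B := fun u v => \sum_(q <- Ddelta G) B (Dmul u q.1) (Dmul v q.2))).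
move=> c X.
apply: (Dc_eq (W := k^o) (f := fun G => \sum_(p <- Ddelta (Dmul (sgl X) G)) B p.1 p.2)
  (g := fun G => \sum_(p <- Ddelta (sgl X)) \sum_(q <- Ddelta G) B (Dmul p.1 q.1) (Dmul p.2 q.2))).
- exact: (klin_comp lD (r _ _)).
- by apply: klin_sum => p.
move=> e Y; rewrite (Dmul_sgl hd) (sum_Ddelta_sgl hB).
rewrite (sum_Ddelta_sgl (B := fun u v => \sum_(q <- Ddelta (sgl Y)) B (Dmul u q.1) (Dmul v q.2))) //.
(* Bilinear tests are decomposed into values at pairs of basis vectors, where [DS_mulf] applies. *)
pose C (i j : 'I_(\dim {:H (c * e)%g})) (h : H a^-1%g) (l : H b^-1%g) : k^o :=
  B (sgl (rk h (cf i))) (sgl (rk l (cf j))).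
transitivity (DS (fun X1 X2 => DS (fun Y1 Y2 => \sum_i \sum_j
   C i j (mulf X1 Y1 (bs i)) (mulf X2 Y2 (bs j))) Y) X); last first.
  apply: eq_DS => X1 X2.
  rewrite (sum_Ddelta_sgl (B := fun u v => B (Dmul (sgl X1) u) (Dmul (sgl X2) v))) //.
  apply: eq_DS => Y1 Y2; rewrite !(Dmul_sgl hd).
  rewrite (bil_decomp (B := fun X1 X2 => B (sgl X1) (sgl X2))).
    by apply: eq_bigr => i _; apply: eq_bigr => j _; rewrite !(mulhE hd).
  have hs a' c' := @sgl_lin _ _ H a' c'.
  by rewrite /B; split; lin.
transitivity (\sum_i \sum_j DS (fun X1 X2 => DS (fun Y1 Y2 =>
   C i j (mulf X1 Y1 (bs i)) (mulf X2 Y2 (bs j))) Y) X); last first.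
  rewrite -DS_sum2; apply: eq_DS => X1 X2; exact/esym/DS_sum2.
rewrite [LHS]DSE; apply: eq_bigr => i _; apply: eq_bigr => j _.
have hs a' c' := @sgl_lin _ _ H a' c'; have hcf V m := @cf_lin k V m.
rewrite (DS_mulf hd (G := C i j)) //.
  by rewrite (mulhE hd).
by rewrite /C /B; split=> v; [apply: klin_scalel|apply: klin_scale];
  apply: klin_comp => //; apply: (klin_comp (hs _ _)); apply: klin_rkl.
Qed.

(** On the basis pair (i, j) the coefficients are epsilon(b_j b_i) and epsilon(b_i) epsilon(b_j). *)
Lemma Ddelta_one a b :
  teq2 (Ddelta (el one (ep : H 1 -> k) : Dc H (a * b)%g))
    [:: (el one (ep : H 1 -> k), el one (ep : H 1 -> k))].
Proof.
apply: teq2_intro => f g hf hg.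
pose B (u : Dc H a) (v : Dc H b) : k^o := (f u : k) *: g v.
have he := @ep_lin _ _ _ _ hd 1%g.
have hel a' (u : H 1 -> k^o) : klinear u -> klinear (fun t : H a'^-1%g => el t u).
  by apply: el_linl.
rewrite (sum_Ddelta_sgl (B := B)); last by move=> v; rewrite /B; lin.
rewrite big_seq1 /= DSE.
have hs a' c' := @sgl_lin _ _ H a' c'.
have eX a' : el (one : H a'^-1%g) (ep : H 1 -> k) =
    \sum_i ep (bs i : H 1) *: el one (cf i : H 1 -> k^o).
  rewrite /el sgl_el; apply: eq_bigr => i _.
  by rewrite rkE // (klinZ _ _ (el_linl (@cf_lin _ _ i))).
rewrite -/(B _ _) !eX (klin_sum_arg _ _ _ (_ : klinear (fun u => B u _))); last by rewrite /B; lin.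
apply: eq_bigr => i _.
rewrite (klin_sum_arg _ _ _ (_ : klinear (B _))); last by rewrite /B; lin.
apply: eq_bigr => j _.
rewrite rkE // (klinZ _ _ (Ds_lin hd _)) (Ds_one hd); last grp; last first.
  by rewrite /B; split=> v; [apply: klin_scalel|apply: klin_scale];
    apply: klin_comp => //; apply: (klin_comp (hs _ _)); apply: klin_rkl;
    try exact: cf_lin; lin.
rewrite (ph_one hd); last grp.
rewrite /B (klinZ _ _ hf) (klinZ _ _ hg) (ep_mu hd) // !scalerA; congr (_ *: _).
by rewrite -[ep (bs i) *: _]/(_ * _) [RHS]mulrAC; congr (_ * _); exact: mulrC.
Qed.

(** Evaluated at x, y, z both sides are Sweedler sums of X(z y x). They agree by coassociativity in
    H, since phi_c commutes with Delta and phi_b phi_c = phi_(b c). *)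
Lemma Ddelta_coassoc a b c (F : Dc H (a * (b * c))%g) :
  teq3 [seq (p.1, q.1, q.2) | p <- Ddelta F, q <- Ddelta p.2]
       [seq (q.1, q.2, p.2) | p <- @Ddelta (a * b)%g c (trl (Dc H) (mulgA a b c) F),
                              q <- Ddelta p.1].
Proof.
apply: teq3_intro => f g h hf hg hh.
rewrite [LHS]big_allpairs_dep [RHS]big_allpairs_dep /=.
pose T u v w : k^o := ((f u : k) * (g v : k)) *: h w.
have T1 v w : klinear (fun u => T u v w) by rewrite /T; lin.
have T2 u w : klinear (fun v => T u v w) by rewrite /T; lin.
have T3 u v : klinear (fun w => T u v w) by rewrite /T; lin.
have L1 v : klinear (fun u => \sum_(q <- @Ddelta b c v) T u q.1 q.2) by lin.
have L2 w : klinear (fun u : Dc H (a * b)%g => \sum_(q <- Ddelta u) T q.1 q.2 w).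
  by apply: (sum_Ddelta_lin (B := fun u v => T u v w)).
have ht := trl_lin (H := H) (mulgA a b c).
apply: (Dc_eq (W := k^o) (f := fun F => \sum_(p <- Ddelta F) \sum_(q <- Ddelta p.2) T p.1 q.1 q.2)
  (g := fun F => \sum_(p <- @Ddelta (a * b)%g c (trl (Dc H) (mulgA a b c) F))
     \sum_(q <- Ddelta p.1) T q.1 q.2 p.2)).
- exact: (sum_Ddelta_lin (B := fun u v => \sum_(q <- Ddelta v) T u q.1 q.2)).
- apply: (klin_comp (g := fun F => \sum_(p <- @Ddelta (a * b)%g c F)
     \sum_(q <- Ddelta p.1) T q.1 q.2 p.2)) => //.
  exact: (sum_Ddelta_lin (B := fun u v => \sum_(q <- Ddelta u) T q.1 q.2 v)).
move=> e X; rewrite trl_sgl.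
rewrite (sum_Ddelta_sgl (B := fun u v => \sum_(q <- Ddelta v) T u q.1 q.2)) //.
rewrite (sum_Ddelta_sgl (B := fun u v => \sum_(q <- Ddelta u) T q.1 q.2 v)) //.
pose t (i j l : 'I_(\dim {:H e})) (x : H a^-1%g) (y : H b^-1%g) (z : H c^-1%g) : k^o :=
  T (sgl (rk x (cf i))) (sgl (rk y (cf j))) (sgl (rk z (cf l))).
have hs a' c' := @sgl_lin _ _ H a' c'.
have ED (X1 : 'Hom(H e, H a^-1%g)) (X2 : 'Hom(H e, H b^-1%g)) (X3 : 'Hom(H e, H c^-1%g)) :
    T (sgl X1) (sgl X2) (sgl X3) =
    \sum_i \sum_j \sum_l t i j l (X1 (bs i)) (X2 (bs j)) (X3 (bs l)).
  rewrite (hom_decomp (B := fun X => T (sgl X) (sgl X2) (sgl X3))); last lin.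
  apply: eq_bigr => i _.
  rewrite (hom_decomp (B := fun X => T (sgl (rk (X1 (bs i)) (cf i))) (sgl X) (sgl X3))); last lin.
  apply: eq_bigr => j _.
  by rewrite (hom_decomp (B := fun X => T (sgl (rk (X1 (bs i)) (cf i)))
     (sgl (rk (X2 (bs j)) (cf j))) (sgl X))) //; lin.
have S3 (a' b' c' : pi) (B : 'I_(\dim {:H e}) -> 'I_(\dim {:H e}) -> 'I_(\dim {:H e}) ->
    'Hom(H c', H a'^-1%g) -> 'Hom(H c', H b'^-1%g) -> k^o) Z :
    DS (fun X1 X2 => \sum_i \sum_j \sum_l B i j l X1 X2) Z = \sum_i \sum_j \sum_l DS (B i j l) Z.
  by rewrite DS_sum2; do 2 (apply: eq_bigr => ? _); rewrite DS_sum.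
transitivity (\sum_i \sum_j \sum_l DS (fun X1 X2 => DS (fun Y1 Y2 =>
    t i j l (X1 (bs i)) (Y1 (bs j)) (Y2 (bs l))) X2) X).
  rewrite -S3; apply: eq_DS => X1 X2.
  rewrite (sum_Ddelta_sgl (B := fun u v => T (sgl X1) u v)) // -S3.
  by apply: eq_DS => Y1 Y2; rewrite ED.
transitivity (\sum_i \sum_j \sum_l DS (fun X1 X2 => DS (fun Y1 Y2 =>
    t i j l (Y1 (bs i)) (Y2 (bs j)) (X2 (bs l))) X1) (castH (a * b * c)%g X)); last first.
  rewrite -S3; apply: eq_DS => X1 X2.
  rewrite (sum_Ddelta_sgl (B := fun u v => T u v (sgl X2))) // -S3.
  by apply: eq_DS => Y1 Y2; rewrite ED.
apply: eq_bigr => i _; apply: eq_bigr => j _; apply: eq_bigr => l _.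
have t1 y z : klinear (fun x => t i j l x y z).
  by apply: (klin_comp (T1 _ _)); apply: (klin_comp (hs _ _)); apply: klin_rkl => //; exact: cf_lin.
have t2 x z : klinear (fun y => t i j l x y z).
  by apply: (klin_comp (T2 _ _)); apply: (klin_comp (hs _ _)); apply: klin_rkl => //; exact: cf_lin.
have t3 x y : klinear (fun z => t i j l x y z).
  by apply: (klin_comp (T3 _ _)); apply: (klin_comp (hs _ _)); apply: klin_rkl => //; exact: cf_lin.
move: (t i j l) t1 t2 t3 => {t ED} u t1 t2 t3.
move: (bs i) (bs j) (bs l) => x y z.
transitivity (DS (fun X1 X2 => Ds (fun (p : H (c^-1 * b^-1 * c)%g) q => u (X1 x) (ph c p) q)
   (X2 (mu z y))) X).
  by apply: eq_DS => X1 X2; rewrite (DS_eval hd (G := u (X1 x))) //; split.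
rewrite (DS_eval hd (G := fun h h' => Ds (fun (p : H (c^-1 * b^-1 * c)%g) q => u h (ph c p) q) h'));
  last lin.
transitivity (DS (fun X1 X2 => Ds (fun (p : H (b^-1 * a^-1 * b)%g) q => u (ph b p) q (X2 z))
   (X1 (mu y x))) (castH (a * b * c)%g X)); last first.
  by apply: eq_DS => X1 X2; rewrite (DS_eval hd (G := fun p q => u p q (X2 z))) //; split.
rewrite (DS_eval hd (G := fun h h' => Ds (fun (p : H (b^-1 * a^-1 * b)%g) q => u (ph b p) q h') h));
  last lin.
rewrite castHE Ds_cst; last by rewrite mulgA.
rewrite (muA hd).
transitivity (Ds (fun (p' : H (c^-1 * (a * b)^-1 * c)%g) q' =>
   Ds (fun (p : H ((b * c)^-1 * a^-1 * (b * c))%g) (q : H (c^-1 * b^-1 * c)%g) =>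
     u (ph (b * c)%g p) (ph c q) q') p') (X (mu (mu z y) x))).
  by rewrite (Ds_coassoc hd (w := (c^-1 * (a * b)^-1 * c)%g)) //; grp.
apply: eq_Ds => p' q'.
rewrite (Ds_ph hd (a := ((b * c)^-1 * a^-1 * (b * c))%g) (b := (c^-1 * b^-1 * c)%g));
  [|lin|grp|grp|grp|grp].
by apply: eq_Ds => p q; rewrite (ph_ph hd) //; grp.
Qed.

End DoubleCoproduct.

Section DoubleCounitConj.
Variables (k : fieldType) (pi : groupType) (H : pi -> vectType k).
Variable d : chc_data (Hl H).
Hypothesis hd : is_chc d.
Local Notation mu := (mu d).
Local Notation one := (oneH d).
Local Notation ep := (ep d).
Local Notation ph := (ph d).
Local Notation si := (si d).
Local Notation Ds := (Ds d).
Local Notation mulf := (mulf d).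
Local Notation DS := (DS d).
Local Notation Dmul := (Dmul d).
Local Notation Ddelta a b := (@Ddelta k pi H d a b).

Definition Deps a (F : Dc H a) : k^o := Dext (fun c X => ep (X one) : k^o) F.

Lemma Deps_linT a c : klinear (fun X : 'Hom(H c, H a^-1%g) => ep (X one) : k^o).
Proof. lin. Qed.

Lemma Deps_lin a : klinear (@Deps a).
Proof. by apply: Dext_lin => c; apply: Deps_linT. Qed.

Lemma Deps_sgl a c (X : 'Hom(H c, H a^-1%g)) : Deps (sgl X) = ep (X one).
Proof. by rewrite /Deps Dext_sgl // => e; apply: Deps_linT. Qed.

Lemma Deps_el a c (h : H a^-1%g) (f : H c -> k^o) : klinear f ->
  Deps (el h f) = (ep h : k) *: f one.
Proof.
by move=> hf; rewrite Deps_sgl rkE // (klinZ _ _ (@ep_lin _ _ _ _ hd _)) -![_ *: _]/(_ * _) mulrC.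
Qed.

(** At the unit, Y is evaluated at S^-1(h''') phi_1(h') while epsilon absorbs h''; what remains is
    S^-1(h'') h', which contracts to epsilon(h). *)
Lemma Deps_mul (F G : Dc H 1) : Deps (Dmul F G) = (Deps F : k) *: Deps G.
Proof.
have l := @Dmul_linl k pi H d hd 1%g; have r := @Dmul_linr k pi H d hd 1%g.
have he := @Deps_lin 1%g.
apply: (Dc_eq (W := k^o) (f := fun F => Deps (Dmul F G)) (g := fun F => (Deps F : k) *: Deps G));
  try lin.
move=> c X.
apply: (Dc_eq (W := k^o) (f := fun G => Deps (Dmul (sgl X) G))
  (g := fun G => (Deps (sgl X) : k) *: Deps G)); try lin.
move=> e Y; rewrite (Dmul_sgl hd) !Deps_sgl (mulhE hd) /mulf (Ds_one hd) //; last first.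
  by have := Lh_linh hd Y; have := Lh_linx hd _ (klin_hom Y) => h1 h2; split; lin.
have hep := @ep_lin _ _ _ _ hd 1^-1%g.
rewrite /Lh (klin_TwF d _ _ hep) /Tw.
move: (X one) => h.
pose Z v : k^o := ep (Y v).
have hZ : klinear Z by rewrite /Z; lin.
(* [ph 1] is inserted on the second leg too, so that it can be pulled out of the coproduct; it also
   serves as the cast from the index 1^-1 e 1 to e. *)
transitivity (Ds (fun (h1 : H (1^-1 * e * 1)%g) (r : H (1^-1 * e^-1)%g) =>
   Z (mu (si (ph 1 r : H e^-1%g)) (ph 1 h1))) h).
  apply: eq_Ds => h1 r'; 
  have -> : si (ph 1 r' : H e^-1%g) = si r' :> H e.
    by rewrite (ph1 hd) ?(si_cst d) //; grp.
  have hG : klinear (fun r : H e^-1%g => Z (mu (si r) (ph 1 h1))) by lin.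
  rewrite -[RHS]/(Z (mu (si r') (ph 1 h1))) -(si_cst d (a' := e^-1%g)); last grp.
  rewrite -(Ds_counitl hd (a := 1^-1%g) r' hG); try grp.
  apply: eq_Ds => m v; rewrite (ep_mu hd) ?invg1 // (mu1r hd).
  by [].
rewrite -(Ds_ph hd (g := 1%g) (c' := 1%g) (F := fun (u : H e) (v : H e^-1%g) => Z (mu (si v) u)));
  [|lin|grp|grp|grp|grp].
rewrite (Ds_sil hd) //; last grp.
by rewrite (ep_ph hd) //; grp.
Qed.

Lemma Deps_one : Deps (el one (ep : H 1 -> k) : Dc H 1) = 1.
Proof.
rewrite Deps_el; last exact: (@ep_lin _ _ _ _ hd).
by rewrite !(ep_one hd) ?invg1 // scale1r.
Qed.

Lemma klin_DSF (W W' : lmodType k) (g : W -> W') a b c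
    (B : 'Hom(H c, H a^-1%g) -> 'Hom(H c, H b^-1%g) -> W) X : klinear g ->
  g (DS B X) = DS (fun X1 X2 => g (B X1 X2)) X.
Proof.
move=> hg; rewrite !DSE klin_sum_arg //; apply: eq_bigr => i _.
by rewrite klin_sum_arg //; apply: eq_bigr => j _; rewrite (klin_DsF d _ _ hg).
Qed.

Lemma Dcounit_l a (F : Dc H a) :
  \sum_(p <- Ddelta 1%g a (trl (Dc H) (esym (mul1g a)) F)) (Deps p.1 : k) *: p.2 = F.
Proof.
have he := @Deps_lin; have hs := @sgl_lin _ _ H.
have ht := trl_lin (H := H) (esym (mul1g a)).
have hB v : klinear (fun u : Dc H 1 => (Deps u : k) *: (v : Dc H a)) by lin.
apply: (Dc_eq (f := fun F => \sum_(p <- Ddelta 1%g a (trl (Dc H) (esym (mul1g a)) F))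
  (Deps p.1 : k) *: p.2) (g := id)) => //.
  exact: (klin_comp (sum_Ddelta_lin hd hB) ht).
move=> c X; rewrite trl_sgl (sum_Ddelta_sgl hd hB).
under eq_DS => X1 X2 do rewrite Deps_sgl -(klinZ _ _ (hs _ _)).
rewrite -(klin_DSF _ _ (hs _ _)); congr sgl; apply/lfunP => y.
have hy : klinear (fun X : 'Hom(H c, H a^-1%g) => X y) by lin.
rewrite (klin_DSF _ _ hy).
transitivity (DS (fun X1 X2 => (ep (X1 one) : k) *: X2 y) (castH (1 * a)%g X)).
  by apply: eq_DS => X1 X2; rewrite (klinZ _ _ hy).
rewrite (DS_eval hd (G := fun h l => (ep h : k) *: l)); last lin.
rewrite (mu1r hd) castHE.
transitivity (Ds (fun (p : H (a^-1 * 1^-1 * a)%g) (l : H a^-1%g) => ep p *: l) (X y)).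
  rewrite Ds_cst ?mul1g //; apply: eq_Ds => p l.
  by rewrite (ep_ph hd) //; grp.
by rewrite (Ds_counitl hd (G := id)) ?cst_id //; grp.
Qed.

Lemma Dcounit_r a (F : Dc H a) :
  \sum_(p <- Ddelta a 1%g (trl (Dc H) (esym (mulg1 a)) F)) (Deps p.2 : k) *: p.1 = F.
Proof.
have he := @Deps_lin; have hs := @sgl_lin _ _ H.
have ht := trl_lin (H := H) (esym (mulg1 a)).
have hB v : klinear (fun u : Dc H a => (Deps (v : Dc H 1) : k) *: u) by lin.
apply: (Dc_eq (f := fun F => \sum_(p <- Ddelta a 1%g (trl (Dc H) (esym (mulg1 a)) F))
  (Deps p.2 : k) *: p.1) (g := id)) => //.
  exact: (klin_comp (sum_Ddelta_lin hd hB) ht).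
move=> c X; rewrite trl_sgl (sum_Ddelta_sgl hd hB).
under eq_DS => X1 X2 do rewrite Deps_sgl -(klinZ _ _ (hs _ _)).
rewrite -(klin_DSF _ _ (hs _ _)); congr sgl; apply/lfunP => y.
have hy : klinear (fun X : 'Hom(H c, H a^-1%g) => X y) by lin.
rewrite (klin_DSF _ _ hy).
transitivity (DS (fun X1 X2 => (ep (X2 one) : k) *: X1 y) (castH (a * 1)%g X)).
  by apply: eq_DS => X1 X2; rewrite (klinZ _ _ hy).
rewrite (DS_eval hd (G := fun h l => (ep l : k) *: h)); last lin.
rewrite (mu1l hd) castHE.
transitivity (Ds (fun (p : H (1^-1 * a^-1 * 1)%g) (l : H 1^-1%g) =>
    ep l *: (ph 1 p : H a^-1%g)) (X y)).
  by rewrite Ds_cst ?mulg1.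
rewrite (Ds_counitr hd); [|lin|grp|grp].
by rewrite (ph1 hd) ?cst_cst ?cst_id //; grp.
Qed.

Definition phiH b a c (X : 'Hom(H c, H a^-1%g)) :
    'Hom(H (b * c * b^-1)%g, H (b * a * b^-1)^-1%g) :=
  lf (fun y => ph b (X (ph b^-1 y))).

Lemma phiHE b a c (X : 'Hom(H c, H a^-1%g)) y : phiH b X y = ph b (X (ph b^-1 y)).
Proof. by rewrite lfE //; lin. Qed.

Lemma phiH_lin b a c : klinear (@phiH b a c).
Proof.
move=> t X Y; apply/lfunP => y.
rewrite add_lfunE scale_lfunE !phiHE add_lfunE scale_lfunE.
exact: ph_lin.
Qed.

Definition Dphi b a (F : Dc H a) : Dc H (b * a * b^-1)%g :=
  @Dext k pi H a _ (fun c X => sgl (phiH b X)) F.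

Lemma Dphi_linT b a c : klinear (fun X : 'Hom(H c, H a^-1%g) => sgl (phiH b X)).
Proof. exact: (klin_comp (@sgl_lin _ _ _ _ _) (@phiH_lin _ _ _)). Qed.

Lemma Dphi_lin b a : klinear (@Dphi b a).
Proof. by apply: Dext_lin => c; apply: Dphi_linT. Qed.

Lemma Dphi_sgl b a c (X : 'Hom(H c, H a^-1%g)) : Dphi b (sgl X) = sgl (phiH b X).
Proof. by rewrite /Dphi Dext_sgl // => e; apply: Dphi_linT. Qed.

Lemma Dphi_mul b a (F G : Dc H a) : Dphi b (Dmul F G) = Dmul (Dphi b F) (Dphi b G).
Proof.
have l a' := @Dmul_linl k pi H d hd a'; have r a' := @Dmul_linr k pi H d hd a'.
have hp := @Dphi_lin b a.
apply: (Dc_eq (f := fun F => Dphi b (Dmul F G)) (g := fun F => Dmul (Dphi b F) (Dphi b G)));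
  try lin.
move=> c X.
apply: (Dc_eq (f := fun G => Dphi b (Dmul (sgl X) G))
  (g := fun G => Dmul (Dphi b (sgl X)) (Dphi b G))); try lin.
move=> e Y; rewrite (Dmul_sgl hd) !Dphi_sgl (Dmul_sgl hd).
apply: sgl_eq => [|y]; first exact: gconj_mul.
rewrite phiHE !(mulhE hd) mulf_cst; last exact: gconj_mul.
have ey : y = ph b (ph b^-1 y : H (c * e)%g).
  by rewrite (phVK hd) //; grp.
rewrite {2}ey (ph_mulf hd (X := X) (Y := Y)) //; try exact: klin_hom.
all: by move=> x; rewrite phiHE (phK hd).
Qed.

Lemma Dphi_comp b g a (F : Dc H a) :
  Dphi b (Dphi g F) = trl (Dc H) (gconj_comp b g a) (Dphi (b * g)%g F).
Proof.
have hp b' a' := @Dphi_lin b' a'; have ht := trl_lin (H := H) (gconj_comp b g a).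
apply: (Dc_eq (f := fun F => Dphi b (Dphi g F))
  (g := fun F => trl (Dc H) (gconj_comp b g a) (Dphi (b * g)%g F))); try lin.
move=> c X; rewrite !Dphi_sgl trl_sgl.
apply: sgl_eq => [|y]; first by rewrite gconj_comp.
rewrite castHE !phiHE (cst_ph d); last by grp.
rewrite (ph_cst d); last by grp.
by rewrite !(ph_ph hd) ?invgM //; grp.
Qed.

Lemma Dphi_one b a : Dphi b (el one (ep : H 1 -> k) : Dc H a) = el one (ep : H 1 -> k).
Proof.
have he := @ep_lin _ _ _ _ hd 1%g.
rewrite Dphi_sgl; apply: sgl_eq => [|y]; first by grp.
rewrite phiHE !rkE // (klinZ _ _ (@ph_lin _ _ _ _ hd _ _ _)) (ph_one hd); last by grp.
by rewrite (ep_ph hd) ?(ep_cst d) //; grp.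
Qed.

Lemma Dphi_bij b a : bijective (@Dphi b a).
Proof.
have hp b' a' := @Dphi_lin b' a'.
have ht a' b' (e : a' = b') := trl_lin (H := H) e.
exists (fun G => trl (Dc H) (gH b a) (Dphi b^-1 G)) => F.
  apply: (Dc_eq (f := fun F => trl (Dc H) (gH b a) (Dphi b^-1 (Dphi b F))) (g := id)) => //.
    by apply: klin_comp => //; lin.
  move=> c X; rewrite !Dphi_sgl trl_sgl.
  apply: sgl_eq => [|y]; first by grp.
  rewrite castHE !phiHE (cst_ph d); last by grp.
  rewrite !(ph_ph hd) ?mulgV ?mulVg; try grp.
  rewrite (ph1 hd); last by grp.
  by rewrite (ph1 hd) ?cst_id //; grp.
apply: (Dc_eq (f := fun F => Dphi b (trl (Dc H) (gH b a) (Dphi b^-1 F))) (g := id)) => //.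
  by apply: klin_comp => //; apply: klin_comp.
move=> c X; rewrite !Dphi_sgl trl_sgl Dphi_sgl.
apply: sgl_eq => [|y]; first by grp.
rewrite phiHE castHE phiHE (cst_ph d); last by grp.
rewrite !(ph_ph hd) ?mulgV ?mulVg; try grp.
rewrite (ph1 hd); last by grp.
by rewrite cst_id !(ph1 hd) ?cst_id //; grp.
Qed.

Lemma Deps_phi g (F : Dc H 1) : Deps (trl (Dc H) (gconj1 g) (Dphi g F)) = Deps F.
Proof.
have hp := @Dphi_lin g 1%g; have ht := trl_lin (H := H) (gconj1 g); have he := @Deps_lin 1%g.
apply: (Dc_eq (W := k^o) (f := fun F => Deps (trl (Dc H) (gconj1 g) (Dphi g F))) (g := @Deps 1%g));
  try lin.
move=> c X; rewrite Dphi_sgl trl_sgl !Deps_sgl castHE phiHE.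
rewrite (ph_one hd); last by grp.
rewrite (ep_cst d); last by grp.
by rewrite (ep_ph hd) //; grp.
Qed.

(** After evaluation this is phi_(g b g^-1) phi_g = phi_g phi_b, together with the compatibility of
    phi_g with the product and coproduct of H. *)
Lemma Dphi_Delta g a b (F : Dc H (a * b)%g) :
  teq2 (Ddelta _ _ (trl (Dc H) (gconj_mul g a b) (Dphi g F)))
       [seq (Dphi g p.1, Dphi g p.2) | p <- Ddelta a b F].
Proof.
apply: teq2_intro => f f' hf hf'.
have hp b' a' := @Dphi_lin b' a'; have hs a' c' := @sgl_lin _ _ H a' c'.
have ht := trl_lin (H := H) (gconj_mul g a b).
rewrite [RHS]big_map /=.
pose B u v : k^o := (f u : k) *: f' v.
have hB v : klinear (fun u => B u v) by rewrite /B; lin.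
have hB2 u : klinear (fun v => B u v) by rewrite /B; lin.
have hC v : klinear (fun u : Dc H a => B (Dphi g u) (Dphi g (v : Dc H b))) by lin.
apply: (Dc_eq (W := k^o) (f := fun F =>
    \sum_(p <- Ddelta _ _ (trl (Dc H) (gconj_mul g a b) (Dphi g F))) B p.1 p.2)
  (g := fun F => \sum_(p <- Ddelta a b F) B (Dphi g p.1) (Dphi g p.2))).
- by apply: (klin_comp (sum_Ddelta_lin hd hB)); lin.
- exact: (sum_Ddelta_lin hd hC).
move=> c X; rewrite Dphi_sgl trl_sgl (sum_Ddelta_sgl hd hB) (sum_Ddelta_sgl hd hC).
pose C (i j : 'I_(\dim {:H (g * c * g^-1)%g})) (h : H (g * a * g^-1)^-1%g)
  (l : H (g * b * g^-1)^-1%g) : k^o := B (sgl (rk h (cf i))) (sgl (rk l (cf j))).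
have hCb i j : bilin (C i j).
  split=> v; [apply: (klin_comp (hB _))|apply: (klin_comp (hB2 _))];
    by apply: (klin_comp (hs _ _)); apply: klin_rkl => //; exact: cf_lin.
transitivity (DS (fun X1 X2 => \sum_i \sum_j
   C i j (ph g (X1 (ph g^-1 (bs i)))) (ph g (X2 (ph g^-1 (bs j))))) X); last first.
  apply: eq_DS => X1 X2; rewrite !Dphi_sgl.
  rewrite (bil_decomp (B := fun X1 X2 => B (sgl X1) (sgl X2))); last lin.
  by apply: eq_bigr => i _; apply: eq_bigr => j _; rewrite !phiHE.
rewrite [RHS]DS_sum2 [LHS]DSE; apply: eq_bigr => i _; apply: eq_bigr => j _.
rewrite -[LHS]/(Ds (fun (p : H ((g * b * g^-1)^-1 * (g * a * g^-1)^-1 * (g * b * g^-1))%g) l =>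
  C i j (ph (g * b * g^-1) p) l) _).
move: (C i j) (hCb i j) => {C hCb} C hCb.
rewrite (DS_eval hd (G := fun h l => C (ph g h) (ph g l))); last lin.
rewrite castHE phiHE Ds_cst; last by rewrite gconj_mul.
rewrite (ph_mu hd); last by grp.
rewrite (Ds_ph hd (a := (b^-1 * a^-1 * b)%g) (b := b^-1%g)); [|split; lin|grp|grp|grp|grp].
by apply: eq_Ds => p l; rewrite !(ph_ph hd) ?mulgVK //; grp.
Qed.

End DoubleCounitConj.

Section DoubleAntipode.
Variables (k : fieldType) (pi : groupType) (H : pi -> vectType k).
Variable d : chc_data (Hl H).
Hypothesis hd : is_chc d.
Local Notation mu := (mu d).
Local Notation one := (oneH d).
Local Notation ep := (ep d).
Local Notation ph := (ph d).
Local Notation sa := (sa d).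
Local Notation si := (si d).
Local Notation Ds := (Ds d).
Local Notation Dmul := (Dmul d).
Local Notation Ddelta a b := (@Ddelta k pi H d a b).

Lemma sum_el a c (h : H a^-1%g) (f : H c -> k^o) : klinear f ->
  el h f = \sum_i (f (bs i) : k) *: el h (cf i : H c -> k^o).
Proof.
move=> hf; rewrite /el sgl_el; apply: eq_bigr => i _.
by rewrite rkE // (klinZ _ _ (el_linl (@cf_lin _ _ i))).
Qed.

(** The antipode is prescribed on h # f only, so it is applied to X = sum_i X(b_i) # cf_i; [Dant_el]
    recovers the prescribed formula for every linear f. *)
Definition Dant a (F : Dc H a) : Dc H a^-1%g :=
  @Dext k pi H a _ (fun c X => \sum_i
    Dmul (el (ph a (sa (X (bs i)) : H a)) (ep : H 1 -> k))
         (el one (fun y : H c^-1%g => cf i (si y)))) F.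

Lemma Dant_linT a c : klinear (fun X : 'Hom(H c, H a^-1%g) => \sum_i
    Dmul (el (ph a (sa (X (bs i)) : H a) : H a^-1^-1%g) (ep : H 1 -> k))
         (el one (fun y : H c^-1%g => cf i (si y)))).
Proof.
have l a' := @Dmul_linl k pi H d hd a'; have he := @ep_lin _ _ _ _ hd 1%g.
have hel a' : klinear (fun h : H a'^-1%g => el h (ep : H 1 -> k)) by exact: el_linl.
lin.
Qed.

Lemma Dant_lin a : klinear (@Dant a).
Proof. by apply: Dext_lin => c; apply: Dant_linT. Qed.

Lemma Dant_el a c (h : H a^-1%g) (f : H c -> k^o) : klinear f ->
  Dant (el h f) = Dmul (el (ph a (sa h : H a)) (ep : H 1 -> k))
    (el one (fun y : H c^-1%g => f (si y))).
Proof.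
move=> hf; rewrite /Dant Dext_sgl; last by move=> e; apply: Dant_linT.
have r a' := @Dmul_linr k pi H d hd a'; have l a' := @Dmul_linl k pi H d hd a'.
have he := @ep_lin _ _ _ _ hd 1%g.
have hT : klinear (fun h : H a^-1%g => el (ph a (sa h : H a) : H a^-1^-1%g) (ep : H 1 -> k)).
  by apply: (klin_comp (el_linl he)); lin.
have -> : el (one : H a^-1^-1%g) (fun y : H c^-1%g => f (si y)) =
    \sum_i (f (bs i) : k) *: el one (fun y : H c^-1%g => cf i (si y)).
  rewrite /el -[RHS]/(\sum_i (f (bs i) : k) *: sgl (rk one (fun y => cf i (si y)))).
  under [RHS]eq_bigr => i _ do rewrite -(klinZ _ _ (@sgl_lin _ _ _ _ _)).
  rewrite -(klin_sum_arg _ _ _ (@sgl_lin _ _ _ _ _)); congr sgl; apply/lfunP => y.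
  rewrite sum_lfunE rkE; last lin.
  rewrite {1}(klin_basis (si y) hf) scaler_suml; apply: eq_bigr => i _.
  by rewrite scale_lfunE rkE ?scalerA 1?mulrC //; lin.
rewrite (klin_sum_arg _ _ _ (r _ _)); apply: eq_bigr => i _.
by rewrite (klinZ _ _ (r _ _)) rkE // (klinZ _ _ hT) (klinZ _ _ (l _ _)).
Qed.

Lemma trl_mul a b (e : a = b) (F G : Dc H a) :
  trl (Dc H) e (Dmul F G) = Dmul (trl (Dc H) e F) (trl (Dc H) e G).
Proof. by subst b. Qed.

Lemma trl_el a b (e : a = b) c (h : H a^-1%g) (f : H c -> k^o) :
  trl (Dc H) e (el h f) = el (cst b^-1%g h) f.
Proof. by subst b; rewrite cst_id. Qed.

Lemma sum_el_fun a c (h : H a^-1%g) I J (r : seq I) (s : seq J) (t : I -> J -> k)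
    (f : I -> J -> H c -> k^o) : (forall i j, klinear (f i j)) ->
  \sum_(i <- r) \sum_(j <- s) t i j *: el h (f i j) =
  el h (fun x => \sum_(i <- r) \sum_(j <- s) t i j *: f i j x).
Proof.
move=> hf; have hs := @sgl_lin _ _ H a c.
transitivity (sgl (\sum_(i <- r) \sum_(j <- s) t i j *: rk h (f i j))).
  rewrite (klin_sum_arg _ _ _ hs); apply: eq_bigr => i _.
  by rewrite (klin_sum_arg _ _ _ hs); apply: eq_bigr => j _; rewrite (klinZ _ _ hs).
congr sgl; apply/lfunP => x; rewrite sum_lfunE rkE; last lin.
rewrite scaler_suml; apply: eq_bigr => i _; rewrite sum_lfunE scaler_suml.
by apply: eq_bigr => j _; rewrite scale_lfunE rkE ?scalerA.
Qed.

Lemma el_scale a c (h : H a^-1%g) t (f : H c -> k^o) : klinear f ->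
  t *: el h f = el h (fun x => t *: f x).
Proof.
move=> hf; rewrite -(klinZ _ _ (@sgl_lin _ _ H a c)); congr sgl; apply/lfunP => x.
by rewrite scale_lfunE !rkE ?scalerA //; lin.
Qed.

(** The antipode axiom s_*(f') f'' = f(1) epsilon of A, with Delta_*(f) in coordinates: at x the
    left side is f(x'' S^-1(x')). In [sum_conv_is] the product f' s_*(f'') leads to f(S^-1(x'')
    x'). *)
Lemma sum_conv_si c a (f : H c -> k^o) : klinear f ->
  \sum_i \sum_j (f (mu (bs j) (bs i)) : k) *:
    el (one : H a^-1%g) (conv d (fun y : H c^-1%g => cf i (si y)) (cf j) : H (c^-1 * c)%g -> k^o)
  = (f one : k) *: el one (ep : H 1 -> k).
Proof.
move=> hf; have he := @ep_lin _ _ _ _ hd 1%g.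
rewrite sum_el_fun; last by move=> i j; exact: (conv_lin hd).
rewrite el_scale //; apply: el_eq => [|x]; first by grp.
transitivity (Ds (fun (y1 : H c^-1%g) (y2 : H c) => f (mu y2 (si y1))) x).
  rewrite /conv; under eq_bigr => i _ do under eq_bigr => j _ do rewrite -Ds_scale.
  under eq_bigr => i _ do rewrite -Ds_sum.
  rewrite -Ds_sum; apply: eq_Ds => y1 y2.
  have hb : bilin (fun u v : H c => f (mu v u)) by lin.
  rewrite (bilin_basis (si y1) y2 hb); apply: eq_bigr => i _; apply: eq_bigr => j _.
  by rewrite -![_ *: _]/(_ * _) mulrC.
rewrite (Ds_sir hd) //; try grp.
by rewrite (ep_cst d); [exact: mulrC | grp].
Qed.

Lemma sum_conv_is c a (f : H c -> k^o) : klinear f ->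
  \sum_i \sum_j (f (mu (bs j) (bs i)) : k) *:
    el (one : H a^-1%g) (conv d (cf i) (fun y : H c^-1%g => cf j (si y)) : H (c * c^-1)%g -> k^o)
  = (f one : k) *: el one (ep : H 1 -> k).
Proof.
move=> hf; have he := @ep_lin _ _ _ _ hd 1%g.
rewrite sum_el_fun; last by move=> i j; exact: (conv_lin hd).
rewrite el_scale //; apply: el_eq => [|x]; first by grp.
transitivity (Ds (fun (y1 : H c) (y2 : H c^-1%g) => f (mu (si y2) y1)) x).
  rewrite /conv; under eq_bigr => i _ do under eq_bigr => j _ do rewrite -Ds_scale.
  under eq_bigr => i _ do rewrite -Ds_sum.
  rewrite -Ds_sum; apply: eq_Ds => y1 y2.
  have hb : bilin (fun u v : H c => f (mu v u)) by lin.
  rewrite (bilin_basis y1 (si y2) hb); apply: eq_bigr => i _; apply: eq_bigr => j _.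
  by rewrite -![_ *: _]/(_ * _) mulrC.
rewrite (Ds_sil hd) //; try grp.
by rewrite (ep_cst d); [exact: mulrC | grp].
Qed.

Lemma Dantipode_l a (F : Dc H 1) :
  \sum_(p <- Ddelta a^-1%g a (trl (Dc H) (esym (mulVg a)) F))
     Dmul (trl (Dc H) (invgK a) (Dant p.1)) p.2 = (Deps d F : k) *: el one (ep : H 1 -> k).
Proof.
have r a' := @Dmul_linr k pi H d hd a'; have l a' := @Dmul_linl k pi H d hd a'.
have ht a' b' (e : a' = b') := trl_lin (H := H) e.
have hS a' := @Dant_lin a'; have he := @ep_lin _ _ _ _ hd 1%g.
have hE := Deps_lin hd (a := 1%g).
have hel a' : klinear (fun h : H a'^-1%g => el h (ep : H 1 -> k)) by exact: el_linl.
have hB v : klinear (fun u : Dc H a^-1%g => Dmul (trl (Dc H) (invgK a) (Dant u)) (v : Dc H a)).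
  exact: (klin_comp (l _ _) (klin_comp (ht _ _ _) (hS _))).
apply: (Dc_eq_el (f := fun F => \sum_(p <- Ddelta a^-1%g a (trl (Dc H) (esym (mulVg a)) F))
     Dmul (trl (Dc H) (invgK a) (Dant p.1)) p.2)
  (g := fun F => (Deps d F : k) *: el one (ep : H 1 -> k))).
- exact: (klin_comp (sum_Ddelta_lin hd hB) (ht _ _ _)).
- lin.
move=> c h f hf; rewrite Deps_el // trl_el (sum_Ddelta_sgl hd hB) DSE.
set h' := cst _ h.
(* S(h' # f') (h'' # f'') is S(h') [s_*(f') f''] h''. The linear map Q keeps the outer factors, so
   that the bracket, entirely in A, can be summed first. *)
pose Q (Z : Dc H a) := Ds (fun (p : H (a^-1 * a^-1^-1 * a)%g) (q : H a^-1%g) =>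
  Dmul (el (sa p) (ep : H 1 -> k)) (Dmul Z (el q (ep : H 1 -> k)))) h'.
have hQ : klinear Q.
  by apply: klin_Ds => p q; apply: klin_comp (r _ _) (l _ _).
transitivity (\sum_i \sum_j Q ((f (mu (bs j) (bs i)) : k) *:
   el one (conv d (fun y : H c^-1%g => cf i (si y)) (cf j) : H (c^-1 * c)%g -> k^o))).
  apply: eq_bigr => i _; apply: eq_bigr => j _.
  rewrite rkE // (klinZ _ _ (Ds_lin hd _)) (klinZ _ _ hQ); congr (_ *: _).
  apply: eq_Ds => p q.
  transitivity (Dmul (trl (Dc H) (invgK a) (Dant (el (ph a p : H a^-1^-1%g) (cf i : H c -> k^o))))
    (el q (cf j : H c -> k^o))); first by [].
  rewrite (Dant_el _ (@cf_lin _ _ i)) trl_mul !trl_el (one_cst d) ?invgK //.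
  rewrite -(Dmul_AH hd q (@cf_lin _ _ j)).
  rewrite -(Dmul_AA hd); [|by lin|exact: cf_lin].
  rewrite -!(DmulA hd); congr (Dmul (el _ _) _).
  rewrite (cst_ph d); last by grp.
  rewrite (sa_ph hd (c := a^-1%g)); try grp.
  by rewrite (ph_ph hd) ?mulVg ?(ph1 hd) ?(cst_sa d) //; grp.
under eq_bigr => i _ do rewrite -(klin_sum_arg _ _ _ hQ).
rewrite -(klin_sum_arg _ _ _ hQ) sum_conv_si // (klinZ _ _ hQ) /Q.
transitivity ((f one : k) *: Ds (fun (p : H (a^-1 * a^-1^-1 * a)%g) (q : H a^-1%g) =>
   el (mu (sa p) q) (ep : H 1 -> k)) h').
  by congr (_ *: _); apply: eq_Ds => p q; rewrite (Dmul1 hd) (Dmul_HH hd).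
rewrite (Ds_antil hd (G := fun z => el z (ep : H 1 -> k))) //; try grp.
by rewrite /h' (ep_cst d) ?scalerA 1?mulrC //; grp.
Qed.

Lemma Dantipode_r a (F : Dc H 1) :
  \sum_(p <- Ddelta a a^-1%g (trl (Dc H) (esym (mulgV a)) F))
     Dmul p.1 (trl (Dc H) (invgK a) (Dant p.2)) = (Deps d F : k) *: el one (ep : H 1 -> k).
Proof.
have r a' := @Dmul_linr k pi H d hd a'; have l a' := @Dmul_linl k pi H d hd a'.
have ht a' b' (e : a' = b') := trl_lin (H := H) e.
have hS a' := @Dant_lin a'; have he := @ep_lin _ _ _ _ hd 1%g.
have hE := Deps_lin hd (a := 1%g).
have hel a' : klinear (fun h : H a'^-1%g => el h (ep : H 1 -> k)) by exact: el_linl.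
have hB v : klinear (fun u : Dc H a => Dmul u (trl (Dc H) (invgK a) (Dant v))) by exact: l.
apply: (Dc_eq_el (f := fun F => \sum_(p <- Ddelta a a^-1%g (trl (Dc H) (esym (mulgV a)) F))
     Dmul p.1 (trl (Dc H) (invgK a) (Dant p.2)))
  (g := fun F => (Deps d F : k) *: el one (ep : H 1 -> k))).
- exact: (klin_comp (sum_Ddelta_lin hd hB) (ht _ _ _)).
- lin.
move=> c h f hf; rewrite Deps_el // trl_el (sum_Ddelta_sgl hd hB) DSE.
set h' := cst _ h.
transitivity ((ep h : k) *: \sum_i \sum_j (f (mu (bs j) (bs i)) : k) *:
   el (one : H a^-1%g) (conv d (cf i) (fun y : H c^-1%g => cf j (si y)) : H (c * c^-1)%g -> k^o));
  last by rewrite sum_conv_is // scalerA.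
rewrite scaler_sumr; apply: eq_bigr => i _; rewrite scaler_sumr; apply: eq_bigr => j _.
rewrite rkE // (klinZ _ _ (Ds_lin hd _)) scalerA mulrC -scalerA; congr (_ *: _).
(* On this side the factors from H are the adjacent ones: p S(q) contracts first, and the identity
   in A remains. *)
transitivity (Ds (fun (p : H (a^-1^-1 * a^-1 * a^-1)%g) (q : H a^-1^-1%g) =>
  Dmul (el one (cf i : H c -> k^o)) (Dmul (el (ph a^-1 (mu p (sa q)) : H a^-1%g) (ep : H 1 -> k))
    (el one (fun y : H c^-1%g => cf j (si y))))) h').
  apply: eq_Ds => p q.
  transitivity (Dmul (el (ph a^-1 p : H a^-1%g) (cf i : H c -> k^o))
    (trl (Dc H) (invgK a) (Dant (el q (cf j : H c -> k^o))))); first by [].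
  rewrite (Dant_el _ (@cf_lin _ _ j)) trl_mul !trl_el (one_cst d) ?invgK //.
  rewrite -(Dmul_AH hd _ (@cf_lin _ _ i)) -!(DmulA hd) (DmulA hd (el (ph _ _) _)) (Dmul_HH hd).
  rewrite (ph_mu hd); last by grp.
  congr (Dmul _ (Dmul (el (mu _ _) _) _)).
  rewrite (cst_ph d); last by grp.
  rewrite -[sa q in RHS](cst_sa d (c := a^-1%g)); last by grp.
  by rewrite (ph_cst d) //; grp.
rewrite (Ds_antir hd (G := fun z => Dmul (el one (cf i : H c -> k^o))
   (Dmul (el (ph a^-1 z : H a^-1%g) (ep : H 1 -> k)) (el one (fun y : H c^-1%g => cf j (si y))))));
  [|by apply: klin_comp (r _ _) _; apply: klin_comp (l _ _) _; apply: (klin_comp (hel _)); lin|grp|grp].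
rewrite (ph_one hd); last by grp.
rewrite (Dmul1 hd) (Dmul_AA hd); [|exact: cf_lin|lin].
by rewrite /h' (ep_cst d) //; grp.
Qed.

End DoubleAntipode.

(** * The crossed structure of D(H), its formulas and the uniqueness of the product *)

Definition double_chc (k : fieldType) (pi : groupType) (H : pi -> vectType k)
    (d : chc_data (Hl H)) : chc_data (Dc H) := CHCData
  (@Dmul k pi H d) (fun a => el (oneH d) (ep d : H 1%g -> k)) (@Ddelta k pi H d)
  (@Deps k pi H d 1%g) (@Dphi k pi H d) (@Dant k pi H d).

Section DoubleFormulas.
Variables (k : fieldType) (pi : groupType) (H : pi -> vectType k).
Variable d : chc_data (Hl H).
Hypothesis hd : is_chc d.
Local Notation mu := (mu d).
Local Notation one := (oneH d).
Local Notation ep := (ep d).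
Local Notation ph := (ph d).
Local Notation si := (si d).
Local Notation Ds := (Ds d).
Local Notation Dmul := (Dmul d).
Local Notation Ddelta a b := (@Ddelta k pi H d a b).

Lemma phE b a c (e : (b * a * b^-1)%g = c) (x : H a) : trl (Hl H) e (cphi d b a x) = ph b x.
Proof. by rewrite trlE. Qed.

Lemma siE a (x : H a^-1%g) : sinv d x = si x.
Proof. by rewrite /si cst_id. Qed.

Lemma cDelta_Tw a e (W : lmodType k) (F : H a^-1%g -> H e -> H e -> W) (h : H a^-1%g) :
  (forall u v, klinear (fun m => F m u v)) -> (forall m v, klinear (fun u => F m u v)) ->
  (forall m u, klinear (F m u)) ->
  \sum_(p <- cDelta d (a^-1 * e * a)%g (a^-1 * e^-1)%g (trl (Hl H) (gD1 a e) h))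
    \sum_(q <- cDelta d a^-1%g e^-1%g p.2)
       F q.1 (sinv d q.2) (trl (Hl H) (gD2 a e) (cphi d a _ p.1)) = Tw d F h.
Proof.
move=> l1 l2 l3; rewrite /Tw trlE -(Ds_cst d _ h (gD1 a e)) -Ds_cDelta //; last by split; lin.
apply: eq_bigr => p _.
rewrite -(Ds_cDelta d (F := fun h2 h3 => F h2 (si h3) (ph a p.1))); last by split; lin.
by apply: eq_bigr => q _; rewrite phE siE.
Qed.

Lemma dmulE c e (f : dual H c) (f' : dual H e) x : dmul d f f' x = conv d f f' x.
Proof.
have hb : bilin (fun u v => (f u : k) *: (f' v : k^o)).
  have hf := klin_hom f; have hf' := klin_hom f'; split; lin.
rewrite /dmul -/(lf _) lfE; first exact: (Ds_cDelta d x hb).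
move=> t y z.
have E w : \sum_(p <- cDelta d c e w) (f p.1 : k) * (f' p.2 : k) =
    Ds (fun u v => (f u : k) *: (f' v : k^o)) w by exact: (Ds_cDelta d w hb).
by rewrite !E; apply: (Ds_lin hd).
Qed.

Lemma sandE e (f : dual H e) u w x : sand d f u w x = f (mu (mu u x) w).
Proof.
have hf := klin_hom f.
rewrite /sand -/(lf _) lfE //.
by change (klinear (fun x : H e => f (mu (mu u x) w) : k^o)); lin.
Qed.

Lemma Dprod_Tw a c e (h h2 : H a^-1%g) (f : dual H c) (f2 : dual H e) :
  Dprod_rhs d h h2 f f2 =
  Tw d (fun m u v => el (mu m h2) (conv d f (fun x => f2 (mu (mu u x) v)) : H (c * e)%g -> k^o)) h.
Proof.
have hf := klin_hom f; have hf2 := klin_hom f2.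
have hc (g : H e -> k^o) := @conv_lin k pi H d hd c e (c * e)%g f g.
pose F m u v := el (mu m h2) (conv d f (fun x => f2 (mu (mu u x) v)) : H (c * e)%g -> k^o).
rewrite -[RHS](cDelta_Tw (F := F)).
- rewrite /Dprod_rhs; apply: eq_bigr => p _; apply: eq_bigr => q _.
  rewrite dot_el /F /el; congr sgl; apply: eq_rk => x; rewrite dmulE.
  by apply: eq_Ds => u v; rewrite sandE.
- by move=> u v; rewrite /F; apply: (klin_comp (el_linl (hc _))); lin.
- move=> m v; rewrite /F; apply: (el_linr _ (f := fun u => conv d f (fun x => f2 (mu (mu u x) v)))) => // x.
  by rewrite /conv; lin.
- move=> m u; rewrite /F; apply: (el_linr _ (f := fun v => conv d f (fun x => f2 (mu (mu u x) v)))) => // x.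
  by rewrite /conv; lin.
Qed.

Lemma Dmul_dot a c e (h h2 : H a^-1%g) (f : dual H c) (f2 : dual H e) :
  Dmul (dot h f) (dot h2 f2) = Dprod_rhs d h h2 f f2.
Proof.
have hf := klin_hom f; have hf2 := klin_hom f2.
rewrite !dot_el (Dmul_el hd) // Dprod_Tw.
have hs := @sgl_lin _ _ H a (c * e)%g.
rewrite -(klin_TwF d _ _ hs); congr sgl; apply/lfunP => x; rewrite lfE; last exact: (Ds_lin hd).
have hx : klinear (fun X : 'Hom(H (c * e)%g, H a^-1%g) => X x) by lin.
rewrite [RHS](klin_TwF d _ _ hx).
transitivity (Tw d (fun m u v => Ds (fun x1 x2 => (f x1 : k) *:
   ((f2 (mu (mu u x2) v) : k) *: mu m h2)) x) h).
  rewrite Tw_Dswap; apply: eq_Ds => x1 x2.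
  exact: (klin_TwF d _ _ (klin_scale (f x1) (@klin_id _ _))).
apply: eq_Tw => m u v; rewrite rkE; last exact: (conv_lin hd).
by rewrite /conv -Ds_scalel; apply: eq_Ds => x1 x2; rewrite scalerA.
Qed.

Lemma Dmix_Tw a e (h : H a^-1%g) (f : dual H e) :
  Dmix_rhs d h f = Tw d (fun m u v => el m (fun x => f (mu (mu u x) v))) h.
Proof.
have hf := klin_hom f.
pose F (m : H a^-1%g) u v := el m ((fun x => f (mu (mu u x) v)) : H e -> k^o).
rewrite -[RHS](cDelta_Tw (F := F)).
- rewrite /Dmix_rhs; apply: eq_bigr => p _; apply: eq_bigr => q _.
  by rewrite dot_el /F /el; congr sgl; apply: eq_rk => x; rewrite sandE.
- by move=> u v; rewrite /F; apply: el_linl; lin.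
- by move=> m v; apply: (el_linr _ (f := fun u x => f (mu (mu u x) v))) => t; lin.
- by move=> m u; apply: (el_linr _ (f := fun v x => f (mu (mu u x) v))) => t; lin.
Qed.

Lemma Dmul_charE a : Dmul_char d (fun x y : Dc H a => Dmul x y).
Proof.
have he := @ep_lin _ _ _ _ hd 1%g.
split.
- by move=> c x y z; apply: (Dmul_linl hd).
- by move=> c x y z; apply: (Dmul_linr hd).
- exact: (DmulA hd).
- by move=> x; rewrite (dot_eps hd) (Dmul1 hd).
- by move=> x; rewrite (dot_eps hd) (DmulK1 hd).
- by move=> h h2; rewrite !(dot_eps hd) (Dmul_HH hd).
- move=> c e f f2; rewrite !dot_el (Dmul_AA hd); try exact: klin_hom.
  by rewrite /el; congr sgl; apply: eq_rk => x; rewrite dmulE.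
- by move=> c h f; rewrite (dot_eps hd) !dot_el (Dmul_AH hd) //; exact: klin_hom.
- by move=> c h f; rewrite (dot_eps hd) !dot_el (Dmul_HA hd) ?Dmix_Tw //; exact: klin_hom.
Qed.

(* The product is (1 # f)(h # eps)(1 # f2)(h2 # eps); moving h past f2 by the mixed relation
   leaves products in A followed by products in H. *)
Lemma char_prod a (m : Dc H a -> Dc H a -> Dc H a) : Dmul_char d m ->
  forall c e (h h2 : H a^-1%g) (f : dual H c) (f2 : dual H e),
  m (dot h f) (dot h2 f2) = Dprod_rhs d h h2 f f2.
Proof.
move=> hm c e h h2 f f2.
have l y : klinear (m^~ y) by move=> t u v; apply: (mc_linl hm).
have r x : klinear (m x) by move=> t u v; apply: (mc_linr hm).
rewrite -(mc_AH hm h f) -(mc_AH hm h2 f2) -(mc_assoc hm (dot _ f)).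
rewrite (mc_assoc hm (dot h (epsH d))) (mc_HA hm).
rewrite /Dmix_rhs /Dprod_rhs (klin_sum_arg _ _ _ (l _)) (klin_sum_arg _ _ _ (r _)).
apply: eq_bigr => p _.
rewrite (klin_sum_arg _ _ _ (l _)) (klin_sum_arg _ _ _ (r _)); apply: eq_bigr => q _.
rewrite -(mc_AH hm q.1) -(mc_assoc hm (dot _ (sand _ _ _ _))) (mc_Hmorph hm) (mc_assoc hm).
rewrite (mc_Amorph hm).
exact: (mc_AH hm).
Qed.

Lemma bilin_dot_eq a (W : lmodType k) (m m' : Dc H a -> Dc H a -> W) :
  bilin m -> bilin m' ->
  (forall c e (h h2 : H a^-1%g) (f : dual H c) (f2 : dual H e),
    m (dot h f) (dot h2 f2) = m' (dot h f) (dot h2 f2)) ->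
  forall x y, m x y = m' x y.
Proof.
move=> hm hm' E x y.
have D c (h : H a^-1%g) (u : H c -> k^o) : klinear u -> el h u = dot h (lf u : dual H c).
  by move=> hu; rewrite dot_el /el; congr sgl; apply: eq_rk => z; rewrite lfE.
apply: (Dc_eq_el (f := m^~ y) (g := m'^~ y)); [exact: hm.1|exact: hm'.1|].
move=> c h u hu; apply: (Dc_eq_el (f := m (el h u)) (g := m' (el h u))); [exact: hm.2|exact: hm'.2|].
by move=> e h2 u2 hu2; rewrite !D.
Qed.

Lemma Dmul_unique a (m : Dc H a -> Dc H a -> Dc H a) : Dmul_char d m ->
  forall x y, m x y = Dmul x y.
Proof.
move=> hm; apply: bilin_dot_eq.
- by split=> x t u v; [apply: (mc_linl hm)|apply: (mc_linr hm)].
- by split=> x; [apply: (Dmul_linl hd)|apply: (Dmul_linr hd)].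
by move=> c e h h2 f f2; rewrite (char_prod hm) Dmul_dot.
Qed.

(** For any representation L of Delta_*(f), the coefficients f(b_j b_i) are sums of l'(b_i)
    l''(b_j), where (l', l'') runs through L; summing over i and j reassembles l' and l''. *)
Lemma Ddelta_dot a b c (h : H (a * b)^-1%g) (f : dual H c) (L : seq (dual H c * dual H c)) :
  (forall x y : H c, \sum_(l <- L) (l.1 x : k) * (l.2 y : k) = f (cmul d c y x)) ->
  teq2 (Ddelta a b (dot h f))
      [seq (dot (trl (Hl H) (gE2 a b) (cphi d b _ p.1)) l.1, dot p.2 l.2)
         | p <- cDelta d (b^-1 * a^-1 * b)%g b^-1%g (trl (Hl H) (gE1 a b) h), l <- L].
Proof.
move=> hL; apply: teq2_intro => f' g' hf' hg'.
rewrite [RHS]big_allpairs_dep /= dot_el.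
pose B u v : k^o := (f' u : k) *: g' v.
have hf := klin_hom f.
have hB v : klinear (fun u => B u v) by rewrite /B; lin.
have hB2 u : klinear (fun v => B u v) by rewrite /B; lin.
have hel a' c' (u : dual H c') : klinear (fun h : H a'^-1%g => el h u).
  by apply: el_linl; exact: klin_hom.
rewrite (sum_Ddelta_sgl hd hB) DSE.
transitivity (Ds (fun (p : H (b^-1 * a^-1 * b)%g) (q : H b^-1%g) =>
   \sum_(l <- L) B (el (ph b p) l.1) (el q l.2)) h).
  transitivity (Ds (fun (p : H (b^-1 * a^-1 * b)%g) (q : H b^-1%g) => \sum_i \sum_j
     (f (mu (bs j) (bs i)) : k) *: B (el (ph b p) (cf i : H c -> k^o)) (el q (cf j : H c -> k^o))) h).
    rewrite Ds_sum; apply: eq_bigr => i _; rewrite Ds_sum; apply: eq_bigr => j _.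
    by rewrite rkE // (klinZ _ _ (Ds_lin hd _)) Ds_scale.
  apply: eq_Ds => p q.
  transitivity (\sum_i \sum_j \sum_(l <- L) ((l.1 (bs i) : k) * (l.2 (bs j) : k)) *:
      B (el (ph b p) (cf i : H c -> k^o)) (el q (cf j : H c -> k^o))).
    apply: eq_bigr => i _; apply: eq_bigr => j _.
    by rewrite -scaler_suml hL.
  under eq_bigr => i _ do rewrite exchange_big.
  rewrite exchange_big; apply: eq_bigr => l _ /=.
  rewrite (sum_el (ph b p) (klin_hom l.1)) (sum_el q (klin_hom l.2)).
  rewrite (klin_sum_arg _ _ _ (hB _)); apply: eq_bigr => i _.
  rewrite (klin_sum_arg _ _ _ (hB2 _)); apply: eq_bigr => j _.
  by rewrite (klinZ _ _ (hB _)) (klinZ _ _ (hB2 _)) scalerA.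
rewrite trlE -(Ds_cst d _ h (gE1 a b)) -Ds_cDelta; last by split; lin.
by apply: eq_bigr => p _; apply: eq_bigr => l _; rewrite phE.
Qed.

Lemma Deps_dot c (h : H 1^-1%g) (f : dual H c) :
  Deps d (dot h f) = ceps d (trl (Hl H) (invg1 pi) h) * f (cone d c).
Proof. by rewrite dot_el Deps_el ?trlE //; exact: klin_hom. Qed.

Lemma sstarE g (f : dual H g) y : sstar d f y = f (si y).
Proof.
have hf := klin_hom f.
rewrite /sstar -/(lf _) lfE ?siE // => c u v; rewrite !siE.
by rewrite (@si_lin _ _ _ _ g^-1%g g) hf.
Qed.

Lemma Dant_dot a c (h : H a^-1%g) (f : dual H c) :
  Dant d (dot h f) = Dmul
   (dot (trl (Hl H) (gF a) (cphi d a a (trl (Hl H) (invgK a) (cS d a^-1%g h)))) (epsH d))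
   (dot (trl (Hl H) (esym (invgK a)) (cone d a)) (sstar d f)).
Proof.
rewrite (dot_eps hd) !dot_el (Dant_el hd) ?phE; last exact: klin_hom.
congr (Dmul (el (ph a _) _) _); first by rewrite trlE.
rewrite trlE (one_cst d) ?invgK //; congr sgl; apply: eq_rk => y.
by rewrite sstarE.
Qed.

Lemma Dphi_dot b a c (h : H a^-1%g) (f : dual H c) :
  Dphi d b (dot h f) = dot (trl (Hl H) (gG b a) (cphi d b a^-1%g h)) (fphi d b f).
Proof.
have hf := klin_hom f.
rewrite !dot_el (Dphi_sgl hd) phE; congr sgl; apply/lfunP => y.
rewrite (phiHE hd) !rkE //; last exact: klin_hom.
rewrite (klinZ _ _ (@ph_lin _ _ _ _ hd _ _ _)); congr (_ *: _).
rewrite /fphi -/(lf _) lfE ?phE // => t u v; rewrite !phE.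
by rewrite (@ph_lin _ _ _ _ hd _ _ _) hf.
Qed.

Lemma double_chcP : is_chc (double_chc d).
Proof.
split=> /=.
- by move=> a c x y z; apply: (Dmul_linl hd).
- by move=> a c x y z; apply: (Dmul_linr hd).
- exact: (DmulA hd).
- by move=> a x; rewrite (Dmul1 hd).
- by move=> a x; rewrite (DmulK1 hd).
- exact: (Ddelta_lin hd).
- exact: (Ddelta_mul hd).
- exact: (Ddelta_one hd).
- exact: (Ddelta_coassoc hd).
- exact: (Deps_lin hd).
- exact: (Deps_mul hd).
- exact: (Deps_one hd).
- exact: (Dcounit_l hd).
- exact: (Dcounit_r hd).
- exact: (Dphi_lin hd).
- exact: (Dphi_mul hd).
- exact: (Dphi_one hd).
- exact: (Dphi_bij hd).
- exact: (Dphi_comp hd).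
- exact: (Dphi_Delta hd).
- exact: (Deps_phi hd).
- exact: (Dant_lin hd).
- exact: (Dantipode_l hd).
- exact: (Dantipode_r hd).
Qed.

Lemma double_formulas : D_formulas d (double_chc d).
Proof.
split=> /=.
- exact: Dmul_dot.
- by move=> a; rewrite (dot_eps hd).
- exact: Ddelta_dot.
- exact: Deps_dot.
- exact: Dant_dot.
- exact: Dphi_dot.
Qed.

End DoubleFormulas.

Theorem theorem5p3 (k : fieldType) (pi : groupType) (H : pi -> vectType k)
    (d : chc_data (Hl H)) :
  is_chc d ->
  exists D : chc_data (Dc H),
    [/\ is_chc D,
        D_formulas d D &
        forall a : pi,
          Dmul_char d (cmul D a) /\
          forall m : Dc H a -> Dc H a -> Dc H a,
            Dmul_char d m -> forall x y, m x y = cmul D a x y].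
Proof.
move=> hd; exists (double_chc d).
split; [exact: double_chcP|exact: double_formulas|move=> a].
by split; [exact: Dmul_charE|exact: Dmul_unique].
Qed.
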